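(* In the system with passive measurement ($\alpha=0$), the data set $\mathcal M_1(\omega)=\{u^\infty(\hat x,k,\omega)\,;\,\hat x\in\mathbb S^2,\ k\in\mathbb R_+\}$ recovers $\sigma^2$ almost surely, without knowledge of $V$ and $f$. That is: there is a map $\mathcal T$, defined on functions $\mathbb S^2\times\mathbb R_+\to\mathbb C$ and not depending on $\sigma,V,f$, such that for every admissible triple $(\sigma,V,f)$, $$\mathcal T\big(u^\infty(\cdot,\cdot,\omega)\big)=\sigma^2\quad\text{a.e. in }\mathbb R^3,\qquad\text{for }\mathbb P\text{-almost every }\omega\in\Omega .$$
   Context: Setting. $D\subset\mathbb R^3$ is a fixed bounded domain containing the origin. A triple $(\sigma,V,f)$ of real-valued measurable functions on $\mathbb R^3$ is admissible if $\sigma^2,V,f\in L^\infty(\mathbb R^3;\mathbb R)$ and all are supported in $D$. $(\Omega,\mathcal F,\mathbb P)$ is a complete probability space and $\mathbb R_+=(0,\infty)$. $\dot B=\dot B_x(\omega)$ is Gaussian white noise: $\varphi\mapsto\langle\dot B(\cdot,\omega),\varphi\rangle$ is linear on real $L^2(D)$, each $\langle\dot B,\varphi\rangle$ is a zero-mean real Gaussian random variable, $\mathbb E(\langle\dot B,\varphi\rangle\langle\dot B,\psi\rangle)=\int_D\varphi\psi\,dx$; it is extended complex-linearly to complex $\varphi$. The system considered (formally), with $k=\sqrt E>0$, $d\in\mathbb S^2$, $\alpha\in\{0,1\}$, is $(-\Delta-k^2+V)u=f+\sigma\dot B_x(\omega)$ in $\mathbb R^3$, $u=\alpha u^i+u^{sc}$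 with $u^i(x)=e^{\mathrm i k x\cdot d}$, and $u^{sc}$ satisfying the Sommerfeld radiation condition. Its far-field pattern is defined as follows. Let $\Phi_k(x,y)=\frac{e^{\mathrm i k|x-y|}}{4\pi|x-y|}$, $(\mathcal R_k\varphi)(x)=\int_{\operatorname{supp}\varphi}\Phi_k(x,y)\varphi(y)\,dy$, and $\mathcal R_k(\sigma\dot B)(x)=\langle\dot B(\cdot,\omega),\sigma(\cdot)\Phi_k(x,\cdot)\rangle$. Then $$u^\infty(\hat x,k,d,\omega)=\frac1{4\pi}\int_D e^{-\mathrm i k\hat x\cdot y}\,(I-V\mathcal R_k)^{-1}(\alpha Vu^i-f-\sigma\dot B_y)\,dy,\qquad \hat x\in\mathbb S^2,$$ where $(I-V\mathcal R_k)^{-1}$ is the inverse on $L^2(D)$ and the noise contribution $\int_D e^{-\mathrm i k\hat x\cdot y}(I-V\mathcal R_k)^{-1}(\sigma\dot B_y)\,dy$ means the random variable $$\langle\dot B,\sigma e^{-\mathrm i k\hat x\cdot(\cdot)}\rangle+\int_D e^{-\mathrm i k\hat x\cdot y}\,\big[(I-V\mathcal R_k)^{-1}V\mathcal R_k(\sigma\dot B)\big](y)\,dy .$$ A version of this noise contribution that is jointly measurable in $(\hat x,k,\omega)$ is used. When $\alpha=0$ (passive measurement) $u^\infty$ does not depend on $d$ and is written $u^\infty(\hat x,k,\omega)$. *)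

(* Defs.v *)
From mathcomp Require Import all_boot all_order all_algebra.
From mathcomp Require Import all_classical all_reals all_analysis.
From mathcomp Require Export complex.

Set Implicit Arguments.
Unset Strict Implicit.
Unset Printing Implicit Defensive.

Import Order.TTheory GRing.Theory Num.Theory.
Import numFieldNormedType.Exports.

Local Open Scope classical_set_scope.
Local Open Scope ring_scope.
Local Open Scope complex_scope.

(* R^3 carries the product (= Borel) sigma-algebra and the product topology;
   the library norm on this type is the sup norm, hence [enorm] below.
   [measurableTypeR R] is R with the display of [lebesgue_measure]. *)
Notation R3 R :=
  (measurableTypeR R * measurableTypeR R * measurableTypeR R)%type.

Definition leb3 (R : realType) : {measure set (R3 R) -> \bar R} :=
  ((@lebesgue_measure R \x @lebesgue_measure R) \x @lebesgue_measure R)%E.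

Definition dot3 (R : realType) (x y : R3 R) : R :=
  (x.1.1 : R) * y.1.1 + (x.1.2 : R) * y.1.2 + (x.2 : R) * y.2.

Definition enorm (R : realType) (x : R3 R) : R := Num.sqrt (dot3 x x).

Definition sphere (R : realType) : Type := {x : R3 R | enorm x = 1}.

Definition posreal (R : realType) : Type := {k : R | 0 < k}.

Definition bounded_domain (R : realType) (D : set (R3 R)) : Prop :=
  [/\ open D, connected D, D !=set0 & bounded_set D].

Definition expi (R : realType) (t : R) : R[i] := cos t +i* sin t.

Definition cintegral (R : realType) (D : set (R3 R)) (f : R3 R -> R[i]) : R[i] :=
  (\int[@leb3 R]_(x in D) complex.Re (f x)) +i* (\int[@leb3 R]_(x in D) complex.Im (f x)).

(* Elements of L^2(D) are represented by functions on R^3 whose values outside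
   D are irrelevant: [f \_ D] is the extension by zero of the restriction. *)
Definition L2 (R : realType) (D : set (R3 R)) (f : R3 R -> R) : Prop :=
  (f \_ D) \in Lfun (@leb3 R) 2%:E.

Definition L2C (R : realType) (D : set (R3 R)) (f : R3 R -> R[i]) : Prop :=
  L2 D (fun x => complex.Re (f x)) /\ L2 D (fun x => complex.Im (f x)).

Definition supported_in (R : realType) (D : set (R3 R)) (f : R3 R -> R) : Prop :=
  {ae @leb3 R, forall x, ~ D x -> f x = 0}.

(* Only sigma^2, not sigma, is required to be in L^oo. *)
Definition admissible (R : realType) (D : set (R3 R)) (sigma V f : R3 R -> R)
    : Prop :=
  [/\ measurable_fun [set: R3 R] sigma,
      (fun x => sigma x ^+ 2) \in Lfun (@leb3 R) +oo%E,
      V \in Lfun (@leb3 R) +oo%E,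
      f \in Lfun (@leb3 R) +oo%E
    & [/\ supported_in D sigma, supported_in D V & supported_in D f]].

(* [normal_prob 0 s] is a Gaussian law only for s != 0; the degenerate
   zero-mean Gaussian is the Dirac mass at 0. *)
Definition centered_gaussian d (Omega : measurableType d) (R : realType)
    (P : probability Omega R) (X : {RV P >-> R}) : Prop :=
  exists2 s : R, 0 <= s &
    forall A : set R, measurable A ->
      distribution P X A = if s == 0 then \d_(0 : R) A else normal_prob 0 s A.

(* [B phi] is the random variable <B, phi>; its value is meaningful only when
   phi represents an element of the real space L^2(D). *)
Definition white_noise d (Omega : measurableType d) (R : realType)
    (P : probability Omega R) (D : set (R3 R))
    (B : (R3 R -> R) -> {RV P >-> R}) : Prop :=
  [/\ forall phi psi, L2 D phi -> L2 D psi ->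
        {ae @leb3 R, forall x, D x -> phi x = psi x} ->
        forall w, B phi w = B psi w,
      forall (a : R) phi psi, L2 D phi -> L2 D psi ->
        forall w, B (fun x => a * phi x + psi x) w = a * B phi w + B psi w,
      forall phi, L2 D phi -> centered_gaussian (B phi)
    & forall phi psi, L2 D phi -> L2 D psi ->
        'E_P[fun w => (B phi w * B psi w)%R]%E =
        (\int[@leb3 R]_(x in D) (phi x * psi x))%:E ].

Definition noiseC d (Omega : measurableType d) (R : realType)
    (P : probability Omega R) (B : (R3 R -> R) -> {RV P >-> R})
    (phi : R3 R -> R[i]) (w : Omega) : R[i] :=
  B (fun x => complex.Re (phi x)) w +i* B (fun x => complex.Im (phi x)) w.

Definition Phi (R : realType) (k : R) (x y : R3 R) : R[i] :=
  expi (k * enorm (x - y)) / (4 * pi * enorm (x - y))%:C.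

(* R_k on L^2(D): such a phi is supported in D, so that the integral over
   supp phi is the integral over D. *)
Definition Rk (R : realType) (D : set (R3 R)) (k : R) (phi : R3 R -> R[i])
    (x : R3 R) : R[i] :=
  cintegral D (fun y => Phi k x y * phi y).

(* (I - V R_k)^-1 g, i.e. the w in L^2(D) such that w - V R_k w = g in L^2(D);
   [xget] selects a representative of it. *)
Definition inv_I_VRk (R : realType) (D : set (R3 R)) (V : R3 R -> R) (k : R)
    (g : R3 R -> R[i]) : R3 R -> R[i] :=
  xget (fun=> 0) [set w : R3 R -> R[i] | L2C D w /\
    {ae @leb3 R, forall x, D x -> w x - (V x)%:C * Rk D k w x = g x}].

(* A version, jointly measurable in (x, omega), of the random field
   x |-> R_k(sigma B)(x) = <B, sigma Phi_k(x, .)>; joint measurability is what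
   makes almost all of its paths measurable functions of x. *)
Definition is_Rk_noise d (Omega : measurableType d) (R : realType)
    (P : probability Omega R) (B : (R3 R -> R) -> {RV P >-> R})
    (sigma : R3 R -> R) (k : R) (Z : R3 R -> Omega -> R[i]) : Prop :=
  [/\ measurable_fun [set: R3 R * Omega] (fun z => complex.Re (Z z.1 z.2)),
      measurable_fun [set: R3 R * Omega] (fun z => complex.Im (Z z.1 z.2))
    & forall x, {ae P, forall w,
        Z x w = noiseC B (fun y => (sigma y)%:C * Phi k x y) w}].

(* N is a version, jointly measurable in (xhat, k, omega), of the noise
   contribution "int_D e^{-i k xhat.y} (I - V R_k)^-1 (sigma B) dy". *)
Definition is_noise_contribution d (Omega : measurableType d) (R : realType)
    (P : probability Omega R) (D : set (R3 R))
    (B : (R3 R -> R) -> {RV P >-> R}) (sigma V : R3 R -> R)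
    (N : R3 R -> R -> Omega -> R[i]) : Prop :=
  let S2RO : set (R3 R * measurableTypeR R * Omega) :=
    [set z | enorm z.1.1 = 1 /\ 0 < z.1.2] in
  [/\ measurable_fun S2RO (fun z => complex.Re (N z.1.1 z.1.2 z.2)),
      measurable_fun S2RO (fun z => complex.Im (N z.1.1 z.1.2 z.2))
    & forall k : R, 0 < k ->
        exists2 Z, is_Rk_noise B sigma k Z &
        forall xhat : R3 R, enorm xhat = 1 ->
        {ae P, forall w, N xhat k w =
           noiseC B (fun y => (sigma y)%:C * expi (- (k * dot3 xhat y))) w
           + cintegral D (fun y => expi (- (k * dot3 xhat y)) *
               inv_I_VRk D V k (fun x => (V x)%:C * Z x w) y)}].

Definition incident (R : realType) (k : R) (dir x : R3 R) : R[i] :=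
  expi (k * dot3 x dir).

Definition far_field (Omega : Type) (R : realType) (D : set (R3 R))
    (V f : R3 R -> R) (N : R3 R -> R -> Omega -> R[i]) (alpha : bool)
    (xhat : R3 R) (k : R) (dir : R3 R) (w : Omega) : R[i] :=
  ((4 * pi)^-1)%:C *
  (cintegral D (fun y => expi (- (k * dot3 xhat y)) *
     inv_I_VRk D V k
       (fun x => alpha%:R * ((V x)%:C * incident k dir x) - (f x)%:C) y)
   - N xhat k w).

(* Main.v *)
From HB Require Import structures.
Require Import Defs.
From mathcomp Require Import all_boot all_order all_algebra.
From mathcomp Require Import all_classical all_reals all_analysis.
From mathcomp Require Import measurable_realfun ess_sup_inf ring lra zify.

(** The noise cannot be averaged out over realizations, so it is averaged over
directions: at one large wavenumber k, products of two far-field values are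
averaged over 2^n pairs of directions, and n tends to infinity along with k.

Put p = k xhat. Up to the factor 1/(4 pi), the far field at p is
- <B, sigma e^{-i p.y}> plus the integral over D of e^{-i p.y} w(y), where the
function w = (I - V R_k)^-1 (- f) - (I - V R_k)^-1 (V R_k(sigma B)) depends on k
and on the realization but not on the direction.

Fix a frequency xi, and 2^n points p_i of the sphere of radius k such that
every p_i - xi is again on that sphere. If D lies in [-L, L]^3 and the third
coordinates of the p_i are distinct positive multiples of 1/L, then the waves
at the p_i are orthogonal on a box of height 2 pi L which contains D, and the
Bessel inequality ([bessel_strip]) gives
sum_i |int_D e^{-i p_i.y} w|^2 <= C ||w||^2. It is used twice.
- The terms that contain w are negligible in mean square over i, as soon as
  2^-n ||w||^2 tends to 0. No regularity of V, f or sigma enters.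
- The covariances of the Gaussian variables <B, sigma e^{-i p_i.y}> have
  bounded square sums, so that averages of their products concentrate with
  variance C 2^-n ([lln_square], [gaussian_product_average]).
Hence the average of u(p_i) conj(u(p_i - xi)) tends almost surely to
(4 pi)^-2 times the integral of sigma^2 e^{-i xi.y} ([correlation_limit]).

The size of w is controlled by letting k run through wavenumbers at which R_k,
which does not involve V, has small norm on L^2(D) ([trig_kernel_small]). They
exist because the squared Hilbert-Schmidt norms of R_k^T R_k tend to 0 in
Cesaro mean: this is Wiener's lemma, which applies because the level sets of
|x - y| + |x - y'| and |x - y| - |x - y'| are null. At such k the
inverse has norm at most 2, whereas R_k(sigma B) has a second moment bounded
independently of k, so that 2^-n ||w||^2 is almost surely summable.

The frequencies xi range over the shifted lattice of the
(m1, m2 + 1/2, m3)/L. The shift makes the second coordinate nonzero, which is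
what allows the p_i to be found with prescribed third coordinates, and the
integrals of g e^{-i xi.y} over this lattice still determine a bounded g on D
([shifted_fourier_unique]): the bounded functions by which g may be multiplied
without losing the orthogonality to all these waves form an algebra that is
closed under bounded limits and contains the trigonometric polynomials in the
y_j/L, therefore the indicators of all Borel sets. There are countably many
frequencies, so one null set of realizations suffices, and the recovery map
selects any function that has the observed limits. *)

Set Implicit Arguments.
Unset Strict Implicit.
Unset Printing Implicit Defensive.

Import Order.TTheory GRing.Theory Num.Theory.
Import numFieldNormedType.Exports.

Local Open Scope classical_set_scope.
Local Open Scope ring_scope.

(** * Square-integrable functions and the Bessel inequality *)

Section SquareIntegrable.
Context d (T : measurableType d) (R : realType).
Variable mu : {measure set T -> \bar R}.
Implicit Types f g h : T -> R.

Definition intg f := mu.-integrable [set: T] (EFin \o f).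

Definition l2 f :=
  measurable_fun [set: T] f /\ intg (fun x => f x ^+ 2).

Definition dot f g : R := \int[mu]_x (f x * g x).

Lemma intg_meas f : intg f -> measurable_fun [set: T] f.
Proof. by move=> /integrableP[/measurable_EFinP]. Qed.

Lemma intg_le f g : measurable_fun [set: T] f -> intg g ->
  (forall x, `|f x| <= g x) -> intg f.
Proof.
move=> mf ig fg; apply: (@le_integrable _ _ _ _ _ _ _ (EFin \o g)) => //.
  exact/measurable_EFinP.
by move=> x _ /=; rewrite lee_fin (le_trans (fg x))// ler_norm.
Qed.

Lemma intgD f g : intg f -> intg g -> intg (fun x => f x + g x).
Proof. by move=> fi gi; exact: (integrableD measurableT fi gi). Qed.

Lemma intgZ f a : intg f -> intg (fun x => a * f x).
Proof. by move=> fi; exact: (integrableZl measurableT a fi). Qed.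

Lemma intgN f : intg f -> intg (fun x => - f x).
Proof.
by move=> /(intgZ (-1)); apply: eq_integrable => // x _; rewrite /= mulN1r.
Qed.

Lemma intgB f g : intg f -> intg g -> intg (fun x => f x - g x).
Proof. by move=> ? ?; apply: intgD => //; exact: intgN. Qed.

Lemma intg0 : intg (fun=> 0).
Proof. exact: integrable0. Qed.

Lemma intg_sum n (F : nat -> T -> R) :
  (forall i, (i < n)%N -> intg (F i)) -> intg (fun x => \sum_(i < n) F i x).
Proof.
elim: n => [|n IH] H.
  by apply: eq_integrable intg0 => // x _; rewrite /= big_ord0.
have : intg (fun x => \sum_(i < n) F i x + F n x).
  by apply: intgD; [apply: IH => i /ltnW; exact: H|exact: H].
by apply: eq_integrable => // x _; rewrite /= big_ord_recr.
Qed.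

Lemma Rintegral_sum n (F : nat -> T -> R) : (forall i, (i < n)%N -> intg (F i)) ->
  \int[mu]_x (\sum_(i < n) F i x) = \sum_(i < n) \int[mu]_x F i x.
Proof.
elim: n => [|n IH] H.
  rewrite big_ord0 (_ : (fun x => _) = cst 0) ?Rintegral_cst ?mul0r//.
  by apply/funext => x; rewrite big_ord0.
rewrite big_ord_recr/= -IH; last by move=> i /ltnW; exact: H.
rewrite -RintegralD//; last 2 first.
- by apply: intg_sum => i /ltnW; exact: H.
- exact: H.
by apply: eq_Rintegral => x _; rewrite big_ord_recr.
Qed.

Lemma l2_meas f : l2 f -> measurable_fun [set: T] f. Proof. by case. Qed.

Lemma l2_mul f g : l2 f -> l2 g -> intg (fun x => f x * g x).
Proof.
move=> [mf f2] [mg g2]; apply: intg_le (intgD f2 g2) _ => [|x].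
  exact: measurable_funM.
rewrite normrM -[f x ^+ 2]real_normK ?num_real// -[g x ^+ 2]real_normK ?num_real//.
have := sqr_ge0 (`|f x| - `|g x|); nra.
Qed.

Lemma l2D f g : l2 f -> l2 g -> l2 (fun x => f x + g x).
Proof.
move=> lf lg; split; first by apply: measurable_funD; [case: lf|case: lg].
have : intg (fun x => f x ^+ 2 + g x ^+ 2 + 2 * (f x * g x)).
  by apply: intgD; [apply: intgD; [case: lf|case: lg]|exact/intgZ/l2_mul].
by apply: eq_integrable => // x _ /=; congr EFin; ring.
Qed.

Lemma l2Z f a : l2 f -> l2 (fun x => a * f x).
Proof.
move=> [mf f2]; split; first exact: measurable_funM.
by have := intgZ (a ^+ 2) f2; apply: eq_integrable => // x _ /=; rewrite exprMn.
Qed.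

Lemma l2N f : l2 f -> l2 (fun x => - f x).
Proof.
by move=> /(l2Z (-1)); congr l2; apply/funext => x; rewrite mulN1r.
Qed.

Lemma l2B f g : l2 f -> l2 g -> l2 (fun x => f x - g x).
Proof. by move=> ? ?; apply: l2D => //; exact: l2N. Qed.

Lemma l2_0 : l2 (fun=> 0).
Proof.
split; first exact: measurable_cst.
by apply: eq_integrable intg0 => // x _; rewrite /= expr0n.
Qed.

Lemma l2_sum n (F : nat -> T -> R) :
  (forall i, (i < n)%N -> l2 (F i)) -> l2 (fun x => \sum_(i < n) F i x).
Proof.
elim: n => [|n IH] H.
  by have := l2_0; congr l2; apply/funext => x; rewrite big_ord0.
have : l2 (fun x => \sum_(i < n) F i x + F n x).
  by apply: l2D; [apply: IH => i /ltnW; exact: H|exact: H].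
by congr l2; apply/funext => x; rewrite big_ord_recr.
Qed.

Lemma l2_bound f g C : l2 f -> measurable_fun [set: T] g ->
  (forall x, `|g x| <= C) -> l2 (fun x => g x * f x).
Proof.
move=> [mf f2] mg gC; split; first exact: measurable_funM.
apply: intg_le (intgZ (C ^+ 2) f2) _ => [|x].
  exact/measurable_funX/measurable_funM.
rewrite ger0_norm ?sqr_ge0// exprMn ler_wpM2r ?sqr_ge0//.
by rewrite -[g x ^+ 2]real_normK ?num_real// ler_sqr ?nnegrE// (le_trans _ (gC x)).
Qed.

Lemma dotC f g : dot f g = dot g f.
Proof. by apply: eq_Rintegral => x _; rewrite mulrC. Qed.

Lemma dotDl f g h : l2 f -> l2 g -> l2 h ->
  dot (fun x => f x + g x) h = dot f h + dot g h.
Proof.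
move=> lf lg lh; rewrite /dot -RintegralD//; [|exact: l2_mul|exact: l2_mul].
by apply: eq_Rintegral => x _; rewrite mulrDl.
Qed.

Lemma dotZl f h a : l2 f -> l2 h -> dot (fun x => a * f x) h = a * dot f h.
Proof.
move=> lf lh; rewrite /dot -RintegralZl//; last exact: l2_mul.
by apply: eq_Rintegral => x _; rewrite mulrA.
Qed.

Lemma dotDr f g h : l2 f -> l2 g -> l2 h ->
  dot h (fun x => f x + g x) = dot h f + dot h g.
Proof. by move=> lf lg lh; rewrite dotC dotDl// !(dotC h). Qed.

Lemma dotZr f h a : l2 f -> l2 h -> dot h (fun x => a * f x) = a * dot h f.
Proof. by move=> lf lh; rewrite dotC dotZl// dotC. Qed.

Lemma dotBl f g h : l2 f -> l2 g -> l2 h ->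
  dot (fun x => f x - g x) h = dot f h - dot g h.
Proof.
move=> lf lg lh.
rewrite (_ : (fun x => _) = (fun x => f x + (-1) * g x)); last first.
  by apply/funext => x; rewrite mulN1r.
by rewrite dotDl ?dotZl ?mulN1r//; exact: l2Z.
Qed.

Lemma dotBr f g h : l2 f -> l2 g -> l2 h ->
  dot h (fun x => f x - g x) = dot h f - dot h g.
Proof. by move=> lf lg lh; rewrite dotC dotBl// !(dotC h). Qed.

Lemma dot_suml n (F : nat -> T -> R) h : (forall i, (i < n)%N -> l2 (F i)) ->
  l2 h -> dot (fun x => \sum_(i < n) F i x) h = \sum_(i < n) dot (F i) h.
Proof.
move=> lF lh; rewrite /dot.
rewrite -(@Rintegral_sum n (fun i x => F i x * h x)); last first.
  by move=> i /lF lFi; exact: (l2_mul lFi lh).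
by apply: eq_Rintegral => x _; rewrite mulr_suml.
Qed.

Lemma dot_ge0 f : 0 <= dot f f.
Proof. by apply: Rintegral_ge0 => x _; rewrite -expr2 sqr_ge0. Qed.

Lemma dotE f : (\int[mu]_x (f x ^+ 2))%R = dot f f.
Proof. by apply: eq_Rintegral => x _; rewrite expr2. Qed.

Lemma dot_fineE f : l2 f -> (\int[mu]_x (f x ^+ 2)%:E)%E = (dot f f)%:E.
Proof.
move=> [_ f2]; rewrite -dotE /Rintegral fineK//.
exact: integrable_fin_num f2.
Qed.

Lemma l2P f : measurable_fun [set: T] f ->
  (\int[mu]_x (f x ^+ 2)%:E < +oo)%E -> l2 f.
Proof.
move=> mf f2; split => //; apply/integrableP; split.
  exact/measurable_EFinP/measurable_funX.
by under eq_integral do rewrite /= ger0_norm ?sqr_ge0//.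
Qed.

Lemma dot_mono f g : l2 f -> l2 g -> (forall x, `|f x| <= `|g x|) ->
  dot f f <= dot g g.
Proof.
move=> lf lg fg; rewrite /dot; apply: le_Rintegral => //.
- exact: (l2_mul lf lf).
- exact: (l2_mul lg lg).
by move=> x _; rewrite -!expr2 -[f x ^+ 2]real_normK ?num_real//
  -[g x ^+ 2]real_normK ?num_real// ler_sqr ?nnegrE.
Qed.

(** The quadratic polynomial t |-> |f + t g|^2 is nonnegative; the case where
g has norm zero needs a choice of t of its own. *)
Lemma cauchy_schwarz f g : l2 f -> l2 g ->
  dot f g ^+ 2 <= dot f f * dot g g.
Proof.
move=> lf lg.
have H t : 0 <= dot f f + 2 * t * dot f g + t ^+ 2 * dot g g.
  have := dot_ge0 (fun x => f x + t * g x).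
  have lt := l2Z t lg; have lft := l2D lf lt.
  rewrite dotDl// !dotDr// !dotZr// !dotZl// (dotC g f).
  suff -> : dot f f + t * dot f g + (t * dot f g + t * (t * dot g g)) =
    dot f f + 2 * t * dot f g + t ^+ 2 * dot g g by [].
  by ring.
have := dot_ge0 g; rewrite le_eqVlt => /predU1P[g0|g0].
  rewrite -g0 mulr0; have [->|fg0] := eqVneq (dot f g) 0; first by rewrite expr0n.
  have := H (- (dot f f + 1) / (2 * dot f g)); rewrite -g0 mulr0 addr0.
  rewrite (_ : 2 * _ * _ = - (dot f f + 1)); first lra.
  by field; exact: fg0.
have := H (- dot f g / dot g g).
rewrite (_ : _ + _ = dot f f - dot f g ^+ 2 / dot g g); last first.
  by field; rewrite gt_eqF.
by rewrite subr_ge0 ler_pdivrMr.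
Qed.

Lemma dotD_le f g : l2 f -> l2 g ->
  dot (fun x => f x + g x) (fun x => f x + g x) <= 2 * dot f f + 2 * dot g g.
Proof.
move=> lf lg.
have lfg := l2D lf lg; have := dot_ge0 (fun x => f x - g x).
have lfmg := l2B lf lg.
rewrite (dotDl lf lg lfg) (dotDr lf lg lf) (dotDr lf lg lg) (dotBl lf lg lfmg).
rewrite (dotBr lf lg lf) (dotBr lf lg lg) (dotC g f); lra.
Qed.

(** Expand the square of g - s, where s = sum_i c^-1 (g, v_i) v_i. The norms of
the v_i are only bounded by c, so s need not be the orthogonal projection, but
the expansion still has the right sign. *)
Lemma bessel n (v : nat -> T -> R) c g : 0 < c ->
  (forall i, (i < n)%N -> l2 (v i)) ->
  (forall i j, (i < n)%N -> (j < n)%N -> i != j -> dot (v i) (v j) = 0) ->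
  (forall i, (i < n)%N -> dot (v i) (v i) <= c) ->
  l2 g -> \sum_(i < n) dot g (v i) ^+ 2 <= c * dot g g.
Proof.
move=> c0 lv ov nv lg.
pose s x := \sum_(i < n) (c^-1 * dot g (v i)) * v i x.
have ls : l2 s by apply: (@l2_sum n (fun i x => (c^-1 * dot g (v i)) * v i x)) => i /lv; exact: l2Z.
have gs h : l2 h -> dot h s = \sum_(i < n) c^-1 * dot g (v i) * dot h (v i).
  move=> lh; rewrite dotC /s.
  rewrite (@dot_suml n (fun i x => (c^-1 * dot g (v i)) * v i x))//; last first.
    by move=> i /lv; exact: l2Z.
  apply: eq_bigr => i _; rewrite dotZl//; first by rewrite (dotC h).
  exact: lv.
have vs (i : 'I_n) : dot s (v i) <= `|dot g (v i)| /\
    dot s (v i) * dot g (v i) <= dot g (v i) ^+ 2.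
  rewrite dotC gs; last exact: lv.
  rewrite (bigD1 i)//= big1 ?addr0; last first.
    move=> j ji; rewrite (ov i j) ?mulr0//; by rewrite eq_sym.
  have := nv i (ltn_ord i); have := dot_ge0 (v i).
  move: (dot (v i) (v i)) (dot g (v i)) => b a b0 bc.
  have cb : c^-1 * b <= 1 by rewrite ler_pdivrMl// mulr1.
  have cb0 : 0 <= c^-1 * b by rewrite mulr_ge0// invr_ge0 ltW.
  split; last by rewrite (_ : _ * a = (c^-1 * b) * a ^+ 2);
    [have := sqr_ge0 a; nra|ring].
  rewrite (le_trans (ler_norm _))// mulrAC normrM (ger0_norm cb0).
  have := normr_ge0 a; nra.
have := dot_ge0 (fun x => g x - s x).
rewrite dotBl//; last exact: l2B.
rewrite !dotBr// (dotC s g).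
have -> : dot g s = c^-1 * \sum_(i < n) dot g (v i) ^+ 2.
  by rewrite gs// mulr_sumr; apply: eq_bigr => i _; rewrite expr2 mulrA.
have ss : dot s s <= c^-1 * \sum_(i < n) dot g (v i) ^+ 2.
  rewrite gs// mulr_sumr; apply: ler_sum => i _.
  rewrite -mulrA ler_pM2l ?invr_gt0// mulrC; exact: (vs i).2.
move=> H; have : c^-1 * \sum_(i < n) dot g (v i) ^+ 2 <= dot g g by lra.
by rewrite ler_pdivrMl.
Qed.

End SquareIntegrable.

(** * Cesaro means of trigonometric integrals *)

Section Cesaro.
Variable R : realType.

(** Multiplied by 2 sin(a/2), the sum telescopes. *)
Lemma sum_cos_bound (a b : R) n : sin (a / 2) != 0 ->
  `|\sum_(k < n) cos (k%:R * a + b)| <= `|sin (a / 2)|^-1.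
Proof.
move=> s0.
have -> : \sum_(k < n) cos (k%:R * a + b) =
    (sin (n%:R * a + b - a / 2) - sin (b - a / 2)) / (2 * sin (a / 2)).
  elim: n => [|n IH].
    by rewrite big_ord0 mul0r add0r subrr mul0r.
  rewrite big_ord_recr/= IH.
  have -> : n.+1%:R * a + b - a / 2 = (n%:R * a + b) + a / 2.
    by rewrite -natr1; field.
  rewrite (sinD _ (a / 2)) (sinB (n%:R * a + b)); field; exact: s0.
rewrite normrM normfV normrM (ger0_norm (_ : 0 <= (2:R)))// invfM mulrA.
rewrite ler_piMl ?invr_ge0// ler_pdivrMr// mul1r.
by rewrite (le_trans (ler_normB _ _))//
  (_ : (2:R) = 1 + 1)// lerD// sin_max.
Qed.

Lemma cesaro_cos (a b : R) : sin (a / 2) != 0 ->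
  (fun n => n.+1%:R^-1 * \sum_(k < n.+1) cos (k%:R * a + b)) @ \oo --> (0 : R).
Proof.
move=> s0; apply/norm_cvg0P.
have h : (fun n => `|sin (a / 2)|^-1 * harmonic n) @ \oo --> (0 : R).
  rewrite -[X in _ --> X](mulr0 `|sin (a / 2)|^-1).
  by apply: cvgM; [exact: cvg_cst|exact: cvg_harmonic].
apply: (squeeze_cvgr _ (cvg_cst 0) h); near=> n => /=.
rewrite normr_ge0/= normrM ger0_norm ?invr_ge0// mulrC ler_wpM2r ?invr_ge0//.
exact: sum_cos_bound.
Unshelve. all: by end_near.
Qed.

Lemma sin_eq0_nat (z : R) : sin z = 0 -> exists n : nat, `|z| = n%:R * pi.
Proof.
move=> sz; have sz' : sin `|z| = 0.
  by have [z0|z0] := leP 0 z;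
    [rewrite ger0_norm|rewrite ltr0_norm// sinN sz oppr0].
have p0 := @pi_gt0 R.
pose n := Num.truncn (`|z| / pi); exists n.
have /andP[n1 n2] : n%:R <= `|z| / pi < n.+1%:R.
  by apply: truncn_itv; rewrite divr_ge0// ltW.
have sn m x : sin (x + m%:R * pi) = 0 -> sin x = 0 :> R.
  elim: m x => [|m IH] x; first by rewrite mul0r addr0.
  by rewrite -natr1 mulrDl mul1r addrA sinDpi => /eqP; rewrite oppr_eq0 => /eqP/IH.
have := sn n (`|z| - n%:R * pi); rewrite subrK => /(_ sz') s0.
apply/eqP; rewrite -subr_eq0; apply: contraT => nz.
have : 0 < sin (`|z| - n%:R * pi).
  apply: sin_gt0_pi; rewrite lt_neqAle eq_sym nz subr_ge0 -ler_pdivlMr// n1/=.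
  by move: n2; rewrite ltr_pdivrMr// -natr1 mulrDl mul1r ltrBlDr addrC.
by rewrite s0 ltxx.
Qed.

End Cesaro.

Section RealDominated.
Context d (T : measurableType d) (R : realType).
Variable mu : {measure set T -> \bar R}.

Lemma Rintegral_dominated_cvg (F : nat -> T -> R) (f g : T -> R) :
  (forall n, measurable_fun [set: T] (F n)) -> measurable_fun [set: T] f ->
  {ae mu, forall x, F ^~ x @ \oo --> f x} -> intg mu g ->
  (forall n x, `|F n x| <= g x) ->
  (fun n => \int[mu]_x F n x) @ \oo --> \int[mu]_x f x.
Proof.
move=> mF mf Ff ig Fg.
have [| | | | |If _ H] := @dominated_convergence _ _ _ mu setT measurableT
  (fun n => EFin \o F n) (EFin \o f) (EFin \o g).
- by move=> n; exact/measurable_EFinP.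
- exact/measurable_EFinP.
- apply: filterS Ff => x Ffx _ /=.
  by apply/fine_cvgP; split; [exact: nearW|exact: Ffx].
- exact: ig.
- by apply: aeW => x n _ /=; rewrite lee_fin.
apply: fine_cvg; rewrite [X in _ --> X](_ : _ = (\int[mu]_x (f x)%:E)%E); last first.
  by rewrite fineK//; exact: (integrable_fin_num measurableT If).
exact: H.
Qed.

End RealDominated.

Section ProdIntegral.
Context d1 d2 (T1 : measurableType d1) (T2 : measurableType d2) (R : realType).
Variable m1 : {sigma_finite_measure set T1 -> \bar R}.
Variable m2 : {sigma_finite_measure set T2 -> \bar R}.

Lemma intg_prod f g : intg m1 f -> intg m2 g ->
  intg (m1 \x m2)%E (fun z => f z.1 * g z.2).
Proof.
move=> fi gi; have mf := intg_meas fi; have mg := intg_meas gi.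
have mfg : measurable_fun [set: T1 * T2] (fun z => f z.1 * g z.2).
  by apply: measurable_funM; exact: measurableT_comp.
apply/integrable12ltyP; first exact/measurable_EFinP.
rewrite (eq_integral (fun x => `|f x|%:E * \int[m2]_y `|g y|%:E)%E); last first.
  move=> x _; rewrite -ge0_integralZl//.
  - by apply: eq_integral => y _; rewrite /= normrM EFinM.
  - exact/measurable_EFinP/measurableT_comp.
rewrite ge0_integralZr//; last 2 first.
- exact/measurable_EFinP/measurableT_comp.
- by apply: integral_ge0.
by apply: lte_mul_pinfty => //; [exact: integral_ge0| |];
  [rewrite ge0_fin_numE//; [case/integrableP: fi|exact: integral_ge0]
  |case/integrableP: gi].
Qed.

Lemma Rintegral_fubini f : intg (m1 \x m2)%E f ->
  (forall x, intg m2 (fun y => f (x, y))) ->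
  \int[(m1 \x m2)%E]_z f z = \int[m1]_x (\int[m2]_y f (x, y)).
Proof.
move=> fi fxi; rewrite /Rintegral -(integral12_prod_meas1 fi).
congr fine; apply: eq_integral => x _ /=.
by rewrite /fubini_F fineK//; exact: (integrable_fin_num measurableT (fxi x)).
Qed.

Lemma Rintegral_prod f g : intg m1 f -> intg m2 g ->
  \int[(m1 \x m2)%E]_z (f z.1 * g z.2) = \int[m1]_x f x * \int[m2]_y g y.
Proof.
move=> fi gi; rewrite (Rintegral_fubini (intg_prod fi gi)); last by move=> x; exact: (intgZ (f x) gi).
rewrite -RintegralZr//; apply: eq_Rintegral => x _ /=.
by rewrite RintegralZl.
Qed.

End ProdIntegral.

Section Wiener.
Context d (T : measurableType d) (R : realType).
Variable mu : {sigma_finite_measure set T -> \bar R}.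

Lemma null_sin (phi : T -> R) a : measurable_fun [set: T] phi ->
  (forall c, mu (phi @^-1` [set c]) = 0) ->
  mu [set y | sin ((a + phi y) / 2) = 0] = 0.
Proof.
move=> mphi nphi.
have mpre c : measurable (phi @^-1` [set c]).
  by rewrite -[X in measurable X]setTI; exact: mphi.
have nc c : mu.-negligible (phi @^-1` [set c]).
  by apply/(negligibleP mu (mpre c)); exact: nphi.
have ms : measurable [set y | sin ((a + phi y) / 2) = 0].
  have mg : measurable_fun [set: T] (fun y => sin ((a + phi y) / 2)).
    apply: (measurableT_comp (continuous_measurable_fun (@continuous_sin R))).
    by apply: measurable_funM => //; exact: measurable_funD.
  by rewrite -[X in measurable X]setTI; exact: (mg measurableT [set 0] _).
apply/(negligibleP mu ms).
apply: (@negligibleS _ _ _ mu (\bigcup_(n : nat) (phi @^-1` [set 2 * (n%:R * pi) - a] `|`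
    phi @^-1` [set - (2 * (n%:R * pi)) - a]))).
  move=> y /= /sin_eq0_nat[n hn]; exists n => //=.
  by move: hn; case: (ger0P ((a + phi y) / 2)) => _ hn; [left|right]; lra.
by apply: negligible_bigcup => n; exact: negligibleU.
Qed.

(** Wiener's lemma. The square of the integral is a double integral of
W(x) W(y) times a product of two cosines, whose Cesaro mean tends to 0 unless
phi(x) + phi(y) or phi(x) - phi(y) is a multiple of 2 pi. Since the level sets
of phi are null, so is the set of these exceptions. *)
Lemma wiener_cesaro (W phi : T -> R) b : intg mu W -> measurable_fun [set: T] phi ->
  (forall c, mu (phi @^-1` [set c]) = 0) ->
  (fun n => n.+1%:R^-1 *
    \sum_(k < n.+1) (\int[mu]_x (W x * cos (k%:R * phi x + b))) ^+ 2)
    @ \oo --> (0 : R).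
Proof.
move=> iW mphi nphi.
have mW := intg_meas iW.
have mcos (k : nat) : measurable_fun [set: T] (fun x => cos (k%:R * phi x + b)).
  apply: (measurableT_comp (continuous_measurable_fun (@continuous_cos R))).
  by apply: measurable_funD => //; exact: measurable_funM.
pose F (k : nat) x := W x * cos (k%:R * phi x + b).
have iF k : intg mu (F k).
  apply: (intg_le _ (_ : intg mu (fun x => `|W x|))).
  - by apply: measurable_funM.
  - exact: (integrable_norm iW).
  - by move=> x; rewrite normrM ler_piMr// cos_max.
pose G n (z : T * T) := n.+1%:R^-1 * \sum_(k < n.+1) (F k z.1 * F k z.2).
have iFF (k : nat) := intg_prod (iF k) (iF k).
have -> : (fun n => n.+1%:R^-1 * \sum_(k < n.+1)
    (\int[mu]_x (W x * cos (k%:R * phi x + b))) ^+ 2) =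
    (fun n => \int[(mu \x mu)%E]_z G n z).
  apply/funext => n; rewrite /G RintegralZl//; last first.
    by apply: (@intg_sum _ _ _ _ n.+1 (fun k z => F k z.1 * F k z.2)) => k _.
  congr (_ * _); rewrite (@Rintegral_sum _ _ _ _ n.+1 (fun k z => F k z.1 * F k z.2))//.
  by apply: eq_bigr => k _; rewrite expr2 (Rintegral_prod (iF k) (iF k)).
rewrite -[X in _ --> X](_ : \int[(mu \x mu)%E]_z (cst 0 z) = 0); last first.
  by rewrite Rintegral_cst// mul0r.
have iWW : intg (mu \x mu)%E (fun z => `|W z.1| * `|W z.2|).
  by apply: (@intg_prod _ _ _ _ _ mu mu (fun x => `|W x|) (fun x => `|W x|));
     exact: (integrable_norm iW).
apply: (Rintegral_dominated_cvg _ _ _ iWW) => //.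
- by move=> n; apply/measurable_funM => //; apply: measurable_sum => k;
   exact: (intg_meas (iFF k)).
- pose N s := [set z : T * T | sin ((phi z.1 + s * phi z.2) / 2) = 0].
  have mN s : measurable (N s).
    have mg : measurable_fun [set: T * T] (fun z => sin ((phi z.1 + s * phi z.2) / 2)).
      apply: (measurableT_comp (continuous_measurable_fun (@continuous_sin R))).
      apply: measurable_funM => //; apply: measurable_funD => //.
        exact: measurableT_comp.
      by apply: measurable_funM => //; exact: measurableT_comp.
    by rewrite -[X in measurable X]setTI; exact: (mg measurableT [set 0] _).
  have nN s : s != 0 -> (mu \x mu)%E.-negligible (N s).
    move=> s0; apply/(negligibleP _ (mN s)).
    rewrite /product_measure1; apply: integral0_eq => x _ /=.
    rewrite (_ : xsection _ _ = [set y | sin ((phi x + s * phi y) / 2) = 0]).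
      apply: (@null_sin (fun y => s * phi y)); first exact: measurable_funM.
      move=> c; rewrite -(nphi (c / s)); congr (mu _).
      apply/seteqP; split => y /=; first by move=> <-; field; exact: s0.
      by move=> ->; field; exact: s0.
    by apply/seteqP; split => y /=; rewrite /xsection/= inE.
  have : (mu \x mu)%E.-negligible (N 1 `|` N (-1)).
    by apply: negligibleU; apply: nN; rewrite ?oppr_eq0 oner_eq0.
  apply: negligibleS => z /=; apply: contra_notP.
  move=> /not_orP[/eqP n1 /eqP n2].
  have -> : (G ^~ z) = (fun n => 2^-1 * (W z.1 * W z.2) *
      (n.+1%:R^-1 * \sum_(k < n.+1) cos (k%:R * (phi z.1 + -1 * phi z.2) + 0) +
       n.+1%:R^-1 * \sum_(k < n.+1) cos (k%:R * (phi z.1 + 1 * phi z.2) + 2 * b))).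
    apply/funext => n; rewrite /G /F -(mulrDr n.+1%:R^-1) [RHS]mulrCA -big_split/=.
    congr (_ * _); rewrite mulr_sumr; apply: eq_bigr => k _.
    have -> : k%:R * (phi z.1 + -1 * phi z.2) + 0 =
      (k%:R * phi z.1 + b) - (k%:R * phi z.2 + b) by ring.
    have -> : k%:R * (phi z.1 + 1 * phi z.2) + 2 * b =
      (k%:R * phi z.1 + b) + (k%:R * phi z.2 + b) by ring.
    by rewrite cosB (cosD (k%:R * phi z.1 + b)); field.
  have c2 := @cesaro_cos _ _ 0 n2; have c1 := @cesaro_cos _ _ (2 * b) n1.
  have c3 := cvgM (cvg_cst (2^-1 * (W z.1 * W z.2))) (cvgD c2 c1).
  by rewrite addr0 mulr0 in c3; exact: c3.
- move=> n z; rewrite /G normrM ger0_norm ?invr_ge0// ler_pdivrMl ?ltr0n//.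
  rewrite (le_trans (ler_norm_sum _ _ _))//.
  rewrite -[X in X%:R * _]card_ord -sum1_card natr_sum mulr_suml.
  apply: ler_sum => k _; rewrite mul1r /F !normrM.
  apply: ler_pM; rewrite ?mulr_ge0 ?normr_ge0//.
    by rewrite ler_piMr ?normr_ge0 ?cos_max.
  by rewrite ler_piMr ?normr_ge0 ?cos_max.
Qed.

End Wiener.

(** * Hilbert-Schmidt kernels *)

(** Otherwise the limit of the Cesaro means would be at least e. *)
Lemma cesaro_small (R : realType) (a : nat -> R) (e : R) N : 0 < e ->
  (fun n => n.+1%:R^-1 * \sum_(k < n.+1) a k) @ \oo --> (0 : R) ->
  (forall k, 0 <= a k) ->
  exists2 k, (N <= k)%N & a k <= e.
Proof.
move=> e0 cva a0; apply: contrapT => /forall2NP H.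
have ae k : (N <= k)%N -> e < a k.
  by move=> Nk; have [//|/negP] := H k; rewrite -ltNge.
have /cvgrPdist_lt/(_ (e / 2)) := cva; rewrite divr_gt0// => /(_ isT)[M _ HM].
have := HM ((N + M).*2)%N; rewrite /= -addnn (leq_trans (leq_addl N M)) ?leq_addr//.
move=> /(_ isT); rewrite sub0r normrN; apply/negP; rewrite -leNgt.
rewrite ger0_norm; last by rewrite mulr_ge0 ?invr_ge0// sumr_ge0.
set n := (N + M)%N; have Nn : (N <= n)%N := leq_addr _ _; clearbody n.
rewrite ler_pdivlMl ?ltr0n// -addnS big_split_ord/=.
have H1 : 0 <= \sum_(i < n) a i by rewrite sumr_ge0.
have H2 : n.+1%:R * e <= \sum_(i < n.+1) a (n + i)%N.
  rewrite -[X in X%:R * _]card_ord -sum1_card natr_sum mulr_suml.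
  apply: ler_sum => k _; by rewrite mul1r ltW// ae// (leq_trans Nn)// leq_addr.
rewrite (le_trans _ (lerD H1 H2))// add0r natrD -natr1.
move: (n%:R : R) => x; lra.
Qed.

Section Kernel.
Context d (T : measurableType d) (R : realType).
Variable mu : {finite_measure set T -> \bar R}.

Definition kernel_op (K : T * T -> R) (f : T -> R) (x : T) : R :=
  \int[mu]_y (K (x, y) * f y).

Definition flip (K : T * T -> R) (z : T * T) := K (z.2, z.1).

(** Square integrability of the sections of K, uniformly in the other variable,
which is stronger than the Hilbert-Schmidt condition on a finite measure space
and makes every kernel operator below defined at all points, not just almost
everywhere. *)
Definition hs_kernel (C : R) (K : T * T -> R) :=
  [/\ measurable_fun [set: T * T] K,
    forall x, l2 mu (fun y => K (x, y)) /\
      dot mu (fun y => K (x, y)) (fun y => K (x, y)) <= C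
  & forall y, l2 mu (fun x => K (x, y)) /\
      dot mu (fun x => K (x, y)) (fun x => K (x, y)) <= C].

Lemma flip_hs C K : hs_kernel C K -> hs_kernel C (flip K).
Proof.
move=> [mK K1 K2]; split => //; rewrite /flip/=.
exact: (measurableT_comp mK (@measurable_swap _ _ T T)).
Qed.

Lemma intg_cst (c : R) : intg mu (fun=> c).
Proof. exact: (finite_measure_integrable_cst mu c). Qed.

Lemma l2_bounded (f : T -> R) C : measurable_fun [set: T] f ->
  (forall x, `|f x| <= C) -> l2 mu f.
Proof.
move=> mf fC; split => //; apply: intg_le (intg_cst (C ^+ 2)) _ => [|x].
  exact: measurable_funX.
rewrite ger0_norm ?sqr_ge0// -[f x ^+ 2]real_normK ?num_real//.
by rewrite ler_sqr ?nnegrE// (le_trans _ (fC x)).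
Qed.

Lemma hs_ge0 C K (x : T) : hs_kernel C K -> 0 <= C.
Proof. by move=> [_ /(_ x)[_ h] _]; exact: le_trans (dot_ge0 _ _) h. Qed.

Lemma kernel_opE K f x : kernel_op K f x = dot mu (fun y => K (x, y)) f.
Proof. by []. Qed.

Lemma kernel_op_abs C K f x : hs_kernel C K -> l2 mu f ->
  `|kernel_op K f x| <= Num.sqrt (C * dot mu f f).
Proof.
move=> hK lf; have C0 := hs_ge0 x hK; case: hK => _ /(_ x)[lK KC] _.
rewrite -sqrtr_sqr ler_wsqrtr// kernel_opE (le_trans (cauchy_schwarz lK lf))//.
by rewrite ler_wpM2r// dot_ge0.
Qed.

Lemma kernel_op_integrable C K f g : hs_kernel C K -> l2 mu f -> l2 mu g ->
  intg (mu \x mu)%E (fun z => f z.1 * (K z * g z.2)).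
Proof.
move=> hK lf lg; have [mK K1 K2] := hK.
have m2 (h : T -> R) : measurable_fun [set: T] h ->
  measurable_fun [set: T * T] (fun z : T * T => h z.2).
  by move=> mh; exact: measurableT_comp.
have mfKg : measurable_fun [set: T * T] (fun z => f z.1 * (K z * g z.2)).
  apply: measurable_funM; first exact: (measurableT_comp (l2_meas lf)).
  by apply: measurable_funM => //; exact: (m2 _ (l2_meas lg)).
apply/integrable12ltyP; first exact/measurable_EFinP.
have la (h : T -> R) : l2 mu h -> l2 mu (fun x => `|h x|).
  move=> [mh ih]; split; first exact: measurableT_comp.
  by apply: eq_integrable ih => // x _ /=; rewrite real_normK ?num_real.
pose M := Num.sqrt (C * dot mu g g).
have H x : (\int[mu]_y `|(f x * (K (x, y) * g y))%:E| <= (`|f x| * M)%:E)%E.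
  rewrite (eq_integral (fun y => `|f x|%:E * (`|K (x, y)| * `|g y|)%:E)%E); last first.
    by move=> y _ /=; rewrite !normrM.
  have lKx := (K1 x).1.
  have mKg : measurable_fun [set: T] (fun y => (`|K (x, y)| * `|g y|)%:E).
    apply/measurable_EFinP; apply: measurable_funM.
      exact: (measurableT_comp _ (l2_meas lKx)).
    exact: (measurableT_comp _ (l2_meas lg)).
  rewrite (@ge0_integralZl _ _ _ mu setT measurableT _ mKg)//.
  rewrite EFinM lee_wpmul2l ?lee_fin//.
  have -> : (\int[mu]_y (`|K (x, y)| * `|g y|)%:E =
      (dot mu (fun y => `|K (x, y)|) (fun y => `|g y|))%:E)%E.
    rewrite /dot /Rintegral fineK//.
    exact: (integrable_fin_num measurableT (l2_mul (la _ lKx) (la _ lg))).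
  rewrite lee_fin (le_trans (ler_norm _))// -sqrtr_sqr ler_wsqrtr//.
  rewrite (le_trans (cauchy_schwarz (la _ lKx) (la _ lg)))//.
  have nn (h : T -> R) : dot mu (fun x => `|h x|) (fun x => `|h x|) = dot mu h h.
    by apply: eq_Rintegral => y _; rewrite -!expr2 real_normK ?num_real.
  by rewrite !nn ler_wpM2r ?dot_ge0//; exact: (K1 x).2.
apply: (@le_lt_trans _ _ (\int[mu]_x (`|f x| * M)%:E)%E).
  apply: ge0_le_integral => //=.
  - by move=> x _; apply: integral_ge0.
  - have := @measurable_fun_fubini_tonelli_F _ _ T T R mu
      (fun z => `|(f z.1 * (K z * g z.2))%:E|%E).
    by apply => //; apply: measurableT_comp => //; exact/measurable_EFinP.
  - apply/measurable_EFinP; apply: measurable_funM => //.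
    exact: (measurableT_comp _ (l2_meas lf)).
- by move=> x _; exact: H.
have lM : l2 mu (fun=> M).
  by apply: (@l2_bounded _ `|M|) => //; exact: measurable_cst.
have := l2_mul (la _ lf) lM => /integrableP[_].
by under eq_integral do rewrite /= ger0_norm ?mulr_ge0 ?sqrtr_ge0//.
Qed.

Lemma kernel_op_l2 C K f : hs_kernel C K -> l2 mu f -> l2 mu (kernel_op K f).
Proof.
move=> hK lf.
have lone : l2 mu (fun=> 1) by apply: (@l2_bounded _ 1) => [|x]; [exact: measurable_cst|rewrite normr1].
have iK := kernel_op_integrable hK lone lf.
apply: (@l2_bounded _ (Num.sqrt (C * dot mu f f))); last by move=> x; exact: kernel_op_abs.
have mF := @measurable_fubini_F _ _ T T R mu mu _ iK.
have -> : kernel_op K f = fine \o fubini_F mu (EFin \o (fun z : T * T => 1 * (K z * f z.2))).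
  apply/funext => x; rewrite /kernel_op /Rintegral /fubini_F/=.
  by congr fine; apply: eq_integral => y _; rewrite mul1r.
exact: (measurableT_comp _ mF).
Qed.

Lemma kernel_op_adj C K f g : hs_kernel C K -> l2 mu f -> l2 mu g ->
  dot mu f (kernel_op K g) = dot mu (kernel_op (flip K) f) g.
Proof.
move=> hK lf lg; have iK := kernel_op_integrable hK lf lg; have [_ K1 K2] := hK.
have E : \int[mu]_x (f x * \int[mu]_y (K (x, y) * g y)) =
    fine (\int[mu]_x \int[mu]_y (f x * (K (x, y) * g y))%:E)%E.
  congr fine; apply: eq_integral => x _.
  have iKg := l2_mul (K1 x).1 lg.
  rewrite -RintegralZl// /Rintegral fineK//.
  exact: (integrable_fin_num measurableT (intgZ (f x) iKg)).
rewrite /dot E (@Fubini _ _ T T R mu mu _ iK)/=.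
congr fine; apply: eq_integral => y _.
rewrite /kernel_op /flip/= mulrC.
have iKf := l2_mul (K2 y).1 lf.
rewrite -RintegralZl// /Rintegral fineK//; last first.
  exact: (integrable_fin_num measurableT (intgZ (g y) iKf)).
by apply: eq_integral => x _; congr EFin; ring.
Qed.

(** The kernel of K^T K. *)
Definition gram (K : T * T -> R) (z : T * T) : R :=
  \int[mu]_x (K (x, z.1) * K (x, z.2)).

Lemma gram_abs C K z : hs_kernel C K -> `|gram K z| <= C.
Proof.
move=> hK; have C0 := hs_ge0 z.1 hK; case: hK => _ _ K2.
have [l1 h1] := K2 z.1; have [l2 h2] := K2 z.2.
rewrite -(ger0_norm C0) -ler_sqr ?nnegrE// !real_normK ?num_real//.
rewrite (le_trans (cauchy_schwarz l1 l2))// expr2.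
by apply: ler_pM => //; exact: dot_ge0.
Qed.

Lemma gram_meas C K : hs_kernel C K -> measurable_fun [set: T * T] (gram K).
Proof.
move=> [mK _ K2].
pose F (z : (T * T) * T) := (K (z.2, z.1.1) * K (z.2, z.1.2))%:E.
have mF : measurable_fun setT F.
  apply/measurable_EFinP; apply: measurable_funM; apply: (measurableT_comp mK);
    apply: measurable_fun_pair; (try exact: measurable_snd).
    exact: (measurableT_comp measurable_fst measurable_fst).
  exact: (measurableT_comp measurable_snd measurable_fst).
have -> : gram K = fine \o (fun z => (\int[mu]_x (F^\+ (z, x))%E - \int[mu]_x (F^\- (z, x))%E)%E).
  apply/funext => z; rewrite /gram /Rintegral; congr fine.
  rewrite [LHS]integralE; congr (_ - _)%E; apply: eq_integral => x _;
    by rewrite ?funeposE ?funenegE.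
apply: (measurableT_comp (@fine_measurable R setT measurableT)).
apply: emeasurable_funB.
  exact: (@measurable_fun_fubini_tonelli_F _ _ (T * T)%type T R mu (F^\+)%E
    (measurable_funepos mF) (funepos_ge0 F)).
exact: (@measurable_fun_fubini_tonelli_F _ _ (T * T)%type T R mu (F^\-)%E
  (measurable_funeneg mF) (funeneg_ge0 F)).
Qed.

(** The squared Hilbert-Schmidt norm of K^T K. *)
Definition gram_norm2 K : R := \int[(mu \x mu)%E]_z (gram K z ^+ 2).

Lemma intg_prod_cst (c : R) : intg (mu \x mu)%E (fun=> c).
Proof.
have := intg_prod (intg_cst c) (intg_cst 1).
by apply: eq_integrable => // x _ /=; rewrite mulr1.
Qed.

Lemma gram_norm2_intg C K : hs_kernel C K -> intg (mu \x mu)%E (fun z => gram K z ^+ 2).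
Proof.
move=> hK; apply: intg_le (intg_prod_cst (C ^+ 2)) _ => [|z].
  by apply: measurable_funX; exact: (gram_meas hK).
have C0 := hs_ge0 z.1 hK.
rewrite ger0_norm ?sqr_ge0// -real_normK ?num_real// ler_sqr ?nnegrE//.
exact: gram_abs.
Qed.

Lemma gram_sect_l2 C K y : hs_kernel C K -> l2 mu (fun y' => gram K (y, y')).
Proof.
move=> hK; apply: (@l2_bounded _ C) => [|y']; last exact: gram_abs.
exact: (measurableT_comp (gram_meas hK) (pair1_measurable y)).
Qed.

(** |K f|^2 = (K^T K f, f), and the operator norm of K^T K is at most its
Hilbert-Schmidt norm. The detour through K^T K matters: the Hilbert-Schmidt
norm of an oscillating kernel is not small, that of K^T K is. *)
Lemma kernel_op_bound C K f : hs_kernel C K -> l2 mu f ->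
  dot mu (kernel_op K f) (kernel_op K f) ^+ 2 <= gram_norm2 K * dot mu f f ^+ 2.
Proof.
move=> hK lf; have lKf := kernel_op_l2 hK lf; have hK' := flip_hs hK.
have lKKf := kernel_op_l2 hK' lKf.
rewrite (kernel_op_adj hK lKf lf) (le_trans (cauchy_schwarz lKKf lf))//.
rewrite [dot mu f f ^+ 2]expr2 mulrA ler_wpM2r ?dot_ge0//.
have E y : kernel_op (flip K) (kernel_op K f) y = dot mu (fun y' => gram K (y, y')) f.
  rewrite kernel_opE /flip/=; case: hK (hK) => _ _ K2 hK.
  by rewrite (kernel_op_adj hK (K2 y).1 lf); apply: eq_Rintegral => y' _;
    rewrite /kernel_op /flip /gram/=; congr (_ * _); apply: eq_Rintegral => x _;
    rewrite mulrC.
have -> : gram_norm2 K = \int[mu]_y dot mu (fun y' => gram K (y, y')) (fun y' => gram K (y, y')).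
  rewrite /gram_norm2 (Rintegral_fubini (gram_norm2_intg hK)) => [|y].
    by apply: eq_Rintegral => y _; rewrite /= -dotE.
  exact: (gram_sect_l2 y hK).2.
have il : intg mu (fun y => dot mu (fun y' => gram K (y, y')) (fun y' => gram K (y, y'))).
  have := integrable_fubini_F (gram_norm2_intg hK).
  apply: eq_integrable => // y _; rewrite /fubini_F/=.
  by rewrite (dot_fineE (gram_sect_l2 y hK)).
rewrite -RintegralZr// -dotE; apply: le_Rintegral => //.
- exact: lKKf.2.
- by have := intgZ (dot mu f f) il; apply: eq_integrable => // x _ /=; rewrite mulrC.
by move=> y _; rewrite E; apply: cauchy_schwarz => //; exact: (gram_sect_l2 y hK).
Qed.

End Kernel.

(** * Oscillating kernels *)

Section Oscillation.
Context d (T : measurableType d) (R : realType).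
Variable mu : {finite_measure set T -> \bar R}.
Variables (C : R) (w rho : T * T -> R).
Hypothesis hw : hs_kernel mu C w.
Hypothesis mrho : measurable_fun [set: T * T] rho.
Hypothesis level0 : {ae (mu \x mu)%E, forall z c,
  mu [set x | rho (x, z.1) + rho (x, z.2) = c] = 0 /\
  mu [set x | rho (x, z.1) - rho (x, z.2) = c] = 0}.

(** With w = 1/|x - y|, rho = |x - y|, and t = 0 or t = - pi/2, this is 4 pi times
the real or the imaginary part of the fundamental solution. *)
Definition osc (k t : R) (z : T * T) : R := w z * cos (k * rho z + t).

Lemma osc_hs k t : hs_kernel mu C (osc k t).
Proof.
have [mw w1 w2] := hw.
have mc : measurable_fun [set: T * T] (fun z => cos (k * rho z + t)).
  apply: (measurableT_comp (continuous_measurable_fun (@continuous_cos R))).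
  by apply: measurable_funD => //; exact: measurable_funM.
have H (f g : T -> R) : l2 mu f -> measurable_fun [set: T] g ->
    dot mu f f <= C ->
    l2 mu (fun x => f x * cos (g x)) /\
    dot mu (fun x => f x * cos (g x)) (fun x => f x * cos (g x)) <= C.
  move=> lf mg fC.
  have lfc : l2 mu (fun x => f x * cos (g x)).
    rewrite (_ : (fun x => _) = (fun x => cos (g x) * f x)); last first.
      by apply/funext => x; rewrite mulrC.
    apply: (@l2_bound _ _ _ _ _ _ 1) => // [|x]; last exact: cos_max.
    exact: (measurableT_comp (continuous_measurable_fun (@continuous_cos R))).
  split => //; apply: le_trans fC; apply: dot_mono => // x.
  by rewrite normrM ler_piMr// cos_max.
split; first exact: measurable_funM.
- move=> x; apply: (H (fun y => w (x, y))); [exact: (w1 x).1| |exact: (w1 x).2].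
  apply: measurable_funD => //; apply: measurable_funM => //.
  exact: (measurableT_comp mrho (pair1_measurable x)).
- move=> y; apply: (H (fun x => w (x, y))); [exact: (w2 y).1| |exact: (w2 y).2].
  apply: measurable_funD => //; apply: measurable_funM => //.
  exact: (measurableT_comp mrho (pair2_measurable y)).
Qed.

(** Product of cosines: for fixed z, the Gram kernel is made of two trigonometric
integrals of the form treated by Wiener's lemma. *)
Lemma gram_osc k t z :
  gram mu (osc k t) z =
  2^-1 * (\int[mu]_x (w (x, z.1) * w (x, z.2) *
             cos (k * (rho (x, z.1) + rho (x, z.2)) + (t + t)))) +
  2^-1 * (\int[mu]_x (w (x, z.1) * w (x, z.2) *
             cos (k * (rho (x, z.1) - rho (x, z.2)) + 0))).
Proof.
have [mw w1 w2] := hw.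
have iW := l2_mul (w2 z.1).1 (w2 z.2).1.
have ic (g : T -> R) : measurable_fun [set: T] g ->
    intg mu (fun x => w (x, z.1) * w (x, z.2) * cos (g x)).
  move=> mg; apply: intg_le (integrable_norm iW) _ => [|x /=].
    apply: measurable_funM; first exact: (intg_meas iW).
    exact: (measurableT_comp (continuous_measurable_fun (@continuous_cos R))).
  by rewrite normrM ler_piMr// cos_max.
have mr y : measurable_fun [set: T] (fun x => rho (x, y)).
  exact: (measurableT_comp mrho (pair2_measurable y)).
have i1 := ic (fun x => k * (rho (x, z.1) + rho (x, z.2)) + (t + t)).
have i2 := ic (fun x => k * (rho (x, z.1) - rho (x, z.2)) + 0).
have {i1} i1 := i1 ltac:(by apply: measurable_funD => //; apply: measurable_funM => //; exact: measurable_funD).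
have {i2} i2 := i2 ltac:(by apply: measurable_funD => //; apply: measurable_funM => //; exact: measurable_funB).
rewrite -!RintegralZl// -RintegralD//; [|exact: (intgZ 2^-1 i1)|exact: (intgZ 2^-1 i2)].
apply: eq_Rintegral => x _; rewrite /osc.
have -> : k * (rho (x, z.1) + rho (x, z.2)) + (t + t) =
  (k * rho (x, z.1) + t) + (k * rho (x, z.2) + t) by ring.
have -> : k * (rho (x, z.1) - rho (x, z.2)) + 0 =
  (k * rho (x, z.1) + t) - (k * rho (x, z.2) + t) by ring.
by rewrite cosB (cosD (k * rho (x, z.1) + t)); field.
Qed.

(** Wiener's lemma applies to almost every pair z because of the hypothesis on
the level sets; the Gram kernels are bounded by C, so the convergence may be
integrated over z. *)
Lemma cesaro_gram_norm2 t :
  (fun n => n.+1%:R^-1 * \sum_(k < n.+1) gram_norm2 mu (osc k%:R t)) @ \oo --> (0 : R).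
Proof.
have [mw w1 w2] := hw.
pose F n (z : T * T) := n.+1%:R^-1 * \sum_(k < n.+1) gram mu (osc k%:R t) z ^+ 2.
have iG (k : nat) := gram_norm2_intg (osc_hs k%:R t).
have -> : (fun n => n.+1%:R^-1 * \sum_(k < n.+1) gram_norm2 mu (osc k%:R t)) =
    (fun n => \int[(mu \x mu)%E]_z F n z).
  apply/funext => n; rewrite /F RintegralZl//; last first.
    exact: (@intg_sum _ _ _ _ n.+1 (fun k z => gram mu (osc k%:R t) z ^+ 2)).
  by congr (_ * _); rewrite (@Rintegral_sum _ _ _ _ n.+1 (fun k z => gram mu (osc k%:R t) z ^+ 2)).
rewrite -[X in _ --> X](_ : \int[(mu \x mu)%E]_z (cst 0 z) = 0); last first.
  by rewrite Rintegral_cst// mul0r.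
apply: (Rintegral_dominated_cvg _ _ _ (intg_prod_cst mu (C ^+ 2))) => //.
- move=> n; apply/measurable_funM => //; apply: measurable_sum => k.
  exact: (intg_meas (iG k)).
- apply: filterS level0 => z lz /=.
  have iW := l2_mul (w2 z.1).1 (w2 z.2).1.
  have mr y : measurable_fun [set: T] (fun x => rho (x, y)).
    exact: (measurableT_comp mrho (pair2_measurable y)).
  have c1 := @wiener_cesaro _ _ _ mu _ (fun x => rho (x, z.1) + rho (x, z.2)) (t + t) iW
    (measurable_funD (mr _) (mr _)) (fun c => (lz c).1).
  have c2 := @wiener_cesaro _ _ _ mu _ (fun x => rho (x, z.1) - rho (x, z.2)) 0 iW
    (measurable_funB (mr _) (mr _)) (fun c => (lz c).2).
  pose A n : R := n.+1%:R^-1 * \sum_(k < n.+1) (\int[mu]_x (w (x, z.1) * w (x, z.2) *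
    cos (k%:R * (rho (x, z.1) + rho (x, z.2)) + (t + t)))) ^+ 2.
  pose B n : R := n.+1%:R^-1 * \sum_(k < n.+1) (\int[mu]_x (w (x, z.1) * w (x, z.2) *
    cos (k%:R * (rho (x, z.1) - rho (x, z.2)) + 0))) ^+ 2.
  have c3 : (fun n => 2^-1 * (A n + B n)) @ \oo --> (0 : R).
    rewrite -[X in _ --> X](mulr0 2^-1) -[X in _ * X](addr0 (0:R)).
    by apply: cvgM; [exact: cvg_cst|apply: cvgD; [exact: c1|exact: c2]].
  apply: (squeeze_cvgr _ (cvg_cst 0) c3); near=> n; apply/andP; split.
    by rewrite mulr_ge0 ?invr_ge0// sumr_ge0// => k _; rewrite sqr_ge0.
  rewrite /A /B -(mulrDr n.+1%:R^-1) [leRHS]mulrCA ler_wpM2l ?invr_ge0//.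
  rewrite -big_split/= mulr_sumr; apply: ler_sum => k _.
  rewrite gram_osc; set a := Rintegral _ _ _; set b := Rintegral _ _ _.
  have := sqr_ge0 (a - b); lra.
- move=> n z; rewrite /F normrM ger0_norm ?invr_ge0// ler_pdivrMl ?ltr0n//.
  rewrite (le_trans (ler_norm_sum _ _ _))//.
  rewrite -[X in X%:R * _]card_ord -sum1_card natr_sum mulr_suml.
  apply: ler_sum => k _; rewrite mul1r ger0_norm ?sqr_ge0//.
  have hk := osc_hs k%:R t.
  have C0 := hs_ge0 z.1 hk.
  by rewrite -real_normK ?num_real// ler_sqr ?nnegrE//; exact: gram_abs hk.
Unshelve. all: by end_near.
Qed.

(** The two phases are treated together because the same k must serve for the
real and the imaginary part of the fundamental solution. *)
Lemma osc_op_small t1 t2 (e : R) N : 0 < e ->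
  exists2 k : nat, (N <= k)%N & forall t, t = t1 \/ t = t2 ->
    forall f, l2 mu f ->
    dot mu (kernel_op mu (osc k%:R t) f) (kernel_op mu (osc k%:R t) f) <= e * dot mu f f.
Proof.
move=> e0.
have g0 k t : 0 <= gram_norm2 mu (osc k t) by apply: Rintegral_ge0 => x _; rewrite sqr_ge0.
have c := cvgD (cesaro_gram_norm2 t1) (cesaro_gram_norm2 t2).
rewrite addr0 in c.
have [|||k Nk ak] := @cesaro_small R
  (fun k => gram_norm2 mu (osc k%:R t1) + gram_norm2 mu (osc k%:R t2)) (e ^+ 2) N.
- by rewrite exprn_gt0.
- rewrite (_ : (fun n => _) = (fun n =>
    n.+1%:R^-1 * (\sum_(k < n.+1) gram_norm2 mu (osc k%:R t1)) +
    n.+1%:R^-1 * (\sum_(k < n.+1) gram_norm2 mu (osc k%:R t2)))); first exact: c.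
  by apply/funext => n; rewrite -mulrDr big_split.
- by move=> k; rewrite addr_ge0.
exists k => // t tt f lf.
have ge : gram_norm2 mu (osc k%:R t) <= e ^+ 2.
  case: tt => ->; apply: (le_trans _ ak); first by rewrite lerDl g0.
  by rewrite lerDr g0.
rewrite -ler_sqr ?nnegrE ?dot_ge0//; last by rewrite mulr_ge0 ?dot_ge0// ltW.
rewrite (le_trans (kernel_op_bound (osc_hs k%:R t) lf))// exprMn ler_wpM2r//.
exact: sqr_ge0.
Qed.

End Oscillation.

(** * Geometry of the Euclidean space *)

Section Geometry.
Variable R : realType.
Notation X := (R3 R).
Notation lam := (@lebesgue_measure R).

Definition cube (a : X) (r : R) : set X :=
  [set x | [/\ `|x.1.1 - a.1.1| <= r, `|x.1.2 - a.1.2| <= r & `|x.2 - a.2| <= r]].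

Lemma cubeE a r : cube a r =
  ((`[a.1.1 - r, a.1.1 + r]%classic `*` `[a.1.2 - r, a.1.2 + r]%classic)
    `*` `[a.2 - r, a.2 + r]%classic).
Proof.
apply/seteqP; split => x /=; rewrite /cube/= !in_itv/= !ler_distl.
  by case=> h1 h2 h3; split.
by case=> -[h1 h2] h3; split.
Qed.

Lemma measurable_cube a r : measurable (cube a r).
Proof. by rewrite cubeE; apply: measurableX => //; exact: measurableX. Qed.

Lemma leb3_cube a r : 0 <= r -> leb3 R (cube a r) = ((2 * r) ^+ 3)%:E.
Proof.
move=> r0; rewrite cubeE /leb3.
have itvE (c : R) : lam `[c - r, c + r]%classic = (2 * r)%:E.
  rewrite lebesgue_measure_itv/= lte_fin.
  case: ifPn => [_|]; first by rewrite -EFinB; congr EFin; ring.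
  by rewrite -leNgt => h; congr EFin; lra.
rewrite [LHS](@product_measure1E _ _ _ _ R (lam \x lam)%E lam)//; last exact: measurableX.
rewrite [X in (X * _)%E](@product_measure1E _ _ _ _ R lam lam)//.
transitivity ((2 * r)%:E * (2 * r)%:E * (2 * r)%:E)%E.
  by congr (_ * _ * _)%E; exact: itvE.
by rewrite -!EFinM; congr EFin; ring.
Qed.

(** An open set is a countable union of rational cubes, which are measurable for
the product sigma-algebra. *)
Lemma open_measurable3 (D : set X) : open D -> measurable D.
Proof.
move=> oD.
pose q3 (q : rat * rat * rat) : X := ((ratr q.1.1, ratr q.1.2), ratr q.2).
pose F (q : rat * rat * rat * nat) :=
  if `[< cube (q3 q.1) q.2.+1%:R^-1 `<=` D >] then cube (q3 q.1) q.2.+1%:R^-1 else set0.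
have -> : D = \bigcup_q F q.
  apply/seteqP; split => x; last first.
    by move=> [q _]; rewrite /F; case: asboolP => // h /h.
  move=> Dx; have : nbhs x D by apply: open_nbhs_nbhs; split.
  rewrite -nbhs_ballE => -[e /= e0 xD].
  have [n] : exists n : nat, 2 * n.+1%:R^-1 < e.
    exists (Num.truncn (2 / e)).
    have := truncnS_gt (2 / e); rewrite ltr_pdivrMr// => h.
    by rewrite ltr_pdivrMr// mulrC.
  move=> ne.
  have n0 : 0 < n.+1%:R^-1 :> R by rewrite invr_gt0.
  have Q (t : R) : exists q : rat, `|t - ratr q| <= n.+1%:R^-1.
    move: n0; move: (n.+1%:R^-1 : R) => r r0.
    have [|q] := @rat_in_itvoo R (t - r) (t + r); first by lra.
    by rewrite in_itv/= => /andP[h1 h2]; exists q; rewrite distrC ler_distl; lra.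
  have [q1 h1] := Q x.1.1; have [q2 h2] := Q x.1.2; have [q3' h3] := Q x.2.
  exists (q1, q2, q3', n) => //; rewrite /F/= ifT//; apply/asboolP => y [/= y1 y2 y3].
  apply: xD.
  have tri (a b c : R) : `|a - c| <= n.+1%:R^-1 -> `|b - c| <= n.+1%:R^-1 -> `|a - b| < e.
    move=> ha hb; apply: le_lt_trans ne.
    rewrite (_ : a - b = (a - c) - (b - c)); last by ring.
    by rewrite (le_trans (ler_normB _ _))// (_ : 2 = 1 + 1 :> R)// mulrDl !mul1r lerD.
  by split; [split|]; rewrite /ball/=; [exact: tri h1 y1|exact: tri h2 y2|exact: tri h3 y3].
apply: countable_bigcupT_measurable => [|q]; first exact: countableP.
rewrite /F; case: ifP => // _.
exact: measurable_cube.
Qed.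

(** Boundedness refers to the sup norm of the product, so cubes are its balls. *)
Lemma bounded_cube (D : set X) : bounded_set D ->
  exists2 L : R, 0 < L & D `<=` cube 0 L.
Proof.
move=> [M [_ HM]]; pose L := Num.max (M + 1) 1; exists L.
  by rewrite lt_max ltr01 orbT.
move=> x Dx.
have : `|x| <= L by apply: (HM L) => //; rewrite lt_max ltrDl ltr01.
rewrite prod_normE ge_max => /andP[]; rewrite prod_normE ge_max => /andP[h1 h2] h3.
by split; rewrite subr0.
Qed.

Lemma enorm_ge0 (x : X) : 0 <= enorm x. Proof. exact: sqrtr_ge0. Qed.

Lemma enorm_coord (x : X) :
  [/\ `|x.1.1| <= enorm x, `|x.1.2| <= enorm x & `|x.2| <= enorm x].
Proof.
have H (t : R) : t ^+ 2 <= dot3 x x -> `|t| <= enorm x.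
  by move=> h; rewrite -sqrtr_sqr ler_wsqrtr.
by split; apply: H; rewrite /dot3; have := sqr_ge0 x.1.1; have := sqr_ge0 x.1.2;
  have := sqr_ge0 x.2; rewrite !expr2; lra.
Qed.

Lemma measurable_coord : [/\ measurable_fun [set: X] (fun x : X => x.1.1),
  measurable_fun [set: X] (fun x : X => x.1.2) & measurable_fun [set: X] (fun x : X => x.2)].
Proof.
split; [exact: (measurableT_comp measurable_fst measurable_fst)|
  exact: (measurableT_comp measurable_snd measurable_fst)|exact: measurable_snd].
Qed.

Definition dist3 (z : X * X) : R := enorm (z.1 - z.2).

Lemma measurable_dist3 : measurable_fun [set: X * X] dist3.
Proof.
have [m1 m2 m3] := measurable_coord.
have H (g : X -> R) : measurable_fun [set: X] g ->
    measurable_fun [set: X * X] (fun z : X * X => (g z.1 - g z.2) * (g z.1 - g z.2)).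
  move=> mg.
  have h : measurable_fun [set: X * X] (fun z : X * X => g z.1 - g z.2).
    by apply: measurable_funB; [exact: (measurableT_comp mg measurable_fst)|
                                exact: (measurableT_comp mg measurable_snd)].
  exact: measurable_funM.
have -> : dist3 = (fun z => Num.sqrt ((z.1.1.1 - z.2.1.1) * (z.1.1.1 - z.2.1.1) +
   (z.1.1.2 - z.2.1.2) * (z.1.1.2 - z.2.1.2) + (z.1.2 - z.2.2) * (z.1.2 - z.2.2))) by [].
apply: (measurableT_comp (continuous_measurable_fun (@sqrt_continuous R))).
apply: measurable_funD; last exact: (H (fun x => x.2)).
by apply: measurable_funD; [exact: (H (fun x => x.1.1))|exact: (H (fun x => x.1.2))].
Qed.

End Geometry.

(** * Lebesgue measure on the domain and the kernel 1/|x - y| *)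

Section Domain.
Variable R : realType.
Notation X := (R3 R).
Notation lam := (@lebesgue_measure R).
Variables (D : set X) (mD : measurable D) (Doo : (leb3 R D < +oo)%E).

Definition lebD : {finite_measure set X -> \bar R} := mfrestr mD Doo.

Lemma lebDE A : lebD A = leb3 R (A `&` D). Proof. by []. Qed.

Lemma lebD_le A : measurable A -> (lebD A <= leb3 R A)%E.
Proof.
move=> mA; rewrite lebDE; apply: le_measure; rewrite ?inE//.
exact: measurableI.
Qed.

Lemma integral_lebD_patch (f : X -> \bar R) :
  (\int[leb3 R]_(x in D) f x = \int[lebD]_x (f \_ D) x)%E.
Proof.
rewrite -integral_mkcond; apply: eq_measure_integral => A mA AD.
by transitivity (leb3 R (A `&` D)) => //; rewrite setIidl.
Qed.

Lemma Rintegral_lebD_patch (f : X -> R) :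
  \int[leb3 R]_(x in D) f x = \int[lebD]_x (f \_ D) x.
Proof. by rewrite /Rintegral integral_lebD_patch restrict_EFin. Qed.

Lemma lebD_ae : {ae lebD, forall x, D x}.
Proof.
exists (~` D); split => //; first exact: measurableC.
by rewrite lebDE setICl measure0.
Qed.

Definition invdistC : R := fine (lebD setT) + 64.

(** On 2^-(k+1) < |x - y| <= 2^-k the integrand is below 4^(k+1) and x lies in the
cube of radius 2^-k, of volume 8 * 8^-k. These contributions form a geometric
series, and the integrand is at most 1 where |x - y| >= 1. *)
Lemma integral_invdist2_le y (w : X -> R) :
  (forall x, w x = (enorm (x - y))^-1 \/ w x = (enorm (y - x))^-1) ->
  measurable_fun [set: X] w ->
  (\int[lebD]_x (w x ^+ 2)%:E <= invdistC%:E)%E.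
Proof.
move=> hw mw.
(* A dyadic majorant of |x - y|^-2 on the unit ball around y. *)
pose g (k : nat) (x : X) : \bar R := (4 ^+ k.+1 * \1_(cube y (2 ^- k)) x)%:E.
have g0 k x : (0 <= g k x)%E by rewrite lee_fin mulr_ge0// exprn_ge0.
have mg k : measurable_fun [set: X] (g k).
  apply/measurable_EFinP; apply: measurable_funM => //.
  by apply: measurable_indic; exact: measurable_cube.
have enormN x : enorm (y - x) = enorm (x - y).
  congr Num.sqrt; rewrite /dot3.
  have -> : (y - x).1.1 = - (x - y).1.1 by rewrite /=; ring.
  have -> : (y - x).1.2 = - (x - y).1.2 by rewrite /=; ring.
  have -> : (y - x).2 = - (x - y).2 by rewrite /=; ring.
  by rewrite !mulrNN.
have {}hw x : w x = (enorm (x - y))^-1 by case: (hw x) => ->//; rewrite enormN.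
have pw x : ((w x ^+ 2)%:E <= 1 + \sum_(k <oo) g k x)%E.
  have s0 : (0 <= \sum_(k <oo) g k x)%E by apply: nneseries_ge0.
  rewrite hw; set r := enorm (x - y); have r0 : 0 <= r := enorm_ge0 _.
  have [r1|r1] := leP 1 r.
    rewrite (@le_trans _ _ 1%E)//; last by rewrite leeDl.
    by rewrite lee_fin exprn_ile1 ?invr_ge0// invf_le1// (lt_le_trans _ r1).
  have [->|rn0] := eqVneq r 0.
    by rewrite invr0 expr0n/= (@le_trans _ _ 1%E)// ?lee_fin// leeDl.
  have rp : 0 < r by rewrite lt_neqAle eq_sym rn0.
  have ex : exists k, 2 ^- k < r.
    (* An integer larger than 1/r is below its own power of 2. *)
    exists (Num.truncn r^-1).+1.
    rewrite invf_plt ?posrE ?exprn_gt0//.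
    rewrite (lt_le_trans (truncnS_gt _))// -natrX ler_nat ltnW//.
    by rewrite ltn_expl.
  have [k hk kmin] := ex_minnP ex.
  case: k hk kmin => [|k] hk kmin; first by move: hk; rewrite expr0 invr1 ltNge ltW.
  have rk : r <= 2 ^- k.
    by rewrite leNgt; apply/negP => /kmin; rewrite ltnn.
  rewrite (@le_trans _ _ (g k x))//; last first.
    rewrite (@le_trans _ _ (\sum_(k <oo) g k x)%E)//; last by rewrite leeDr.
    have := @nneseries_lim_ge R (g ^~ x) xpredT 0%N k.+1 (fun n _ _ => g0 n x).
    apply: le_trans; rewrite big_nat_recr//= leeDr//.
    by apply: sume_ge0.
  have xc : cube y (2 ^- k) x.
    by have [h1 h2 h3] := enorm_coord (x - y); split; apply: le_trans rk.
  rewrite /g indicE mem_set// mulr1 lee_fin.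
  rewrite (_ : 4 = 2 ^+ 2 :> R); last by ring.
  rewrite -exprM mulnC exprM ler_sqr ?nnegrE ?invr_ge0 ?exprn_ge0//.
  by rewrite invf_ple ?posrE ?exprn_gt0// ltW.
apply: (@le_trans _ _ (\int[lebD]_x (1 + \sum_(k <oo) g k x))%E).
  apply: ge0_le_integral => //.
  - by move=> x _; rewrite lee_fin sqr_ge0.
  - by apply/measurable_EFinP; exact: measurable_funX.
  - apply: emeasurable_funD => //.
    by apply: ge0_emeasurable_sum => // k x _ _; exact: g0.
rewrite ge0_integralD//; first last.
- by apply: ge0_emeasurable_sum => // k x _ _; exact: g0.
- by move=> x _; apply: nneseries_ge0.
rewrite integral_cst// mul1e integral_nneseries// /invdistC EFinD fineK; last first.
  exact: fin_num_measure.
(* The k-th term is at most 32 * 2^-k = 64 / 2^(k+1). *)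
rewrite leeD2l// (le_trans _ (@epsilon_trick0 R 64 xpredT _))//.
apply: lee_nneseries => [k _ _|k _]; first by apply: integral_ge0 => x _; exact: g0.
have mc := measurable_cube y (2 ^- k : R).
rewrite /g; under eq_integral do rewrite EFinM.
have mi : measurable_fun [set: X] (fun x => (\1_(cube y (2 ^- k)) x : R)%:E).
  by apply/measurable_EFinP; exact: measurable_indic.
rewrite (@ge0_integralZl _ _ _ lebD setT measurableT _ mi)//.
rewrite integral_indic// setIT.
apply: (@le_trans _ _ ((4 ^+ k.+1)%:E * ((2 * 2 ^- k) ^+ 3)%:E)%E).
  rewrite lee_wpmul2l ?lee_fin ?exprn_ge0//.
  rewrite (le_trans (lebD_le mc))// leb3_cube// invr_ge0 exprn_ge0//.
rewrite -EFinM lee_fin natrX (_ : 4 = 2 * 2 :> R); last by ring.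
rewrite !exprS exprMn expr0; have : 2 ^+ k != 0 :> R by rewrite expf_neq0.
move: (2 ^+ k) => a a0.
rewrite (_ : 2 * 2 * (a * a) * (2 / a * (2 / a * (2 / a * 1))) = 64 / (2 * a))//.
by field.
Qed.

Definition invdist (z : X * X) : R := (dist3 z)^-1.

Lemma measurable_invdist : measurable_fun [set: X * X] invdist.
Proof.
have -> : invdist = (fun z => dist3 z `^ (-1)).
  by apply/funext => z; rewrite powR_inv1// enorm_ge0.
apply: (measurableT_comp (measurable_powR _)); exact: measurable_dist3.
Qed.

Lemma invdist_hs : hs_kernel lebD invdistC invdist.
Proof.
have H (w : X -> R) y : (forall x, w x = (enorm (x - y))^-1 \/ w x = (enorm (y - x))^-1) ->
    measurable_fun [set: X] w -> l2 lebD w /\ dot lebD w w <= invdistC.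
  move=> hw mw; have b := integral_invdist2_le hw mw.
  have lw : l2 lebD w by apply: l2P => //; rewrite (le_lt_trans b)// ltry.
  by split => //; rewrite -lee_fin -dot_fineE.
split; first exact: measurable_invdist.
- move=> x; apply: (@H _ x) => [y|]; first by right.
  exact: (measurableT_comp measurable_invdist (pair1_measurable x)).
- move=> y; apply: (@H _ y) => [x|]; first by left.
  exact: (measurableT_comp measurable_invdist (pair2_measurable y)).
Qed.

End Domain.

(** * Level sets of sums and differences of distances *)

Section LevelSets.
Variable R : realType.
Notation X := (R3 R).
Notation lam := (@lebesgue_measure R).

Lemma quadratic_zeros (a b c : R) : (a, b, c) != (0, 0, 0) ->
  countable [set t | a * t ^+ 2 + b * t + c = 0].
Proof.
move=> abc; set S := [set t | _].
have H t1 t2 t3 : S t1 -> S t2 -> S t3 -> t1 != t2 -> t1 != t3 -> t2 != t3 -> False.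
  rewrite /S/= => e1 e2 e3 n12 n13 n23.
  have h12 : a * (t1 + t2) + b = 0.
    apply: (mulfI (_ : t1 - t2 != 0)); first by rewrite subr_eq0.
    by rewrite mulr0; nra.
  have h13 : a * (t1 + t3) + b = 0.
    apply: (mulfI (_ : t1 - t3 != 0)); first by rewrite subr_eq0.
    by rewrite mulr0; nra.
  have a0 : a = 0.
    apply: (mulfI (_ : t2 - t3 != 0)); first by rewrite subr_eq0.
    by rewrite mulr0; nra.
  have b0 : b = 0 by move: h12; rewrite a0 mul0r add0r.
  have c0 : c = 0 by move: e1; rewrite a0 b0 !mul0r !add0r.
  by move: abc; rewrite a0 b0 c0 eqxx.
have [[t1 S1]|nS] := pselect (exists t, S t); last first.
  by rewrite (_ : S = set0)// -subset0 => t St; apply: nS; exists t.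
have [[t2 [S2 t12]]|nS] := pselect (exists t, S t /\ t1 != t); last first.
  apply: (@sub_countable _ _ _ [set t1]) => //; apply: subset_card_le => t St /=.
  by apply/eqP; rewrite eq_sym; apply: contrapT => /negP h; apply: nS; exists t.
apply: (@sub_countable _ _ _ [set t1; t2]); last exact/finite_set_countable/finite_set2.
apply: subset_card_le => t St /=.
have [->|n1] := eqVneq t t1; first by left.
have [->|n2] := eqVneq t t2; first by right.
by exfalso; apply: (H t1 t2 t) => //; rewrite eq_sym.
Qed.

(** Two squarings turn the equation into a quadratic one. It is not the zero
polynomial: at the point where the difference of the two squared
distances equals c^2 it would force c = 0, and then the leading coefficient is nonzero
because h and h' differ. *)
Lemma hyperbola_countable (a b h h' s c : R) : 0 <= a -> 0 < b -> h != h' ->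
  s ^+ 2 = 1 ->
  countable [set t | Num.sqrt (a + (t - h) ^+ 2) + s * Num.sqrt (b + (t - h') ^+ 2) = c].
Proof.
move=> a0 b0 hh s2.
pose m := 2 * (h' - h); pose n := a - b + h ^+ 2 - h' ^+ 2 - c ^+ 2.
apply: (@sub_countable _ _ _ [set t | (m ^+ 2 - 4 * c ^+ 2) * t ^+ 2 +
  (2 * m * n + 8 * c ^+ 2 * h') * t + (n ^+ 2 - 4 * c ^+ 2 * (b + h' ^+ 2)) = 0]).
  apply: subset_card_le => t /=.
  have := sqr_sqrtr (addr_ge0 a0 (sqr_ge0 (t - h))).
  have := sqr_sqrtr (addr_ge0 (ltW b0) (sqr_ge0 (t - h'))).
  set A := Num.sqrt (a + _); set B := Num.sqrt (b + _) => B2 A2 E.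
  have {}E : A = c - s * B by lra.
  have E2 : A ^+ 2 - B ^+ 2 - c ^+ 2 = - 2 * c * s * B.
    by rewrite E; move: s2; rewrite !expr2 => s2; ring: s2.
  have E3 : (A ^+ 2 - B ^+ 2 - c ^+ 2) ^+ 2 = 4 * c ^+ 2 * B ^+ 2.
    by rewrite E2 !exprMn s2; ring.
  move: E3; rewrite A2 B2 /m /n => E3.
  apply: (@eq_trans _ _ ((a + (t - h) ^+ 2 - (b + (t - h') ^+ 2) - c ^+ 2) ^+ 2 -
    4 * c ^+ 2 * (b + (t - h') ^+ 2))); first by ring.
  by rewrite E3 subrr.
apply: quadratic_zeros; apply/negP => /eqP[h1 h2 h3].
have m0 : m != 0 by rewrite mulf_neq0// subr_eq0 eq_sym.
pose t := - n / m.
have : (m * t + n) ^+ 2 - 4 * c ^+ 2 * (b + (t - h') ^+ 2) = 0.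
  apply: (@eq_trans _ _ ((m ^+ 2 - 4 * c ^+ 2) * t ^+ 2 +
    (2 * m * n + 8 * c ^+ 2 * h') * t + (n ^+ 2 - 4 * c ^+ 2 * (b + h' ^+ 2)))).
    by ring.
  by rewrite h1 h2 h3 !mul0r !addr0.
rewrite (_ : m * t + n = 0); last by rewrite /t; field.
rewrite expr0n/= add0r => /eqP; rewrite oppr_eq0 mulf_eq0 => /orP[|/eqP]; last first.
  by have := sqr_ge0 (t - h'); lra.
rewrite mulf_eq0 pnatr_eq0/= => c0; move: h1; rewrite (eqP c0) mulr0 subr0 => /eqP.
by rewrite expf_eq0/= (negbTE m0).
Qed.

(** On every vertical line except the one through y', the level set is countable;
the lines are parallel to the third axis, along which y and y' differ. *)
Lemma level_null (y y' : X) (s c : R) : s ^+ 2 = 1 -> y.2 != y'.2 ->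
  leb3 R [set x | enorm (x - y) + s * enorm (x - y') = c] = 0.
Proof.
move=> s2 yy; set A := [set x | _].
have mA : measurable A.
  have md z : measurable_fun [set: X] (fun x : X => enorm (x - z)).
    exact: (measurableT_comp (@measurable_dist3 R) (pair2_measurable z)).
  have mf : measurable_fun [set: X] (fun x : X => enorm (x - y) + s * enorm (x - y')).
    by apply: measurable_funD => //; exact: measurable_funM.
  by rewrite -[X in measurable X]setTI; exact: (mf measurableT [set c] _).
pose N : set X := ([set y'.1.1] `*` [set y'.1.2]) `*` setT.
have mN : measurable N by apply: measurableX => //; exact: measurableX.
have N0 : leb3 R N = 0.
  rewrite /leb3 [LHS](@product_measure1E _ _ _ _ R (lam \x lam)%E lam)//; last exact: measurableX.
  rewrite [X in (X * _)%E](@product_measure1E _ _ _ _ R lam lam)//.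
  transitivity (0 * 0 * lam setT)%E; last by rewrite !mul0e.
  by congr (_ * _ * _)%E; exact: lebesgue_measure_set1.
have AN : leb3 R (A `\` N) = 0.
  apply: integral0_eq => u _ /=.
  apply: countable_lebesgue_measure0.
  have [uy|uy] := pselect (u = y'.1).
    rewrite (_ : xsection _ _ = set0) // -subset0 => t.
    rewrite /xsection/= inE => -[_ ]; apply.
    by rewrite /N/= uy.
  pose a := (u.1 - y.1.1) ^+ 2 + (u.2 - y.1.2) ^+ 2.
  pose b := (u.1 - y'.1.1) ^+ 2 + (u.2 - y'.1.2) ^+ 2.
  have b0 : 0 < b.
    have p0 := sqr_ge0 (u.1 - y'.1.1); have q0 := sqr_ge0 (u.2 - y'.1.2).
    rewrite lt_neqAle addr_ge0// andbT eq_sym; apply/negP => /eqP b0.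
    apply: uy; have p1 : (u.1 - y'.1.1) ^+ 2 = 0 by move: b0; rewrite /b; lra.
    have q1 : (u.2 - y'.1.2) ^+ 2 = 0 by move: b0; rewrite /b; lra.
    move/eqP: p1; rewrite sqrf_eq0 subr_eq0 => /eqP p1.
    move/eqP: q1; rewrite sqrf_eq0 subr_eq0 => /eqP q1.
    by case: u p1 q1 {p0 q0 a b b0} => ? ?; case: (y'.1) => ? ? /= -> ->.
  have a0 : 0 <= a by rewrite addr_ge0 ?sqr_ge0.
  apply: sub_countable (hyperbola_countable c a0 b0 yy s2).
  apply: subset_card_le => t; rewrite /xsection/= inE => -[+ _].
  by rewrite /A/= /enorm /dot3/= !expr2.
apply/eqP; rewrite eq_le measure_ge0 andbT.
rewrite (@le_trans _ _ (leb3 R (N `|` (A `\` N))))//.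
  apply: le_measure; rewrite ?inE//.
    by apply: measurableU => //; exact: measurableD.
  by rewrite setUDr setDv setD0 => x; right.
rewrite (le_trans (measureU2 _ _ _))//; first exact: measurableD.
by rewrite [X in (X + _)%E]N0 [X in (_ + X)%E]AN adde0.
Qed.

End LevelSets.

Section ResolventSmall.
Variable R : realType.
Notation X := (R3 R).
Variables (D : set X) (mD : measurable D) (Doo : (leb3 R D < +oo)%E).
Notation lebD := (lebD mD Doo).

(** The pairs with equal third coordinates, which [level_null] does not cover, are
null for the product measure. *)
Lemma level_lebD : {ae (lebD \x lebD)%E, forall (z : X * X) c,
  lebD [set x | dist3 (x, z.1) + dist3 (x, z.2) = c] = 0 /\
  lebD [set x | dist3 (x, z.1) - dist3 (x, z.2) = c] = 0}.
Proof.
pose N := [set z : X * X | z.1.2 = z.2.2].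
have mN : measurable N.
  have mf : measurable_fun [set: X * X] (fun z : X * X => (z.1.2 : R) - z.2.2).
    apply: measurable_funB.
      exact: (measurableT_comp measurable_snd measurable_fst).
    exact: (measurableT_comp measurable_snd measurable_snd).
  rewrite (_ : N = (fun z : X * X => (z.1.2 : R) - z.2.2) @^-1` [set 0]); last first.
    apply/seteqP; split => z; rewrite /N/=; first by move=> ->; rewrite subrr.
    by move=> /eqP; rewrite subr_eq0 => /eqP.
  by rewrite -[X in measurable X]setTI; exact: (mf measurableT [set 0] _).
exists N; split => //.
  apply: integral0_eq => y _ /=.
  have -> : xsection N y = setT `*` [set y.2].
    by apply/seteqP; split => x; rewrite /xsection/= inE /N/=; [move=> <-; split|case].
  have ms : measurable (setT `*` [set y.2] : set X) by apply: measurableX.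
  apply/eqP; rewrite eq_le measure_ge0 andbT (le_trans (lebD_le mD Doo ms))//.
  rewrite /leb3 [leLHS](@product_measure1E _ _ _ _ R _ (@lebesgue_measure R))//.
  by rewrite [X in (_ * X)%E]lebesgue_measure_set1 mule0.
move=> z /=; apply: contra_notP => zN c.
have zz : z.1.2 != z.2.2 by apply/eqP.
have H (s : R) : s ^+ 2 = 1 -> lebD [set x | enorm (x - z.1) + s * enorm (x - z.2) = c] = 0.
  move=> s2; apply/eqP; rewrite eq_le measure_ge0 andbT.
  have md w : measurable_fun [set: X] (fun x : X => enorm (x - w)).
    exact: (measurableT_comp (@measurable_dist3 R) (pair2_measurable w)).
  have mf : measurable_fun [set: X] (fun x : X => enorm (x - z.1) + s * enorm (x - z.2)).
    by apply: measurable_funD => //; exact: measurable_funM.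
  have mA : measurable [set x : X | enorm (x - z.1) + s * enorm (x - z.2) = c].
    by rewrite -[X in measurable X]setTI; exact: (mf measurableT [set c] _).
  by rewrite (le_trans (lebD_le mD Doo mA))// level_null.
have E1 : [set x : X | dist3 (x, z.1) + dist3 (x, z.2) = c] =
    [set x : X | enorm (x - z.1) + 1 * enorm (x - z.2) = c].
  by apply/seteqP; split => x /=; rewrite mul1r.
have E2 : [set x : X | dist3 (x, z.1) - dist3 (x, z.2) = c] =
    [set x : X | enorm (x - z.1) + -1 * enorm (x - z.2) = c].
  by apply/seteqP; split => x /=; rewrite mulN1r.
split; first by rewrite E1; apply: H; rewrite expr1n.
by rewrite E2; apply: H; rewrite sqrrN expr1n.
Qed.

(** The two phases give 4 pi times the real and the imaginary part of the kernel
of R_k. No decay rate is obtained, only the existence of arbitrarily large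
such k; that is enough, since the recovery procedure may choose its
wavenumbers. *)
Lemma trig_kernel_small (e : R) N : 0 < e ->
  exists2 k : nat, (N <= k)%N & forall t, t = 0 \/ t = - (pi / 2) ->
    forall f, l2 lebD f ->
    dot lebD (kernel_op lebD (osc (@invdist R) (@dist3 R) k%:R t) f)
           (kernel_op lebD (osc (@invdist R) (@dist3 R) k%:R t) f) <= e * dot lebD f f.
Proof.
exact: (osc_op_small (invdist_hs mD Doo) (@measurable_dist3 R) level_lebD).
Qed.

End ResolventSmall.

(** * Moments of the normal law *)

Section NormalMoments.
Variable R : realType.
Notation lam := (@lebesgue_measure R).

Lemma normal_int_bounded (s C : R) (f : R -> R) : s != 0 ->
  measurable_fun [set: R] f -> (forall x, `|f x| <= C) ->
  (\int[normal_prob 0 s]_x (f x)%:E = \int[lam]_x (f x * normal_pdf 0 s x)%:E)%E.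
Proof.
move=> s0 mf fC.
have dom := normal_prob_dominates 0 s.
rewrite -(Radon_Nikodym_change_of_variables dom)//=; last first.
  apply: (@le_integrable _ _ _ _ _ _ _ (EFin \o cst C)) => //.
  - exact/measurable_EFinP.
  - by move=> x _ /=; rewrite lee_fin (le_trans (fC x))// ler_norm.
  - exact: finite_measure_integrable_cst.
apply: ae_eq_integral => //.
- apply: emeasurable_funM; first exact/measurable_EFinP.
  by apply: (measurable_int lam); apply: Radon_Nikodym_integrable; exact: dom.
- apply/measurable_EFinP; apply: measurable_funM => //.
  exact: measurable_normal_pdf.
- rewrite [X in ae_eq _ _ _ X](_ : _ = (fun x => (f x)%:E * (normal_pdf 0 s x)%:E)%E)//.
  apply: ae_eqe_mul2l => /=.
  rewrite Radon_NikodymE//=.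
  case: cid => /= h [h1 h2 h3].
  apply: integral_ae_eq => //=.
  + by apply/measurable_EFinP; exact: measurable_normal_pdf.
  + by move=> E E01 mE; rewrite -h3.
Qed.

Lemma normal_int (s : R) (f : R -> R) : s != 0 ->
  measurable_fun [set: R] f -> (forall x, 0 <= f x) ->
  (\int[normal_prob 0 s]_x (f x)%:E = \int[lam]_x (f x * normal_pdf 0 s x)%:E)%E.
Proof.
move=> s0 mf f0.
pose g (n : nat) x := Num.min (f x) n%:R.
have mg n : measurable_fun [set: R] (g n) by apply: measurable_minr => //.
have g0 n x : 0 <= g n x by rewrite le_min f0 ler0n.
have nd x m n : (m <= n)%N -> g m x <= g n x.
  by move=> mn; rewrite /g le_min ge_min lexx/= ge_min ler_nat mn orbT.
have gf x : \forall n \near \oo, g n x = f x.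
  exists (Num.truncn (f x)).+1 => // n /= hn.
  apply/min_idPl; rewrite ltW// (lt_le_trans (truncnS_gt _))//.
  by rewrite ler_nat.
have H1 := @cvg_monotone_convergence _ _ _ (normal_prob 0 s) setT measurableT
  (fun n x => (g n x)%:E).
have H2 := @cvg_monotone_convergence _ _ _ lam setT measurableT
  (fun n x => (g n x * normal_pdf 0 s x)%:E).
have {H1} H1 : (\int[normal_prob 0 s]_x (g n x)%:E @[n --> \oo] -->
    \int[normal_prob 0 s]_x (f x)%:E)%E.
  rewrite [X in _ --> X](_ : _ = \int[normal_prob 0 s]_x limn (fun n => (g n x)%:E))%E; last first.
    apply: eq_integral => x _; apply/esym/cvg_lim => //; apply: cvg_near_cst.
    by apply: filterS (gf x) => n ->.
  apply: H1 => //.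
  - by move=> n /=; apply/measurable_EFinP; exact: mg.
  - by move=> n x _; rewrite lee_fin.
  - by move=> x _ m n mn; rewrite lee_fin nd.
have {H2} H2 : (\int[lam]_x (g n x * normal_pdf 0 s x)%:E @[n --> \oo] -->
    \int[lam]_x (f x * normal_pdf 0 s x)%:E)%E.
  rewrite [X in _ --> X](_ : _ = \int[lam]_x limn (fun n => (g n x * normal_pdf 0 s x)%:E))%E; last first.
    apply: eq_integral => x _; apply/esym/cvg_lim => //; apply: cvg_near_cst.
    by apply: filterS (gf x) => n ->.
  apply: H2 => //.
  - by move=> n /=; apply/measurable_EFinP; apply: measurable_funM; [exact: mg|exact: measurable_normal_pdf].
  - by move=> n x _; rewrite lee_fin mulr_ge0// normal_pdf_ge0.
  - by move=> x _ m n mn; rewrite lee_fin ler_wpM2r ?normal_pdf_ge0// nd.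
apply: (cvg_unique _ H1) => //; apply: (cvg_trans _ H2); apply: near_eq_cvg; near=> n.
apply/esym; apply: (@normal_int_bounded s n%:R) => // x.
by rewrite ger0_norm// /g ge_min lexx orbT.
Unshelve. all: by end_near.
Qed.

(** Fundamental theorem of calculus on [-n, n]: an integrable derivative has
integral 0 when the boundary terms cancel in the limit. *)
Lemma int_derivative0 (F f : R -> R) : (forall x : R, is_derive x 1 F (f x)) ->
  continuous f -> intg lam f ->
  (fun n : nat => F n%:R - F (- n%:R)) @ \oo --> (0 : R) ->
  \int[lam]_x f x = 0.
Proof.
move=> dF cf fi F0.
have mf := intg_meas fi.
pose A (n : nat) : set R := `[- n%:R, n%:R]%classic.
have H : (fun n : nat => \int[lam]_x ((f \_ (A n)) x)) @ \oo --> \int[lam]_x f x.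
  apply: (@Rintegral_dominated_cvg _ _ _ lam _ _ (fun x => `|f x|)) => //.
  - move=> n; have mA : measurable (A n) by exact: measurable_itv.
    by apply/(measurable_restrictT f mA); exact: measurable_funTS.
  - apply: aeW => x; apply: cvg_near_cst; exists (Num.truncn `|x|).+1 => // n /= hn.
    rewrite patchE mem_set// /A/= in_itv/= -ler_norml ltW//.
    by rewrite (lt_le_trans (truncnS_gt _))// ler_nat.
  - exact: (integrable_norm fi).
  - by move=> n x; rewrite patchE; case: ifP => // _; rewrite normr0.
apply: (cvg_unique _ H) => //; apply: (cvg_trans _ F0); apply: near_eq_cvg; near=> n.
have n0 : - n%:R < n%:R :> R.
  have : (0 < n)%N by near: n; exists 1%N.
  by rewrite -(ltr_nat R); lra.
rewrite -Rintegral_mkcond /Rintegral (@continuous_FTC2 _ f F)//.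
- exact: continuous_subspaceT.
- have cF : continuous F by move=> x; apply/differentiable_continuous/derivable1_diffP; have [] := dF x.
  split; first by move=> x _; have [] := dF x.
  + by apply: cvg_at_right_filter; exact: cF.
  + by apply: cvg_at_left_filter; exact: cF.
- by move=> x _; rewrite derive1E; have := dF x => dFx; rewrite derive_val.
Unshelve. all: by end_near.
Qed.

Section Moments.
Variables (s : R) (s0 : s != 0).
Let G (x : R) : R := expR (- x ^+ 2 / (s ^+ 2 *+ 2)).

Let s2_gt0 : 0 < s ^+ 2. Proof. by rewrite exprn_even_gt0. Qed.

Let G_gt0 x : 0 < G x. Proof. exact: expR_gt0. Qed.

Let is_deriveG (x : R) : is_derive x 1 G (- (x / s ^+ 2) * G x).
Proof.
have dq : is_derive x 1 (fun y : R => (- (s ^+ 2 *+ 2)^-1) * y ^+ 2)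
    ((- (s ^+ 2 *+ 2)^-1) * (2 * x)).
  apply: is_derive_eq.
  by rewrite /GRing.scale/=; ring.
have -> : G = expR \o (fun y : R => (- (s ^+ 2 *+ 2)^-1) * y ^+ 2).
  by apply/funext => y; rewrite /G/=; congr expR; ring.
apply: (is_derive_eq (@is_derive1_comp _ expR _ x _ _ (is_derive_expR _) dq)).
by rewrite /=; field.
Qed.

Let continuousG : continuous G.
Proof.
move=> x; apply/differentiable_continuous/derivable1_diffP.
by have [] := is_deriveG x.
Qed.

Let is_derivexG n (x : R) : is_derive x 1 (fun y => y ^+ n.+1 * G y)
  (n.+1%:R * (x ^+ n * G x) - (s ^+ 2)^-1 * (x ^+ n.+2 * G x)).
Proof.
have dX : is_derive x 1 (fun y : R => y ^+ n.+1) (n.+1%:R * x ^+ n).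
  have -> : (fun y : R => y ^+ n.+1) = (id : R -> R) ^+ n.+1.
    by apply/funext => y; rewrite exprfctE.
  apply: (is_derive_eq (is_deriveX n.+1 (is_derive_id x 1))).
  by rewrite /GRing.scale/= mulr1.
have -> : (fun y => y ^+ n.+1 * G y) = (fun y : R => y ^+ n.+1) * G by [].
apply: (is_derive_eq (is_deriveM dX (is_deriveG x))).
by rewrite /GRing.scale/= !exprS; field; exact: s0.
Qed.

Let G4_bound x : x ^+ 4 * G x <= 32 * s ^+ 4 * normal_fun 0 (Num.sqrt 2 * s) x.
Proof.
rewrite /normal_fun subr0 exprMn sqr_sqrtr//.
pose u := x ^+ 2 / (s ^+ 2 * 4).
have u0 : 0 <= u by rewrite divr_ge0 ?sqr_ge0// mulr_ge0// ltW.
have h := expR_ge1Dxn 1 u0.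
have -> : G x = expR (- u) * expR (- u).
  by rewrite -expRD /G; congr expR; rewrite /u; field.
have -> : expR (- x ^+ 2 / (2 * s ^+ 2 *+ 2)) = expR (- u).
  by congr expR; rewrite /u; field.
have -> : x ^+ 4 = 16 * s ^+ 4 * u ^+ 2 by rewrite /u; field.
rewrite (_ : 16 * s ^+ 4 * u ^+ 2 * (expR (- u) * expR (- u)) =
  16 * s ^+ 4 * (u ^+ 2 * expR (- u)) * expR (- u)); last by ring.
rewrite ler_wpM2r ?expR_ge0// (_ : 32 = 16 * 2 :> R); last by ring.
rewrite -[_ * 2 * _]mulrAC ler_wpM2l//; first by rewrite mulr_ge0// exprn_even_ge0.
rewrite expRN ler_pdivrMr ?expR_gt0//; move: h; rewrite /= (_ : 2`! = 2%N)//.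
lra.
Qed.

Let intg_fun (c : R) (t : R) : t != 0 -> intg lam (fun x => c * normal_fun 0 t x).
Proof.
move=> t0; have := intgZ (c / normal_peak t) (@integrable_normal_pdf R 0 t).
apply: eq_integrable => // x _; congr EFin.
by rewrite normal_pdfE//; field; rewrite gt_eqF// normal_peak_gt0.
Qed.

Let intg_xG n : (n <= 4)%N -> intg lam (fun x => x ^+ n * G x).
Proof.
move=> n4.
have r2 : Num.sqrt 2 * s != 0 by rewrite mulf_neq0// gt_eqF// sqrtr_gt0.
have iG := intg_fun 1 s0.
apply: intg_le (intgD (intg_fun (32 * s ^+ 4) r2) iG) _ => [|x].
  apply: measurable_funM; first exact: measurable_funX.
  exact: continuous_measurable_fun.
rewrite normrM (ger0_norm (ltW (G_gt0 x))) normrX mul1r.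
have -> : normal_fun 0 s x = G x by rewrite /normal_fun subr0.
apply: (@le_trans _ _ (`|x| ^+ 4 * G x + G x)); last first.
  rewrite lerD2r (le_trans _ (G4_bound x))// -normrX ger0_norm//.
  by rewrite exprn_even_ge0.
rewrite -[X in _ + X]mul1r -mulrDl ler_wpM2r ?(ltW (G_gt0 x))//.
have [x1|x1] := leP 1 `|x|.
  by rewrite (le_trans (ler_weXn2l x1 n4))// lerDl.
by rewrite (le_trans (exprn_ile1 _ (normr_ge0 x) (ltW x1)))// lerDr exprn_ge0.
Qed.

Let cvg_xG n : (n <= 3)%N -> (fun m : nat => m%:R ^+ n * G m%:R) @ \oo --> (0 : R).
Proof.
move=> n3.
have K0 : 0 <= 32 * s ^+ 4 by rewrite mulr_ge0// exprn_even_ge0.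
have h : (fun m : nat => (32 * s ^+ 4) * (m%:R)^-1) @ \oo --> (0 : R).
  rewrite -[X in _ --> X](mulr0 (32 * s ^+ 4)); apply: cvgM; first exact: cvg_cst.
  rewrite -cvg_shiftS /=; exact: cvg_harmonic.
apply: (squeeze_cvgr _ (cvg_cst 0) h); near=> m; apply/andP; split.
  by rewrite mulr_ge0 ?exprn_ge0// ltW.
have m1 : 1 <= m%:R :> R by rewrite ler1n; near: m; exists 1%N.
rewrite ler_pdivlMr; last by rewrite (lt_le_trans _ m1).
apply: (@le_trans _ _ (m%:R ^+ 4 * G m%:R)).
  rewrite mulrAC ler_wpM2r ?(ltW (G_gt0 _))// -exprSr.
  exact: (@ler_weXn2l R _ m1).
rewrite (le_trans (G4_bound _))// ler_piMr//.
rewrite /normal_fun -expR0 ler_expR mulNr oppr_le0 mulr_ge0 ?sqr_ge0//.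
by rewrite invr_ge0 mulrn_wge0// sqr_ge0.
Unshelve. all: by end_near.
Qed.

Let rec_xG n : (n <= 2)%N -> ~~ odd n ->
  \int[lam]_x (x ^+ n.+2 * G x) = s ^+ 2 * n.+1%:R * \int[lam]_x (x ^+ n * G x).
Proof.
move=> n2 on.
have i1 : intg lam (fun x => x ^+ n * G x) by apply: intg_xG; rewrite (leq_trans n2).
have i2 : intg lam (fun x => x ^+ n.+2 * G x) by exact: intg_xG.
have := @int_derivative0 (fun y => y ^+ n.+1 * G y)
  (fun x => n.+1%:R * (x ^+ n * G x) - (s ^+ 2)^-1 * (x ^+ n.+2 * G x)) (is_derivexG n).
rewrite RintegralB//; [|exact: (intgZ n.+1%:R i1)|exact: (intgZ (s ^+ 2)^-1 i2)].
rewrite !RintegralZl// => H.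
suff : n.+1%:R * \int[lam]_x (x ^+ n * G x) - (s ^+ 2)^-1 * \int[lam]_x (x ^+ n.+2 * G x) = 0.
  by move/eqP; rewrite subr_eq0 => /eqP h; rewrite -mulrA h; field; exact: s0.
apply: H.
- have cX k : continuous (fun x : R => x ^+ k * G x).
    by move=> x; apply: cvgM; [exact: exprn_continuous|exact: continuousG].
  move=> x; apply: cvgB; apply: cvgM; try exact: cvg_cst; exact: cX.
- by apply: intgB; exact: intgZ.
- have c := @cvg_xG n.+1 n2.
  have -> : (fun m : nat => m%:R ^+ n.+1 * G m%:R - (- m%:R) ^+ n.+1 * G (- m%:R)) =
     (fun m : nat => 2 * (m%:R ^+ n.+1 * G m%:R)).
    apply/funext => m; have -> : G (- m%:R) = G m%:R by rewrite /G sqrrN.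
    by rewrite exprNn -signr_odd/= on expr1; ring.
  by rewrite -[X in _ --> X](mulr0 2); apply: cvgM; [exact: cvg_cst|exact: c].
Qed.

(** Integrating the derivative of x^(n+1) exp(- x^2/(2 s^2)) relates the moments of
order n + 2 and n. *)
Lemma normal_moments :
  (\int[normal_prob 0 s]_x (x ^+ 2)%:E = (s ^+ 2)%:E)%E /\
  (\int[normal_prob 0 s]_x (x ^+ 4)%:E = (3 * s ^+ 4)%:E)%E.
Proof.
have pdfG x : normal_pdf 0 s x = normal_peak s * G x.
  by rewrite normal_pdfE//= /normal_fun subr0.
have m0 : \int[lam]_x (x ^+ 0 * G x) = (normal_peak s)^-1.
  have := integral_normal_pdf 0 s => H.
  have : \int[lam]_x (normal_peak s * (x ^+ 0 * G x)) = 1.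
    rewrite -[RHS]/(fine 1%E) -H /Rintegral; congr fine; apply: eq_integral => x _.
    by rewrite pdfG expr0 mul1r.
  rewrite RintegralZl//; last exact: intg_xG.
  move=> h; apply: (mulfI (_ : normal_peak s != 0)).
    by rewrite gt_eqF// normal_peak_gt0.
  by rewrite h mulfV// gt_eqF// normal_peak_gt0.
have m2 := @rec_xG 0 isT isT; have m4 := @rec_xG 2 isT isT.
have pk := normal_peak_gt0 s0.
have H n : (n <= 4)%N -> ~~ odd n -> (\int[normal_prob 0 s]_x (x ^+ n)%:E =
   (normal_peak s * \int[lam]_x (x ^+ n * G x))%:E)%E.
  move=> n4 on; rewrite normal_int//; last by move=> x; rewrite exprn_even_ge0.
  rewrite -RintegralZl//; last exact: intg_xG.
  rewrite /Rintegral fineK; last exact: (integrable_fin_num measurableT (intgZ _ (intg_xG n4))).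
  by apply: eq_integral => x _; rewrite pdfG; congr EFin; ring.
rewrite !H// m4 m2 m0; split; congr EFin; field; exact: lt0r_neq0.
Qed.

End Moments.

End NormalMoments.

(** * Almost sure convergence, and square integrability on the domain *)

Section BorelCantelli.
Context d (T : measurableType d) (R : realType).
Variable P : {measure set T -> \bar R}.

Lemma eseries_cvg0 (u : nat -> \bar R) : (forall n, (0 <= u n)%E) ->
  (\sum_(n <oo) u n < +oo)%E ->
  (forall n, (u n < +oo)%E) /\ (fun n => fine (u n)) @ \oo --> (0 : R).
Proof.
move=> u0 su.
have ufin n : (u n < +oo)%E.
  apply: le_lt_trans su.
  have := @nneseries_lim_ge R u xpredT 0%N n.+1 (fun k _ _ => u0 k).
  by apply: le_trans; rewrite big_nat_recr//= leeDr// sume_ge0.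
split => //; apply: cvg_series_cvg_0.
have uE n : u n = (fine (u n))%:E by rewrite fineK// ge0_fin_numE.
apply: nondecreasing_is_cvgn.
  move=> m n mn; rewrite /series/= -subr_ge0 sub_series_geq//.
  by apply: sumr_ge0 => i _; exact: fine_ge0.
exists (fine (\sum_(n <oo) u n)%E) => _ [n _ <-].
rewrite -lee_fin fineK; last by rewrite ge0_fin_numE// nneseries_ge0.
rewrite /series/= -sumEFin; under eq_bigr do rewrite -uE.
by apply: nneseries_lim_ge.
Qed.

(** The expectation of the sum of the g n is finite, so that almost surely the
sum is finite and its terms tend to 0. *)
Lemma ae_cvg0 (C : R) (g : nat -> T -> \bar R) :
  (forall n, measurable_fun [set: T] (g n)) -> (forall n x, (0 <= g n x)%E) ->
  (forall n, (\int[P]_x g n x <= (C / 2 ^+ n)%:E)%E) -> 0 <= C ->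
  {ae P, forall w, (forall n, (g n w < +oo)%E) /\
     (fun n => fine (g n w)) @ \oo --> (0 : R)}.
Proof.
move=> mg g0 gC C0.
have H : (\int[P]_x \sum_(n <oo) g n x < +oo)%E.
  rewrite integral_nneseries//.
  apply: (@le_lt_trans _ _ (2 * C)%:E); last exact: ltry.
  rewrite (le_trans _ (@epsilon_trick0 R (2 * C) xpredT _))//; last by rewrite mulr_ge0.
  apply: lee_nneseries => [n _ _|n _]; first exact: integral_ge0.
  rewrite (le_trans (gC n))// lee_fin expnS natrM -natrX invfM mulrACA mulfV//.
  by rewrite mul1r.
have : P.-integrable setT (fun x => \sum_(n <oo) g n x)%E.
  apply/integrableP; split; first by apply: ge0_emeasurable_sum.
  by under eq_integral do rewrite gee0_abs ?nneseries_ge0//.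
move=> /(integrable_ae measurableT); apply: filterS => w /= /(_ I) fw.
apply: eseries_cvg0 => // .
by rewrite -ge0_fin_numE ?nneseries_ge0.
Qed.

End BorelCantelli.

Section L2bridge.
Variable R : realType.
Notation X := (R3 R).
Variables (D : set X) (mD : measurable D) (Doo : (leb3 R D < +oo)%E).
Notation lebD := (lebD mD Doo).

Lemma Rintegral_lebD (f : X -> R) : measurable_fun [set: X] f ->
  \int[leb3 R]_(x in D) f x = \int[lebD]_x f x.
Proof.
move=> mf; rewrite (Rintegral_lebD_patch mD Doo) /Rintegral; congr fine.
apply: ae_eq_integral => //.
- by apply/measurable_EFinP; apply/(measurable_restrictT f mD); exact: measurable_funTS.
- exact/measurable_EFinP.
by apply: filterS (lebD_ae mD Doo) => x Dx _; rewrite patchE mem_set.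
Qed.

Lemma integral_lebD (f : X -> \bar R) : measurable_fun [set: X] f ->
  (\int[leb3 R]_(x in D) f x = \int[lebD]_x f x)%E.
Proof.
move=> mf; rewrite (integral_lebD_patch mD Doo).
apply: ae_eq_integral => //.
- by apply/(measurable_restrictT f mD); exact: measurable_funTS.
by apply: filterS (lebD_ae mD Doo) => x Dx _; rewrite patchE mem_set.
Qed.

Lemma L2E (f : X -> R) : L2 D f <->
  measurable_fun [set: X] (f \_ D) /\
  (\int[leb3 R]_x ((f \_ D) x ^+ 2)%:E < +oo)%E.
Proof.
split.
  move=> lf; split.
    by move: (lf); rewrite /L2 inE => /andP[/[!inE]].
  have /integrableP[_] := Lfun2_integrable_sqr lf.
  by under eq_integral do rewrite /= ger0_norm ?sqr_ge0//.
move=> [mf f2]; rewrite /L2 inE; apply/andP; split; rewrite inE//=.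
rewrite /finite_norm unlock poweR_lty//.
rewrite (eq_integral (fun x => ((f \_ D) x ^+ 2)%:E))// => x _ /=.
by rewrite powR_mulrn// real_normK ?num_real.
Qed.

Lemma l2_L2 (f : X -> R) : l2 lebD f -> L2 D f.
Proof.
move=> lf; have mf := l2_meas lf; apply/L2E; split.
  by apply/(measurable_restrictT f mD); exact: measurable_funTS.
have -> : (\int[leb3 R]_x ((f \_ D) x ^+ 2)%:E = \int[leb3 R]_(x in D) (f x ^+ 2)%:E)%E.
  rewrite [RHS]integral_mkcond; apply: eq_integral => x _.
  by rewrite !patchE; case: ifP => // _; rewrite expr0n.
rewrite integral_lebD; last by apply/measurable_EFinP; exact: measurable_funX.
by rewrite dot_fineE// ltry.
Qed.

Lemma L2_l2 (f : X -> R) : L2 D f -> l2 lebD (f \_ D).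
Proof.
move=> /L2E[mf f2]; apply: (l2P mf).
have mf2 : measurable_fun [set: X] (fun x => ((f \_ D) x ^+ 2)%:E).
  by apply/measurable_EFinP; exact: measurable_funX.
rewrite -(integral_lebD mf2); apply: (le_lt_trans _ f2).
rewrite [leLHS](_ : _ = \int[leb3 R]_x ((f \_ D) x ^+ 2)%:E)%E//.
rewrite [LHS]integral_mkcond; apply: eq_integral => x _.
rewrite [LHS]patchE; case: ifPn => // xD.
by rewrite patchE (negbTE xD) expr0n.
Qed.

End L2bridge.

(** * A law of large numbers for squares of white noise *)

Section GaussianField.
Context (R : realType) (D : set (R3 R)) (d : measure_display)
  (Omega : measurableType d) (P : probability Omega R)
  (B : (R3 R -> R) -> {RV P >-> R}).
Hypothesis hB : white_noise D B.
Notation X := (R3 R).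
Variables (mD : measurable D) (Doo : (leb3 R D < +oo)%E).
Notation lebD := (lebD mD Doo).

Lemma gaussian_moments (Y : {RV P >-> R}) : centered_gaussian Y ->
  exists s : R, (\int[P]_w (Y w ^+ 2)%:E = (s ^+ 2)%:E)%E /\
    (\int[P]_w (Y w ^+ 4)%:E = (3 * s ^+ 4)%:E)%E.
Proof.
move=> [s s0 H]; exists s.
pose Y' : Omega -> measurableTypeR R := Y.
have mY : measurable_fun [set: Omega] Y' by exact: (@measurable_funPT _ _ _ _ Y).
have E n : ~~ odd n ->
    (\int[P]_w (Y w ^+ n)%:E = \int[pushforward P Y']_x (x ^+ n)%:E)%E.
  move=> on; rewrite (@ge0_integral_pushforward _ _ _ _ _ _ mY P setT)//.
  - by apply/measurable_EFinP; exact: measurable_funX.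
  - by move=> x _; rewrite lee_fin exprn_even_ge0.
rewrite !E//.
have [s00|sn0] := eqVneq s 0.
  have F n : (\int[pushforward P Y']_x (x ^+ n.+1)%:E = 0)%E.
    rewrite (eq_measure_integral (dirac (0 : measurableTypeR R)))/=; last first.
      by move=> A mA _; rewrite -[LHS]/(distribution P Y A) H// s00 eqxx.
    rewrite integral_dirac//= ?diracT ?expr0n ?mul1e//.
    by apply/measurable_EFinP; exact: measurable_funX.
  by rewrite !F s00 !expr0n/= mulr0.
have F n : (\int[pushforward P Y']_x (x ^+ n)%:E = \int[normal_prob 0 s]_x (x ^+ n)%:E)%E.
  rewrite (eq_measure_integral (normal_prob 0 s))// => A mA _.
  by rewrite -[LHS]/(distribution P Y A) H// (negbTE sn0).
by rewrite !F; exact: normal_moments.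
Qed.

Lemma B_lin a f g w : l2 lebD f -> l2 lebD g ->
  B (fun x => a * f x + g x) w = a * B f w + B g w.
Proof. by move=> lf lg; case: hB => _ + _ _; apply; exact: (@l2_L2 _ _ mD Doo). Qed.

Lemma B_add f g w : l2 lebD f -> l2 lebD g ->
  B (fun x => f x + g x) w = B f w + B g w.
Proof.
move=> lf lg; have := B_lin 1 w lf lg; rewrite mul1r => <-.
by congr (B _ w); apply/funext => x; rewrite mul1r.
Qed.

Lemma B_sub f g w : l2 lebD f -> l2 lebD g ->
  B (fun x => f x - g x) w = B f w - B g w.
Proof.
move=> lf lg; have := B_lin (-1) w lg lf; rewrite mulN1r addrC => <-.
by congr (B _ w); apply/funext => x; rewrite mulN1r addrC.
Qed.

Lemma B_cov f g : l2 lebD f -> l2 lebD g ->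
  (\int[P]_w (B f w * B g w)%:E = (dot lebD f g)%:E)%E.
Proof.
move=> lf lg; have Lf := l2_L2 lf; have Lg := l2_L2 lg.
have mfg : measurable_fun [set: X] (fun x => f x * g x).
  by apply: measurable_funM; [exact: l2_meas lf|exact: l2_meas lg].
have -> : dot lebD f g = \int[leb3 R]_(x in D) (f x * g x).
  by rewrite (Rintegral_lebD mD Doo mfg).
by case: hB => _ _ _ /(_ f g Lf Lg) <-; rewrite expectation.unlock.
Qed.

Lemma B_moments f : l2 lebD f ->
  [/\ l2 P (B f), l2 P (fun w => B f w ^+ 2),
    dot P (B f) (B f) = dot lebD f f &
    \int[P]_w (B f w ^+ 4) = 3 * dot lebD f f ^+ 2].
Proof.
move=> lf; have gf : centered_gaussian (B f) by case: hB => _ _ + _; apply; exact: l2_L2 lf.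
have [s [s2 s4]] := gaussian_moments gf.
have c := B_cov lf lf.
have c' : (\int[P]_w (B f w ^+ 2)%:E = (dot lebD f f)%:E)%E.
  by rewrite -c; apply: eq_integral => w _; rewrite expr2.
have sd : s ^+ 2 = dot lebD f f by apply/EFin_inj; rewrite -s2.
split.
- by apply: l2P => //; rewrite c' ltry.
- apply: l2P; first exact: measurable_funX.
  under eq_integral do rewrite -exprM.
  by rewrite s4 ltry.
- by rewrite /dot /Rintegral c.
- by rewrite /Rintegral s4/= -sd -exprM.
Qed.

(** Isserlis' formula for squares. It follows from the fourth moments of the
Gaussian variables B(f + g) and B(f - g), by the polarization identity
(x + y)^4 + (x - y)^4 = 2 x^4 + 12 x^2 y^2 + 2 y^4; joint normality is not
involved. *)
Lemma square_cov f g : l2 lebD f -> l2 lebD g ->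
  dot P (fun w => B f w ^+ 2 - dot lebD f f) (fun w => B g w ^+ 2 - dot lebD g g) =
  2 * dot lebD f g ^+ 2.
Proof.
move=> lf lg; have [f1 f2 f3 f4] := B_moments lf; have [g1 g2 g3 g4] := B_moments lg.
have lp := l2D lf lg; have lm := l2B lf lg.
have [p1 p2 p3 p4] := B_moments lp; have [m1 m2 m3 m4] := B_moments lm.
have l1 (c : R) : l2 P (fun=> c) by exact: (@l2_bounded _ _ _ P _ `|c| (measurable_cst _)).
have i4 (h : Omega -> R) : l2 P (fun w => h w ^+ 2) -> intg P (fun w => h w ^+ 4).
  by move=> [_]; apply: eq_integrable => // w _ /=; rewrite -exprM.
have E : \int[P]_w (B f w ^+ 2 * B g w ^+ 2) =
    dot lebD f f * dot lebD g g + 2 * dot lebD f g ^+ 2.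
  have := p4; have -> : \int[P]_w (B (fun x => f x + g x) w ^+ 4) =
     2 * \int[P]_w (B f w ^+ 4) + 12 * \int[P]_w (B f w ^+ 2 * B g w ^+ 2) +
     2 * \int[P]_w (B g w ^+ 4) - \int[P]_w (B (fun x => f x - g x) w ^+ 4).
    have ifg := l2_mul f2 g2.
    rewrite -!RintegralZl//; [|exact: i4|exact: i4].
    have j1 := intgZ 2 (i4 _ f2); have j2 := intgZ 12 ifg; have j3 := intgZ 2 (i4 _ g2).
    rewrite -(RintegralD measurableT j1 j2) -(RintegralD measurableT (intgD j1 j2) j3).
    rewrite -(RintegralB measurableT (intgD (intgD j1 j2) j3) (i4 _ m2)).
    by apply: eq_Rintegral => w _; rewrite B_add// B_sub//; ring.
  rewrite m4 f4 g4.
  rewrite (dotDl lf lg lp) (dotDr lf lg lf) (dotDr lf lg lg).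
  rewrite (dotBl lf lg lm) (dotBr lf lg lf) (dotBr lf lg lg) (dotC _ g f).
  set a := dot _ f f; set b := dot _ g g; set c := dot _ f g => H.
  have {}H : 12 * \int[P]_w (B f w ^+ 2 * B g w ^+ 2) = 12 * (a * b + 2 * c ^+ 2).
    by apply/eqP; rewrite -subr_eq0; apply/eqP; move: H; rewrite !expr2 => H; nra.
  by apply: (mulfI (_ : 12 != 0)); rewrite ?pnatr_eq0.
have lf0 := l1 (dot lebD f f); have lg0 := l1 (dot lebD g g).
rewrite (dotBl f2 lf0 (l2B g2 lg0)) (dotBr g2 lg0 f2) (dotBr g2 lg0 lf0).
have D1 : dot P (fun=> dot lebD f f) (fun w => B g w ^+ 2) = dot lebD f f * dot lebD g g.
  rewrite /dot RintegralZl//; last exact: g1.2.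
  by congr (_ * _); rewrite dotE g3.
have D2 : dot P (fun w => B f w ^+ 2) (fun=> dot lebD g g) = dot lebD f f * dot lebD g g.
  rewrite dotC /dot RintegralZl//; last exact: f1.2.
  by rewrite mulrC; congr (_ * _); rewrite dotE f3.
have D3 : dot P (fun=> dot lebD f f) (fun=> dot lebD g g) = dot lebD f f * dot lebD g g.
  move: (dot lebD f f) (dot lebD g g) => a b.
  rewrite /dot Rintegral_cst//; transitivity (a * b * 1); last by rewrite mulr1.
  by congr (_ * _); exact: (congr1 fine (probability_setT P)).
rewrite D1 D2 D3 (_ : dot P _ _ = dot lebD f f * dot lebD g g + 2 * dot lebD f g ^+ 2)//.
ring.
Qed.

(** The variance of the average is 2 * 4^-n times the sum over i and l of the squared
covariances, hence at most 2 C 2^-n, which is summable. *)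
Lemma lln_square (C : R) (f : nat -> nat -> X -> R) : 0 <= C ->
  (forall n i, (i < 2 ^ n)%N -> l2 lebD (f n i)) ->
  (forall n l, (l < 2 ^ n)%N -> \sum_(i < 2 ^ n) dot lebD (f n i) (f n l) ^+ 2 <= C) ->
  {ae P, forall w, (fun n => (2 ^+ n)^-1 * \sum_(i < 2 ^ n)
     (B (f n i) w ^+ 2 - dot lebD (f n i) (f n i))) @ \oo --> (0 : R)}.
Proof.
move=> C0 lf bf.
have l1 (c : R) : l2 P (fun=> c) by exact: (@l2_bounded _ _ _ P _ `|c| (measurable_cst _)).
pose Y n i w := B (f n i) w ^+ 2 - dot lebD (f n i) (f n i).
have lY n i : (i < 2 ^ n)%N -> l2 P (Y n i).
  by move=> ni; have [_ h _ _] := B_moments (lf n i ni); exact: (l2B h (l1 _)).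
pose S n w := \sum_(i < 2 ^ n) Y n i w.
have lS n : l2 P (S n) by apply: l2_sum => i; exact: lY.
have bS n : dot P (S n) (S n) <= 2 ^+ n * (2 * C).
  rewrite (dot_suml (lY n) (lS n)).
  rewrite (@le_trans _ _ (\sum_(i < 2 ^ n) 2 * C))//; last first.
    by rewrite sumr_const card_ord -[leLHS]mulr_natl natrX.
  apply: ler_sum => l _; rewrite dotC (dot_suml (lY n) (lY n l (ltn_ord l))).
  apply: le_trans (ler_wpM2l (ler0n R 2) (bf n l (ltn_ord l))).
  rewrite mulr_sumr; apply: ler_sum => i _.
  by rewrite square_cov//; exact: lf.
pose g n w := (((2 ^+ n)^-1 * S n w) ^+ 2)%:E.
have mg n : measurable_fun setT (g n).
  apply/measurable_EFinP; apply: measurable_funX; apply: measurable_funM => //.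
  exact: l2_meas (lS n).
have := @ae_cvg0 _ _ _ P (2 * C) g mg (fun n w => sqr_ge0 _) _ (mulr_ge0 (ler0n R 2) C0).
have gb n : (\int[P]_w g n w <= (2 * C / 2 ^+ n)%:E)%E.
  rewrite /g (dot_fineE (l2Z _ (lS n))) dotZl//; last exact: l2Z.
  rewrite dotZr// lee_fin mulrA.
  have h : 0 < 2 ^+ n :> R by rewrite exprn_gt0.
  rewrite -[leRHS](_ : (2 ^+ n)^-1 * (2 ^+ n)^-1 * (2 ^+ n * (2 * C)) = _); last first.
    by field; rewrite gt_eqF.
  by rewrite ler_wpM2l// mulr_ge0 ?invr_ge0 ?ltW.
move=> /(_ gb); apply: filterS => w [_ h].
have h2 := cvg_comp _ _ h (@sqrt_continuous R 0).
rewrite sqrtr0 in h2.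
apply/norm_cvg0P; rewrite (_ : (fun n => _) = Num.sqrt \o (fun n => fine (g n w))); first exact: h2.
by apply/funext => n; rewrite /g/= sqrtr_sqr.
Qed.

End GaussianField.

(** * The resolvent at well-chosen large wavenumbers *)

Section Resolvent.
Local Open Scope complex_scope.
Variable R : realType.
Notation X := (R3 R).
Variables (D : set X) (mD : measurable D) (Doo : (leb3 R D < +oo)%E).
Notation lebD := (lebD mD Doo).

(** Extension by zero, so that the class of a function in L^2(D) has a fixed
representative outside D. *)
Definition re_on (w : X -> R[i]) : X -> R := (fun x => complex.Re (w x)) \_ D.
Definition im_on (w : X -> R[i]) : X -> R := (fun x => complex.Im (w x)) \_ D.

Definition oscC (k : R) := osc (@invdist R) (@dist3 R) k 0.
Definition oscS (k : R) := osc (@invdist R) (@dist3 R) k (- (pi / 2)).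
Definition inv4pi : R := (4 * pi)^-1.

Lemma PhiE k x y : Phi k x y =
  (inv4pi * oscC k (x, y)) +i* (inv4pi * oscS k (x, y)).
Proof.
rewrite /Phi /expi -fmorphV/=.
rewrite /oscC /oscS /osc /invdist /dist3 /inv4pi/= addr0 cosBpihalf invfM.
by apply/eqP; rewrite eq_complex/=; apply/andP; split; apply/eqP; ring.
Qed.

Lemma L2C_l2 w : L2C D w -> l2 lebD (re_on w) /\ l2 lebD (im_on w).
Proof. by move=> [h1 h2]; split; exact: L2_l2. Qed.

Lemma oscC_hs k : hs_kernel lebD (invdistC mD Doo) (oscC k).
Proof. exact: (osc_hs (invdist_hs mD Doo) (@measurable_dist3 R)). Qed.

Lemma oscS_hs k : hs_kernel lebD (invdistC mD Doo) (oscS k).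
Proof. exact: (osc_hs (invdist_hs mD Doo) (@measurable_dist3 R)). Qed.

Lemma Rk_re k w x : L2C D w ->
  complex.Re (Rk D k w x) =
  inv4pi * (kernel_op lebD (oscC k) (re_on w) x - kernel_op lebD (oscS k) (im_on w) x).
Proof.
move=> /L2C_l2[l1 l2].
have [_ /(_ x)[lC _] _] := oscC_hs k; have [_ /(_ x)[lS _] _] := oscS_hs k.
have iC := l2_mul lC l1; have iS := l2_mul lS l2.
rewrite /Rk /cintegral/= (Rintegral_lebD_patch mD Doo).
rewrite /kernel_op -RintegralB// -RintegralZl//; last exact: (intgB iC iS).
apply: eq_Rintegral => y _; rewrite patchE /re_on /im_on !patchE; case: ifP => _.
  by rewrite PhiE; case: (w y) => a b/=; ring.
by rewrite !mulr0 subrr mulr0.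
Qed.

Lemma Rk_im k w x : L2C D w ->
  complex.Im (Rk D k w x) =
  inv4pi * (kernel_op lebD (oscC k) (im_on w) x + kernel_op lebD (oscS k) (re_on w) x).
Proof.
move=> /L2C_l2[l1 l2].
have [_ /(_ x)[lC _] _] := oscC_hs k; have [_ /(_ x)[lS _] _] := oscS_hs k.
have iC := l2_mul lC l2; have iS := l2_mul lS l1.
rewrite /Rk /cintegral/= (Rintegral_lebD_patch mD Doo).
rewrite /kernel_op -RintegralD// -RintegralZl//; last exact: (intgD iC iS).
apply: eq_Rintegral => y _; rewrite patchE /re_on /im_on !patchE; case: ifP => _.
  by rewrite PhiE; case: (w y) => a b/=; ring.
by rewrite !mulr0 addr0 mulr0.
Qed.

Definition normC2 (w : X -> R[i]) : R :=
  dot lebD (re_on w) (re_on w) + dot lebD (im_on w) (im_on w).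

Lemma normC2_ge0 w : 0 <= normC2 w.
Proof. by rewrite addr_ge0 ?dot_ge0. Qed.

Lemma ae_le_Rintegral (f g : X -> R) : intg lebD f -> intg lebD g ->
  (forall x, 0 <= f x) -> (forall x, 0 <= g x) -> {ae lebD, forall x, f x <= g x} ->
  \int[lebD]_x f x <= \int[lebD]_x g x.
Proof.
move=> fi gi f0 g0 fg; rewrite /Rintegral fine_le//.
- exact: (integrable_fin_num measurableT fi).
- exact: (integrable_fin_num measurableT gi).
apply: ae_ge0_le_integral => //.
- by move=> x _; rewrite lee_fin.
- by apply/measurable_EFinP; exact: (intg_meas fi).
- by move=> x _; rewrite lee_fin.
- by apply/measurable_EFinP; exact: (intg_meas gi).
by apply: filterS fg => x h _; rewrite lee_fin.
Qed.

(** Both parts of 4 pi R_k have squared operator norm at most e. The condition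
does not involve V, so wavenumbers can be chosen before the unknowns. *)
Definition small_at (e k : R) := forall f, l2 lebD f ->
  dot lebD (kernel_op lebD (oscC k) f) (kernel_op lebD (oscC k) f) <= e * dot lebD f f /\
  dot lebD (kernel_op lebD (oscS k) f) (kernel_op lebD (oscS k) f) <= e * dot lebD f f.

Lemma exists_small (e : R) N : 0 < e -> exists2 k : nat, (N <= k)%N & small_at e k%:R.
Proof.
move=> e0; have [k Nk H] := trig_kernel_small mD Doo N e0.
by exists k => // f lf; split; apply: H => //; [left|right].
Qed.

Lemma ae_leb3_lebD (Q : X -> Prop) : {ae leb3 R, forall x, Q x} -> {ae lebD, forall x, Q x}.
Proof.
move=> [A [mA A0 QA]]; exists A; split => //.
apply/eqP; rewrite eq_le measure_ge0 andbT (le_trans (lebD_le mD Doo mA))//.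
by rewrite A0.
Qed.

(** The equation gives |w|^2 <= 2 |g|^2 + 2 v^2 |R_k w|^2, and the condition on e
makes the last term at most |w|^2 / 2. *)
Lemma inv_bound (v e k : R) V w g : small_at e k -> 0 <= e ->
  16 * v ^+ 2 * inv4pi ^+ 2 * e <= 1 ->
  {ae leb3 R, forall x, `|V x| <= v} ->
  L2C D w -> L2C D g ->
  {ae leb3 R, forall x, D x -> w x - (V x)%:C * Rk D k w x = g x} ->
  normC2 w <= 4 * normC2 g.
Proof.
move=> sm e0 hve Vv Lw Lg eqw.
have arith1 (A S a b : R) : A <= e * a -> S <= e * b ->
    2 * A + 2 * (-1 * (-1 * S)) <= 2 * e * (a + b) by clear; lra.
have arith2 (A S a b : R) : A <= e * b -> S <= e * a ->
    2 * A + 2 * S <= 2 * e * (a + b) by clear; lra.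
have [w1 w2] := L2C_l2 Lw; have [g1 g2] := L2C_l2 Lg.
pose r1 x := inv4pi * (kernel_op lebD (oscC k) (re_on w) x + (-1) * kernel_op lebD (oscS k) (im_on w) x).
pose r2 x := inv4pi * (kernel_op lebD (oscC k) (im_on w) x + kernel_op lebD (oscS k) (re_on w) x).
have lC f : l2 lebD f -> l2 lebD (kernel_op lebD (oscC k) f) by exact: (kernel_op_l2 (oscC_hs k)).
have lS f : l2 lebD f -> l2 lebD (kernel_op lebD (oscS k) f) by exact: (kernel_op_l2 (oscS_hs k)).
have lr1 : l2 lebD r1 by apply/l2Z/l2D; [exact: lC|apply/l2Z; exact: lS].
have lr2 : l2 lebD r2 by apply/l2Z/l2D; [exact: lC|exact: lS].
have main (a b r : X -> R) : l2 lebD a -> l2 lebD b -> l2 lebD r ->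
    {ae lebD, forall x, exists2 t, `|t| <= v & a x = b x + t * r x} ->
    dot lebD a a <= 2 * dot lebD b b + 2 * v ^+ 2 * dot lebD r r.
  move=> la lb lr H.
  have ib := intgZ 2 lb.2; have ir := intgZ (2 * v ^+ 2) lr.2.
  have zE (c : R) (h : X -> R) : l2 lebD h -> c * dot lebD h h = \int[lebD]_x (c * h x ^+ 2).
    by move=> lh; rewrite -dotE RintegralZl//; exact: lh.2.
  rewrite (zE _ _ lb) (zE _ _ lr) -dotE.
  rewrite -RintegralD//; apply: ae_le_Rintegral.
  - exact: la.2.
  - exact: intgD.
  - by move=> x; rewrite sqr_ge0.
  - by move=> x; rewrite addr_ge0// mulr_ge0 ?sqr_ge0// mulr_ge0 ?sqr_ge0.
  apply: filterS H => x [t tv ->].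
  have t2 : t ^+ 2 <= v ^+ 2.
    by rewrite -real_normK ?num_real// ler_sqr ?nnegrE// (le_trans _ tv).
  have := sqr_ge0 (b x - t * r x); have := sqr_ge0 (r x).
  move: (b x) (r x) => p q q0 h.
  rewrite (_ : 2 * v ^+ 2 * q ^+ 2 = 2 * (v ^+ 2 * q ^+ 2)); last by ring.
  have : t ^+ 2 * q ^+ 2 <= v ^+ 2 * q ^+ 2 by rewrite ler_wpM2r.
  by move: h; rewrite !expr2; nra.
have H1 := main _ _ _ w1 g1 lr1.
have H2 := main _ _ _ w2 g2 lr2.
have aeD : {ae lebD, forall x, [/\ D x, `|V x| <= v &
    (D x -> w x - (V x)%:C * Rk D k w x = g x)]}.
  have a1 := lebD_ae mD Doo; have a2 := ae_leb3_lebD Vv; have a3 := ae_leb3_lebD eqw.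
  by apply: filterS3 a1 a2 a3 => x.
have {}H1 : dot lebD (re_on w) (re_on w) <= 2 * dot lebD (re_on g) (re_on g) + 2 * v ^+ 2 * dot lebD r1 r1.
  apply: H1; apply: filterS aeD => x [Dx Vx /(_ Dx) E]; exists (V x) => //.
  rewrite /re_on !patchE mem_set// -E /r1 mulN1r -(Rk_re k x Lw).
  by case: (w x) => p q; case: (Rk D k _ x) => a b/=; ring.
have {}H2 : dot lebD (im_on w) (im_on w) <= 2 * dot lebD (im_on g) (im_on g) + 2 * v ^+ 2 * dot lebD r2 r2.
  apply: H2; apply: filterS aeD => x [Dx Vx /(_ Dx) E]; exists (V x) => //.
  rewrite /im_on !patchE mem_set// -E /r2 -(Rk_im k x Lw).
  by case: (w x) => p q; case: (Rk D k _ x) => a b/=; ring.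
have [sC1 sS1] := sm _ w1; have [sC2 sS2] := sm _ w2.
have B1 : dot lebD r1 r1 <= 2 * inv4pi ^+ 2 * e * normC2 w.
  have l1 := lC _ w1; have l2' := lS _ w2; have l3 := l2Z (-1) l2'.
  have := dotD_le l1 l3.
  rewrite (dotZl (-1) l2' l3) (dotZr (-1) l2' l2') => h.
  rewrite /r1 (dotZl inv4pi (l2D l1 l3) lr1) (dotZr inv4pi (l2D l1 l3) (l2D l1 l3)).
  rewrite mulrA -expr2 -mulrA mulrACA [X in _ <= X]mulrCA ler_wpM2l ?sqr_ge0//.
  by rewrite (le_trans h)//; exact: arith1 sC1 sS2.
have B2 : dot lebD r2 r2 <= 2 * inv4pi ^+ 2 * e * normC2 w.
  have l1 := lC _ w2; have l3 := lS _ w1.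
  have h := dotD_le l1 l3.
  rewrite /r2 (dotZl inv4pi (l2D l1 l3) lr2) (dotZr inv4pi (l2D l1 l3) (l2D l1 l3)).
  rewrite mulrA -expr2 -mulrA mulrACA [X in _ <= X]mulrCA ler_wpM2l ?sqr_ge0//.
  by rewrite (le_trans h)//; exact: arith2 sC2 sS1.
have W0 := normC2_ge0 w.
have v2 : 0 <= 2 * v ^+ 2 by rewrite mulr_ge0 ?sqr_ge0.
have C1 := ler_wpM2l v2 B1; have C2 := ler_wpM2l v2 B2.
have C3 := ler_wpM2r W0 hve.
rewrite mul1r in C3.
have C4 : 2 * v ^+ 2 * (2 * inv4pi ^+ 2 * e * normC2 w) = 16 * v ^+ 2 * inv4pi ^+ 2 * e * normC2 w / 4.
  by field.
rewrite C4 in C1 C2.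
move: (16 * v ^+ 2 * inv4pi ^+ 2 * e * normC2 w) C1 C2 C3 => Z C1 C2 C3.
move: (2 * v ^+ 2 * dot lebD r1 r1) (2 * v ^+ 2 * dot lebD r2 r2) H1 H2 C1 C2 => z1 z2 H1 H2 C1 C2.
rewrite /normC2 in C3 *.
move: (dot lebD (re_on w) (re_on w)) (dot lebD (im_on w) (im_on w)) (dot lebD (re_on g) (re_on g))
  (dot lebD (im_on g) (im_on g)) H1 H2 C3 => a b a' b' H1 H2 C3.
clear -H1 H2 C1 C2 C3; lra.
Qed.

(** If the equation has no solution, the selected function is 0 and the bound is
trivial; existence of the inverse is therefore not an issue. *)
Lemma inv_I_VRk_bound (v e k : R) V g : small_at e k -> 0 <= e ->
  16 * v ^+ 2 * inv4pi ^+ 2 * e <= 1 ->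
  {ae leb3 R, forall x, `|V x| <= v} -> L2C D g ->
  L2C D (inv_I_VRk D V k g) /\ normC2 (inv_I_VRk D V k g) <= 4 * normC2 g.
Proof.
move=> sm e0 hve Vv Lg; rewrite /inv_I_VRk; set S := [set w | _].
have [[w Sw]|nS] := pselect (exists w, S w).
  have [Lw E] : S (xget (fun=> 0) S) := xgetI (fun=> 0) Sw.
  by split => //; exact: (inv_bound sm e0 hve Vv Lw Lg E).
rewrite xgetPN; last by move=> w Sw; apply: nS; exists w.
have z (h : R[i] -> R) : h 0 = 0 -> L2 D (fun x : X => h 0).
  move=> h0; apply: (@l2_L2 _ _ mD Doo).
  by rewrite h0; exact: l2_0.
have z0 (h : R[i] -> R) : h 0 = 0 -> (fun x : X => h 0) \_ D = (fun=> 0).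
  by move=> h0; apply/funext => x; rewrite patchE h0; case: ifP.
split; first by split; [exact: (z (@complex.Re R) erefl)|exact: (z (@complex.Im R) erefl)].
rewrite /normC2 /re_on /im_on (z0 (@complex.Re R))// ?(z0 (@complex.Im R))//.
have -> : dot lebD (fun=> 0) (fun=> 0) = 0.
  by rewrite /dot; under eq_Rintegral do rewrite mulr0; rewrite Rintegral_cst// mul0r.
by rewrite addr0 mulr_ge0// normC2_ge0.
Qed.

End Resolvent.

(** * Orthogonal plane waves on a box *)

Lemma sqr_le1 (R : realDomainType) (c : R) : `|c| <= 1 -> c * c <= 1.
Proof.
by move=> c1; rewrite -expr2 -real_normK ?num_real// expr_le1.
Qed.

Section PlaneMeasure.
Variable R : realType.
Notation lam := (@lebesgue_measure R).

(** The product measure under a name of its own, to which a sigma-finiteness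
instance can be attached. *)
Definition leb2 : set (measurableTypeR R * measurableTypeR R)%type -> \bar R :=
  (lam \x lam)%E.

HB.instance Definition _ := Measure.copy leb2 (lam \x lam)%E.

Let leb2_sigma_finite : sigma_finite setT leb2.
Proof.
have /sigma_finiteP[F [TF ndF Foo]] := sigma_finiteT lam.
exists (fun n => F n `*` F n).
  rewrite -setXTT TF predeqE => -[x y]; split.
    move=> [/= [n _ Fnx] [k _ Gky]]; exists (maxn n k) => //; split.
    - by move: x Fnx; exact/subsetPset/ndF/leq_maxl.
    - by move: y Gky; exact/subsetPset/ndF/leq_maxr.
  by move=> [n _ []/= ? ?]; split; exists n.
move=> k; have [h1 h2] := Foo k.
split; first exact: measurableX.
rewrite /leb2 [ltLHS](@product_measure1E _ _ _ _ R lam lam)//.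
by rewrite lte_mul_pinfty// ge0_fin_numE.
Qed.

HB.instance Definition _ := @Measure_isSigmaFinite.Build _ _ _ leb2 leb2_sigma_finite.

Definition leb21 : {measure set (R3 R) -> \bar R} := (leb2 \x lam)%E.

Lemma leb3_leb21 (f : R3 R -> \bar R) : (\int[leb3 R]_x f x = \int[leb21]_x f x)%E.
Proof. by apply: eq_measure_integral => A mA _. Qed.

End PlaneMeasure.

Section Strip.
Variable R : realType.
Notation X := (R3 R).
Notation lam := (@lebesgue_measure R).
Variable L : R.
Hypothesis L0 : 0 < L.

Definition wave (p : X) (t : R) (y : X) : R := cos (dot3 p y + t).

Lemma measurable_dot3 (p : X) : measurable_fun [set: X] (dot3 p).
Proof.
have [m1 m2 m3] := measurable_coord R.
by apply: measurable_funD; [apply: measurable_funD|]; exact: measurable_funM.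
Qed.

Lemma measurable_wave p t : measurable_fun [set: X] (wave p t).
Proof.
apply: (measurableT_comp (continuous_measurable_fun (@continuous_cos R))).
by apply: measurable_funD => //; exact: measurable_dot3.
Qed.

Lemma wave_le1 p t y : `|wave p t y| <= 1.
Proof. exact: cos_max. Qed.

(** The height 2 pi L is a common period of the waves whose third frequency is a
multiple of 1/L. The box contains the cube of radius L because pi >= 1. *)
Definition strip : set X :=
  (`[- L, L]%classic `*` `[- L, L]%classic) `*` `[- (pi * L), pi * L]%classic.

Lemma measurable_strip : measurable strip.
Proof. by apply: measurableX => //; exact: measurableX. Qed.

Lemma strip_fin : (leb3 R strip < +oo)%E.
Proof.
have s : strip `<=` cube 0 (Num.max L (pi * L)).
  move=> x [[/=]]; rewrite !in_itv/= => h1 h2 h3; split; rewrite subr0 le_max.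
  - by rewrite ler_norml h1.
  - by rewrite ler_norml h2.
  - by rewrite [X in _ || X]ler_norml h3 orbT.
apply: (@le_lt_trans _ _ (leb3 R (cube 0 (Num.max L (pi * L))))).
  by apply: le_measure; rewrite ?inE//; [exact: measurable_strip|exact: measurable_cube].
by rewrite leb3_cube ?ltry// le_max ltW.
Qed.

(** By Fubini, it is enough to integrate over whole periods in the third
variable. *)
Lemma wave_int0 (q : X) t m : (0 < m)%N -> q.2 * L = m%:R \/ q.2 * L = - m%:R ->
  \int[leb3 R]_(y in strip) wave q t y = 0.
Proof.
move=> m0 qm.
have mS := measurable_strip.
have mw := measurable_wave q t.
have q0 : q.2 != 0.
  apply/negP => /eqP q0; move: qm; rewrite q0 mul0r => -[] /eqP; rewrite eq_sym ?oppr_eq0.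
    by rewrite pnatr_eq0; case: m m0.
  by rewrite pnatr_eq0; case: m m0.
have i1 : (leb3 R).-integrable strip (EFin \o wave q t).
  apply: (@measurable_bounded_integrable _ _ _ (leb3 R)) => //.
  - exact: strip_fin.
  - exact: measurable_funTS.
  - by exists 1; split => // M M1 y _ /=; rewrite (le_trans (wave_le1 _ _ _))// ltW.
have i2 : intg (@leb2 R \x lam)%E (wave q t \_ strip).
  have i0 : intg (leb3 R) (wave q t \_ strip).
    by move/integrable_mkcond : i1 => /(_ mS); rewrite restrict_EFin.
  move/integrableP: i0 => [mi fi]; apply/integrableP; split; first exact: mi.
  by move: fi; rewrite leb3_leb21.
have sec (u : measurableTypeR R * measurableTypeR R) :
    intg lam (fun s => (wave q t \_ strip) (u, s)) /\
    \int[lam]_s (wave q t \_ strip) (u, s) = 0.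
  have [uS|uS] := boolP (u \in (`[- L, L]%classic `*` `[- L, L]%classic : set (measurableTypeR R * measurableTypeR R))); last first.
    have -> : (fun s => (wave q t \_ strip) (u, s)) = (fun=> 0).
      apply/funext => s; rewrite patchE memNset// => -[/= h _].
      by move: uS; rewrite notin_setE; apply.
    by split; [exact: intg0|rewrite Rintegral_cst// mul0r].
  pose b := q.1.1 * u.1 + q.1.2 * u.2 + t.
  pose I : set R := `[- (pi * L), pi * L]%classic.
  have -> : (fun s => (wave q t \_ strip) (u, s)) = (fun s => cos (q.2 * s + b)) \_ I.
    apply/funext => s; rewrite !patchE.
    have -> : ((u, s) \in strip) = (s \in I).
      apply/idP/idP; rewrite !inE; first by case.
      by move=> sI; split => //; move: uS; rewrite inE.
    by case: ifP => // _; rewrite /wave /dot3/= /b; congr cos; ring.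
  have cc : continuous (fun s : R => cos (q.2 * s + b)).
    move=> s; apply: (@continuous_comp _ _ _ (fun s : R => q.2 * s + b) (@cos R)); last exact: continuous_cos.
    apply: cvgD; last exact: cvg_cst.
    by apply: cvgM; [exact: cvg_cst|exact: cvg_id].
  have iI : lam.-integrable I (EFin \o (fun s => cos (q.2 * s + b))).
    apply: continuous_compact_integrable; first exact: segment_compact.
    exact: continuous_subspaceT.
  split.
    by move/integrable_mkcond : iI => /(_ (measurable_itv _)); rewrite restrict_EFin.
  rewrite -Rintegral_mkcond /Rintegral.
  have pL : 0 < pi * L by rewrite mulr_gt0// pi_gt0.
  have dF (s : R) : is_derive s 1 (fun s : R => q.2^-1 * sin (q.2 * s + b)) (cos (q.2 * s + b)).
    apply: is_derive_eq; rewrite /GRing.scale/= ?addr0 ?mulr1 ?mulr0 ?add0r ?addr0.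
    by field.
  rewrite (@continuous_FTC2 _ _ (fun s => q.2^-1 * sin (q.2 * s + b)))//.
  - rewrite -EFinB/= -mulrBr.
    have -> : q.2 * (pi * L) + b = (q.2 * - (pi * L) + b) + (q.2 * L) * (pi *+ 2).
      by rewrite -mulr_natl; ring.
    have P x : sin (x + m%:R * (pi *+ 2)) = sin x :> R.
      by rewrite mulr_natl (periodicn (@sinD2pi R)).
    case: qm => ->; first by rewrite P subrr mulr0.
    by rewrite -[sin (_ + _ * _)]P mulNr addrNK subrr mulr0.
  - lra.
  - exact: continuous_subspaceT.
  - have cF : continuous (fun s : R => q.2^-1 * sin (q.2 * s + b)).
      by move=> s; apply/differentiable_continuous/derivable1_diffP; have [] := dF s.
    split; first by move=> s _; have [] := dF s.
    + by apply: cvg_at_right_filter; exact: cF.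
    + by apply: cvg_at_left_filter; exact: cF.
  - by move=> s _; rewrite derive1E; have dFs := dF s; rewrite derive_val.
have H := Rintegral_fubini i2 (fun u => (sec u).1).
rewrite Rintegral_mkcond /Rintegral leb3_leb21 -[LHS]/(\int[(@leb2 R \x lam)%E]_z (wave q t \_ strip) z).
rewrite H (@eq_Rintegral _ _ _ _ _ (fun=> 0)) => [|u _]; last exact: (sec u).2.
by rewrite Rintegral_cst// mul0r.
Qed.

Variables (D : set X) (mD : measurable D) (Doo : (leb3 R D < +oo)%E).
Hypothesis DL : D `<=` cube 0 L.
Notation lebQ := (lebD measurable_strip strip_fin).
Notation lebD := (lebD mD Doo).

Lemma domain_strip : D `<=` strip.
Proof.
have Lp : L <= pi * L.
  apply: ler_peMl; first exact: ltW.
  by apply: (le_trans _ (@pi_ge2 R)); rewrite ler1n.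
move=> x /DL[]; rewrite !subr0 => h1 h2 h3.
split; first by split; rewrite /= in_itv/= -ler_norml.
by rewrite /= in_itv/= -ler_norml (le_trans h3).
Qed.

Lemma Rintegral_lebD_strip (f : X -> R) : measurable_fun [set: X] f ->
  \int[lebQ]_x (f \_ D) x = \int[lebD]_x f x.
Proof.
move=> mf.
have mfD : measurable_fun [set: X] (f \_ D).
  by apply/(measurable_restrictT f mD); exact: measurable_funTS.
rewrite -(Rintegral_lebD measurable_strip strip_fin mfD) -(Rintegral_lebD mD Doo mf).
rewrite [LHS]Rintegral_mkcond [RHS]Rintegral_mkcond; apply: eq_Rintegral => x _.
rewrite [LHS]patchE; case: ifPn => // xS.
rewrite patchE memNset// => Dx; move: xS; rewrite notin_setE; apply.
exact: domain_strip.
Qed.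

Definition besselC : R := fine (leb3 R strip) + 1.

Lemma besselC_gt0 : 0 < besselC.
Proof. by rewrite ltr_wpDl// fine_ge0. Qed.

Lemma l2_wave p t : l2 lebQ (wave p t).
Proof. exact: (l2_bounded _ (measurable_wave p t) (wave_le1 p t)). Qed.

Lemma wave_mul p q t y : wave p t y * wave q t y =
  2^-1 * (wave (p - q) 0 y) + 2^-1 * (wave (p + q) (t + t) y).
Proof.
rewrite /wave.
have -> : dot3 (p - q) y + 0 = (dot3 p y + t) - (dot3 q y + t).
  by rewrite /dot3/=; ring.
have -> : dot3 (p + q) y + (t + t) = (dot3 p y + t) + (dot3 q y + t).
  by rewrite /dot3/=; ring.
by rewrite cosB (cosD (dot3 p y + t)); field.
Qed.

(** A product of two waves is half the sum of the waves at the difference and at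
the sum of the frequencies, whose third coordinates are nonzero multiples of
1/L; so the waves are orthogonal on the box, of norm at most its volume.
The inequality is transferred to D by extending g by zero. *)
Lemma bessel_strip n (a : nat -> nat) (p : nat -> X) t g :
  (forall i, (i < n)%N -> (0 < a i)%N /\ (p i).2 * L = (a i)%:R) ->
  (forall i j, (i < n)%N -> (j < n)%N -> i != j -> a i != a j) ->
  l2 lebD g ->
  \sum_(i < n) dot lebD g (wave (p i) t) ^+ 2 <= besselC * dot lebD g g.
Proof.
move=> ap ainj lg; have mg := l2_meas lg.
have mgD : measurable_fun [set: X] (g \_ D).
  by apply/(measurable_restrictT g mD); exact: measurable_funTS.
have sq : (fun x => (g \_ D) x * (g \_ D) x) = (fun x => g x * g x) \_ D.
  by apply/funext => x; rewrite !patchE; case: ifP => //; rewrite mulr0.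
have lgD : l2 lebQ (g \_ D).
  apply: (l2P mgD).
  have mgD2 : measurable_fun [set: X] (fun x => ((g \_ D) x ^+ 2)%:E).
    by apply/measurable_EFinP; exact: measurable_funX.
  have mg2 : measurable_fun [set: X] (fun x => (g x ^+ 2)%:E).
    by apply/measurable_EFinP; exact: measurable_funX.
  rewrite -(integral_lebD measurable_strip strip_fin mgD2).
  have -> : (\int[leb3 R]_(x in strip) ((g \_ D) x ^+ 2)%:E =
      \int[leb3 R]_(x in D) (g x ^+ 2)%:E)%E.
    rewrite [LHS]integral_mkcond [RHS]integral_mkcond; apply: eq_integral => x _.
    rewrite !patchE; case: ifPn => xS.
      by case: ifPn => // xD; rewrite expr0n.
    rewrite memNset// => Dx; move: xS; rewrite notin_setE; apply.
    exact: domain_strip.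
  by rewrite (integral_lebD mD Doo mg2) dot_fineE// ltry.
have dE i : dot lebD g (wave (p i) t) = dot lebQ (g \_ D) (wave (p i) t).
  rewrite /dot -Rintegral_lebD_strip; last by apply: measurable_funM => //; exact: measurable_wave.
  by apply: eq_Rintegral => x _; rewrite !patchE; case: ifP => //; rewrite mul0r.
have gE : dot lebD g g = dot lebQ (g \_ D) (g \_ D).
  by rewrite /dot -Rintegral_lebD_strip ?sq//; exact: measurable_funM.
rewrite gE; under eq_bigr do rewrite dE.
apply: (@bessel _ _ _ lebQ n (fun i => wave (p i) t) besselC (g \_ D) besselC_gt0
  (fun i _ => l2_wave (p i) t) _ _ lgD).
- move=> i j iltn jltn ij.
  have [ai pi_] := ap i iltn; have [aj pj_] := ap j jltn.
  have iw q s : intg lebQ (wave q s).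
    apply: intg_le (intg_cst lebQ 1) _ => [|x]; [exact: measurable_wave|exact: wave_le1].
  have w0 q s m : (0 < m)%N -> q.2 * L = m%:R \/ q.2 * L = - m%:R ->
      \int[lebQ]_x wave q s x = 0.
    move=> m0 qm; rewrite -(Rintegral_lebD measurable_strip strip_fin (measurable_wave q s)).
    exact: (@wave_int0 q s m).
  rewrite /dot (@eq_Rintegral _ _ _ _ _ (fun y => 2^-1 * wave (p i - p j) 0 y +
     2^-1 * wave (p i + p j) (t + t) y)); last by move=> y _; exact: wave_mul.
  have j1 := iw (p i - p j) 0; have j2 := iw (p i + p j) (t + t).
  rewrite (RintegralD measurableT (intgZ 2^-1 j1) (intgZ 2^-1 j2)).
  rewrite (RintegralZl _ measurableT j1) (RintegralZl _ measurableT j2).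
  have aij := ainj i j iltn jltn ij.
  have zp : \int[lebQ]_x wave (p i + p j) (t + t) x = 0.
    apply: (w0 _ _ (a i + a j)%N); first by rewrite addn_gt0 ai.
    by left; rewrite natrD -pi_ -pj_ /=; ring.
  rewrite zp.
  have sub2L : (p i - p j).2 * L = (a i)%:R - (a j)%:R.
    by rewrite -pi_ -pj_; rewrite /=; ring.
  have z : \int[lebQ]_x wave (p i - p j) 0 x = 0.
    have [lij|lij|eij] := ltngtP (a i) (a j).
    - apply: (w0 _ _ (a j - a i)%N); first by rewrite subn_gt0.
      right; rewrite sub2L (natrB _ (ltnW lij)); exact: (esym (opprB _ _)).
    - apply: (w0 _ _ (a i - a j)%N); first by rewrite subn_gt0.
      left; rewrite sub2L (natrB _ (ltnW lij)); exact: erefl.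
    - by rewrite eij eqxx in aij.
  by rewrite z mulr0 addr0.
- move=> i iltn; apply: (@le_trans _ _ (\int[lebQ]_x (1 : R))).
    apply: (le_Rintegral measurableT (l2_mul (l2_wave _ _) (l2_wave _ _)) (intg_cst lebQ 1)).
    by move=> x _; exact: sqr_le1 (wave_le1 (p i) t x).
  rewrite Rintegral_cst; last exact: measurableT.
  apply: (@le_trans _ _ (fine (leb3 R (setT `&` strip)))).
    by rewrite mul1r.
  by rewrite setTI lerDl.
Qed.

End Strip.

(** * Approximating indicators of half-lines by polynomials *)

Section DynkinNull.
Context d (X : measurableType d) (R : realType) (mu : {measure set X -> \bar R}).
Context d' (T : measurableType d').

(** The sets A with vanishing integral form a Dynkin system; a disjoint union is
handled by dominated convergence, g times the indicators being bounded by
|g|. *)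
Lemma dynkin_null (pi : X -> T) (G : set (set T)) (g : X -> R) :
  measurable_fun [set: X] pi -> intg mu g ->
  @measurable _ T = <<s G >> -> setI_closed G ->
  \int[mu]_x g x = 0 ->
  (forall A, G A -> \int[mu]_x (g x * \1_A (pi x)) = 0) ->
  forall A, measurable A -> \int[mu]_x (g x * \1_A (pi x)) = 0.
Proof.
move=> mpi ig GE GI g0 GA A mA.
have ind_le (B : set T) x : `|\1_B (pi x) : R| <= 1.
  by rewrite indicE; case: (_ \in _); rewrite ?normr0 ?normr1.
have mind (B : set T) : measurable B -> measurable_fun [set: X] (fun x => \1_B (pi x) : R).
  by move=> mB; exact: (measurableT_comp (measurable_indic mB) mpi).
have ign : intg mu (fun x => `|g x|) := integrable_norm ig.
have igB (B : set T) : measurable B -> intg mu (fun x => g x * \1_B (pi x)).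
  move=> mB; apply: intg_le ign _ => [|x].
    by apply: measurable_funM; [exact: (intg_meas ig)|exact: mind].
  by rewrite normrM ler_piMr.
have mA' : <<s G >> A by rewrite -GE.
move: A mA' {mA}; apply: (@dynkin_induction _ T G
  (fun A => \int[mu]_x (g x * \1_A (pi x)) = 0)) => //.
- rewrite -[RHS]g0; apply: eq_Rintegral => x _.
  by rewrite indicT mulr1.
- move=> S mS S0.
  rewrite (_ : (fun x => _) = (fun x => g x - g x * \1_S (pi x))); last first.
    apply/funext => x; rewrite !indicE in_setC; case: (_ \in _) => /=; ring.
  by rewrite (RintegralB measurableT ig (igB _ mS)) g0 S0 subrr.
move=> F mF tF F0.
have mU : measurable (\bigcup_k F k) by exact: bigcupT_measurable.
pose s n x : R := \sum_(k < n) g x * \1_(F k) (pi x).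
have sE n x : s n x = g x * \sum_(k < n) \1_(F k) (pi x) by rewrite /s mulr_sumr.
have sum01 n x : \sum_(k < n) (\1_(F k) (pi x) : R) <= 1 /\
   (forall m, F m (pi x) -> (m < n)%N -> \sum_(k < n) (\1_(F k) (pi x) : R) = 1).
  have [[m Fm]|nF] := pselect (exists m, F m (pi x)); last first.
    split; last by move=> m Fm; exfalso; apply: nF; exists m.
    rewrite big1// => k _; rewrite indicE memNset// => Fk; apply: nF.
    by exists (nat_of_ord k).
  have z k : k != m -> (\1_(F k) (pi x) : R) = 0.
    move=> km; rewrite indicE memNset// => Fk.
    have := tF k m I I; rewrite /= => h.
    by have := h (ex_intro _ (pi x) (conj Fk Fm)) => kmE; rewrite kmE eqxx in km.
  have one : (\1_(F m) (pi x) : R) = 1 by rewrite indicE mem_set.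
  have key : (m < n)%N -> \sum_(k < n) (\1_(F k) (pi x) : R) = 1.
    move=> mn; rewrite (bigD1 (Ordinal mn))//= one big1 ?addr0// => k km.
    by apply: z; apply: contra km => /eqP e; apply/eqP/val_inj.
  have uniq m' : F m' (pi x) -> m' = m.
    move=> Fm'; apply/eqP; apply: contraT => h; have := z _ h.
    by rewrite indicE mem_set// => /eqP; rewrite oner_eq0.
  split; last by move=> m' /uniq ->; exact: key.
  have [mn|mn] := ltnP m n; first by rewrite key.
  rewrite big1// => k _; apply: z; apply: contraTneq (ltn_ord k) => ->.
  by rewrite -leqNgt.
have sum0 n x : 0 <= \sum_(k < n) (\1_(F k) (pi x) : R) by apply: sumr_ge0.
have igF (k : nat) := igB _ (mF k).
have is_ n : intg mu (s n) by exact: (@intg_sum _ _ _ mu n (fun k x => g x * \1_(F k) (pi x))).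
have H : (fun n => \int[mu]_x s n x) @ \oo --> \int[mu]_x (g x * \1_(\bigcup_k F k) (pi x)).
  apply: (Rintegral_dominated_cvg _ _ _ ign).
  - by move=> n; exact: (intg_meas (is_ n)).
  - exact: (intg_meas (igB _ mU)).
  - apply: aeW => x; apply: cvg_near_cst.
    have [[m Fm]|nF] := pselect (exists m, F m (pi x)).
      exists m.+1 => // n /= mn; rewrite sE ((sum01 n x).2 m Fm mn).
      by rewrite indicE mem_set//; exists m.
    apply: nearW => n; rewrite sE big1 ?mulr0.
      rewrite indicE memNset ?mulr0// => -[m _ Fm]; apply: nF; by exists m.
    move=> k _; rewrite indicE memNset// => Fk; apply: nF.
    by exists (nat_of_ord k).
  - move=> n x; rewrite sE normrM [X in _ * X](ger0_norm (sum0 n x)).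
    by rewrite -[leRHS]mulr1 ler_wpM2l// (sum01 n x).1.
have s0 : (fun n => \int[mu]_x s n x) = (fun=> 0).
  apply/funext => n; rewrite /s (@Rintegral_sum _ _ _ mu n (fun k x => g x * \1_(F k) (pi x)))//.
  by apply: big1 => k _; exact: F0.
rewrite s0 in H; apply/esym; exact: (cvg_unique _ (cvg_cst 0) H).
Qed.

End DynkinNull.

Section BrosowskiDeutsch.
Variable R : realType.

Lemma bernoulli_ineq (u : R) n : -1 <= u -> 1 + n%:R * u <= (1 + u) ^+ n.
Proof.
move=> u1; elim: n => [|n IH]; first by rewrite mul0r addr0 expr0.
rewrite exprS; have h : 0 <= 1 + u by lra.
apply: le_trans (ler_wpM2l h IH); rewrite -natr1.
have : 0 <= n%:R * u ^+ 2 by rewrite mulr_ge0 ?sqr_ge0.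
by rewrite expr2; nra.
Qed.

(** The polynomials of Brosowski and Deutsch: on [0, 1] they tend to 1 where
v < 1/2 and to 0 where v > 1/2. *)
Definition step_poly (n : nat) (v : R) : R := (1 - v ^+ n) ^+ (2 ^ n).

Lemma step_poly01 n v : 0 <= v <= 1 -> 0 <= step_poly n v <= 1.
Proof.
move=> /andP[v0 v1]; have h1 : 0 <= v ^+ n by rewrite exprn_ge0.
have h2 : v ^+ n <= 1 by rewrite exprn_ile1.
by rewrite /step_poly exprn_ge0 ?subr_ge0// exprn_ile1 ?subr_ge0// lerBlDr lerDl.
Qed.

Lemma step_poly_cvg1 v : 0 <= v -> v < 2^-1 -> (fun n => step_poly n v) @ \oo --> (1 : R).
Proof.
move=> v0 v2.
have h : (fun n => 1 - (2 * v) ^+ n) @ \oo --> (1 : R).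
  rewrite -[X in _ --> X]subr0; apply: cvgB; first exact: cvg_cst.
  by apply: cvg_expr; rewrite ger0_norm ?mulr_ge0//; lra.
apply: (@squeeze_cvgr _ _ _ _ _ (fun=> 1) _ _ _ h (cvg_cst (1 : R))); near=> n.
have v01 : 0 <= v <= 1 by rewrite v0/=; lra.
have /andP[_ ->] := step_poly01 n v01; rewrite andbT.
have := @bernoulli_ineq (- v ^+ n) (2 ^ n); rewrite natrX exprMn mulrN; apply.
by rewrite lerN2 exprn_ile1//; lra.
Unshelve. all: by end_near.
Qed.

Lemma step_poly_cvg0 v : v <= 1 -> 2^-1 < v -> (fun n => step_poly n v) @ \oo --> (0 : R).
Proof.
move=> v1 v2; have v0 : 0 < v by lra.
have h : (fun n => ((2 * v)^-1) ^+ n) @ \oo --> (0 : R).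
  apply: cvg_expr; rewrite ger0_norm ?invr_ge0 ?mulr_ge0 ?ltW// invf_lt1; lra.
apply: (squeeze_cvgr _ (cvg_cst 0) h); near=> n.
have v01 : 0 <= v <= 1 by rewrite v1 ltW.
have /andP[-> _] := step_poly01 n v01; rewrite /= /step_poly.
have u0 : 0 < v ^+ n by rewrite exprn_gt0.
have u1 : v ^+ n <= 1 by rewrite exprn_ile1// ltW.
have B : 2 ^+ n * v ^+ n <= (1 + v ^+ n) ^+ (2 ^ n).
  have := @bernoulli_ineq (v ^+ n) (2 ^ n); rewrite natrX => H.
  by rewrite (le_trans _ (H _)) ?lerDr//; lra.
rewrite exprVn exprMn -[leRHS]mul1r ler_pdivlMr ?mulr_gt0 ?exprn_gt0//.
apply: (@le_trans _ _ ((1 - v ^+ n) ^+ (2 ^ n) * (1 + v ^+ n) ^+ (2 ^ n))).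
  by rewrite ler_wpM2l// exprn_ge0// subr_ge0.
rewrite -exprMn exprn_ile1//; move: (v ^+ n) u0 u1 {B} => u u0 u1.
  by rewrite mulr_ge0; lra.
by nra.
Unshelve. all: by end_near.
Qed.

End BrosowskiDeutsch.

(** * Functions whose multiplication preserves orthogonality to a family *)

Section Multipliers.
Context d (X : measurableType d) (R : realType) (mu : {finite_measure set X -> \bar R}).
Variables (I : Type) (W : I -> X -> R) (h : X -> R).
Hypothesis mW : forall i, measurable_fun [set: X] (W i).
Hypothesis W1 : forall i x, `|W i x| <= 1.
Hypothesis ih : intg mu h.

Definition bounded_measurable (f : X -> R) :=
  measurable_fun [set: X] f /\ exists C, forall x, `|f x| <= C.

Lemma bounded_measurable_cst c : bounded_measurable (fun=> c).
Proof. by split; [exact: measurable_cst|exists `|c|]. Qed.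

Lemma bounded_measurableD f g : bounded_measurable f -> bounded_measurable g -> bounded_measurable (fun x => f x + g x).
Proof.
move=> [mf [C fC]] [mg [K gK]]; split; first exact: measurable_funD.
by exists (C + K) => x; rewrite (le_trans (ler_normD _ _))// lerD.
Qed.

Lemma bounded_measurableM f g : bounded_measurable f -> bounded_measurable g -> bounded_measurable (fun x => f x * g x).
Proof.
move=> [mf [C fC]] [mg [K gK]]; split; first exact: measurable_funM.
by exists (C * K) => x; rewrite normrM ler_pM.
Qed.

Lemma bounded_measurable_family i : bounded_measurable (W i).
Proof. by split => //; exists 1. Qed.

Lemma intg_bounded_measurable f : bounded_measurable f -> intg mu (fun x => h x * f x).
Proof.
move=> [mf [C fC]]; apply: (@intg_le _ _ _ _ _ (fun x => C * `|h x|)).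
- by apply: measurable_funM => //; exact: (intg_meas ih).
- by apply: intgZ; exact: (integrable_norm ih).
- by move=> x; rewrite normrM mulrC ler_wpM2r.
Qed.

Definition annihilated (psi : X -> R) :=
  bounded_measurable psi /\ forall i, \int[mu]_x (h x * (psi x * W i x)) = 0.

(** Multipliers are defined by their action on all annihilated functions, and not
on the constant 1 alone, because that makes their closure under products
immediate. *)
Definition multiplier (phi : X -> R) := bounded_measurable phi /\
  forall psi, annihilated psi -> annihilated (fun x => psi x * phi x).

Lemma multiplierP phi : bounded_measurable phi -> (forall psi, annihilated psi ->
  forall i, \int[mu]_x (h x * (psi x * phi x * W i x)) = 0) -> multiplier phi.
Proof.
move=> bp H; split => // psi ap; split; last exact: H.
by apply: bounded_measurableM => //; case: ap.
Qed.

Lemma multiplier_cst c : multiplier (fun=> c).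
Proof.
apply: multiplierP; first exact: bounded_measurable_cst.
move=> psi [bp H] i.
rewrite (_ : (fun x => _) = (fun x => c * (h x * (psi x * W i x)))); last first.
  by apply/funext => x; ring.
by rewrite (RintegralZl _ measurableT (intg_bounded_measurable (bounded_measurableM bp (bounded_measurable_family i)))) H mulr0.
Qed.

Lemma multiplierD f g : multiplier f -> multiplier g -> multiplier (fun x => f x + g x).
Proof.
move=> [bf Hf] [bg Hg]; apply: multiplierP; first exact: bounded_measurableD.
move=> psi ap i; have [b1 H1] := Hf _ ap; have [b2 H2] := Hg _ ap.
rewrite (_ : (fun x => _) = (fun x => h x * (psi x * f x * W i x) +
   h x * (psi x * g x * W i x))); last by apply/funext => x; ring.
rewrite (RintegralD measurableT (intg_bounded_measurable (bounded_measurableM b1 (bounded_measurable_family i)))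
  (intg_bounded_measurable (bounded_measurableM b2 (bounded_measurable_family i)))).
by rewrite H1 H2 addr0.
Qed.

Lemma multiplierM f g : multiplier f -> multiplier g -> multiplier (fun x => f x * g x).
Proof.
move=> [bf Hf] [bg Hg]; apply: multiplierP; first exact: bounded_measurableM.
move=> psi ap i; have [_ H] := Hg _ (Hf _ ap); rewrite -[RHS](H i).
by apply: eq_Rintegral => x _; ring.
Qed.

Lemma multiplierX f n : multiplier f -> multiplier (fun x => f x ^+ n).
Proof.
move=> mf; elim: n => [|n IH].
  by under eq_fun do rewrite expr0; exact: multiplier_cst.
by under eq_fun do rewrite exprS; exact: multiplierM.
Qed.

Lemma multiplier_wave phi : bounded_measurable phi ->
  (forall i, exists j k, forall x, phi x * W i x = 2^-1 * W j x + 2^-1 * W k x) ->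
  multiplier phi.
Proof.
move=> bp H; apply: multiplierP => // psi [bs Hs] i; have [j [k E]] := H i.
have ii j' := intg_bounded_measurable (bounded_measurableM bs (bounded_measurable_family j')).
rewrite (_ : (fun x => _) = (fun x => 2^-1 * (h x * (psi x * W j x)) +
   2^-1 * (h x * (psi x * W k x)))); last first.
  by apply/funext => x; rewrite -mulrA E; ring.
rewrite (RintegralD measurableT (intgZ _ (ii j)) (intgZ _ (ii k))).
rewrite (RintegralZl _ measurableT (ii j)) (RintegralZl _ measurableT (ii k)).
by rewrite !Hs mulr0 addr0.
Qed.

Lemma multiplier_lim (F : nat -> X -> R) f :
  (forall n, multiplier (F n)) -> (forall n x, `|F n x| <= 1) -> bounded_measurable f ->
  {ae mu, forall x, F ^~ x @ \oo --> f x} -> multiplier f.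
Proof.
move=> mF F1 bf Ff; apply: multiplierP => // psi ap i; have [[ms [C sC]] _] := ap.
have bfi : bounded_measurable (fun x => psi x * f x * W i x).
  by apply: bounded_measurableM (bounded_measurable_family i); apply: bounded_measurableM bf; case: ap.
have H : (fun n => \int[mu]_x (h x * (psi x * F n x * W i x))) @ \oo -->
    \int[mu]_x (h x * (psi x * f x * W i x)).
  apply: (@Rintegral_dominated_cvg _ _ _ mu _ _ (fun x => C * `|h x|)).
  - move=> n; have [_ H] := mF n; have [b _] := H _ ap.
    exact: (intg_meas (intg_bounded_measurable (bounded_measurableM b (bounded_measurable_family i)))).
  - exact: (intg_meas (intg_bounded_measurable bfi)).
  - apply: filterS Ff => x Fx.
    apply: cvgM; first exact: cvg_cst.
    by apply: cvgM; [apply: cvgM; [exact: cvg_cst|exact: Fx]|exact: cvg_cst].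
  - by apply: intgZ; exact: (integrable_norm ih).
  - move=> n x; rewrite normrM mulrC ler_wpM2r// !normrM -[leRHS]mulr1.
    by rewrite ler_pM// -[leRHS]mulr1 ler_pM.
have s0 : (fun n => \int[mu]_x (h x * (psi x * F n x * W i x))) = (fun=> 0).
  by apply/funext => n; have [_ H'] := mF n; have [_] := H' _ ap; apply.
by rewrite s0 in H; apply/esym; exact: (cvg_unique _ (cvg_cst 0) H).
Qed.

Lemma bounded_measurable_indic d' (T : measurableType d') (pi : X -> T) A :
  measurable_fun [set: X] pi -> measurable A -> bounded_measurable (fun x => \1_A (pi x)).
Proof.
move=> mpi mA; split; first exact: (measurableT_comp (measurable_indic mA) mpi).
by exists 1 => x; rewrite indicE; case: (_ \in _); rewrite ?normr0 ?normr1.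
Qed.

(** This passes from a pi-system to the sigma-algebra that it generates; it is
applied to half-lines and then to rectangles. *)
Lemma multiplier_sigma d' (T : measurableType d') (pi : X -> T) (G : set (set T)) :
  measurable_fun [set: X] pi -> @measurable _ T = <<s G >> -> setI_closed G ->
  (forall A, G A -> multiplier (fun x => \1_A (pi x))) ->
  forall A, measurable A -> multiplier (fun x => \1_A (pi x)).
Proof.
move=> mpi GE GI GA A mA; apply: multiplierP; first exact: bounded_measurable_indic.
move=> psi ap i; have [bp Hp] := ap.
have sw B x : h x * (psi x * \1_B (pi x) * W i x) = h x * (psi x * W i x) * \1_B (pi x).
  by ring.
under eq_Rintegral do rewrite sw.
apply: (dynkin_null mpi (intg_bounded_measurable (bounded_measurableM bp (bounded_measurable_family i))) GE GI (Hp i) _ mA).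
move=> B GB; have [_ H] := GA _ GB; have [_ {}H] := H _ ap.
by under eq_Rintegral do rewrite -sw; exact: H.
Qed.

End Multipliers.

(** * Uniqueness from the shifted lattice of frequencies *)

Section Uniqueness.
Variable R : realType.
Notation X := (R3 R).
Notation lam := (@lebesgue_measure R).
Variable L : R.
Hypothesis L0 : 0 < L.
Variables (D : set X) (mD : measurable D) (Doo : (leb3 R D < +oo)%E).
Hypothesis DL : D `<=` cube 0 L.
Notation lebD := (lebD mD Doo).

(** The half-integer shift keeps the second coordinate away from 0; see
[plane_sphere]. *)
Definition freq (m : int * int * int) : X :=
  (m.1.1%:~R / L, (m.1.2%:~R + 2^-1) / L, m.2%:~R / L).

Lemma coord_null (c : R) : [/\ lebD [set y : X | y.1.1 = c] = 0,
  lebD [set y : X | y.1.2 = c] = 0 & lebD [set y : X | y.2 = c] = 0].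
Proof.
have H (A B C : set (measurableTypeR R)) : measurable A -> measurable B -> measurable C ->
    (lam A * lam B * lam C = 0)%E -> lebD ((A `*` B) `*` C) = 0.
  move=> mA mB mC z; have mABC : measurable ((A `*` B) `*` C).
    by apply: measurableX => //; exact: measurableX.
  apply/eqP; rewrite eq_le measure_ge0 andbT (le_trans (lebD_le mD Doo mABC))//.
  rewrite /leb3 [leLHS](@product_measure1E _ _ _ _ R (lam \x lam)%E lam)//; last exact: measurableX.
  by rewrite [X in (X * _)%E](@product_measure1E _ _ _ _ R lam lam)// z.
have l0 : lam [set c] = 0 by exact: lebesgue_measure_set1.
split.
- rewrite (_ : [set y : X | _] = ([set c] `*` setT) `*` setT).
    by apply: H => //; rewrite l0 !mul0e.
  by apply/seteqP; split => [[[a b] e]/= ->//|[[a b] e]/= [[->]]].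
- rewrite (_ : [set y : X | _] = (setT `*` [set c]) `*` setT).
    by apply: H => //; rewrite l0 mule0 mul0e.
  by apply/seteqP; split => [[[a b] e]/= ->//|[[a b] e]/= [[_ ->]]].
- rewrite (_ : [set y : X | _] = (setT `*` setT) `*` [set c]).
    by apply: H => //; rewrite l0 mule0.
  by apply/seteqP; split => [[[a b] e]/= ->//|[[a b] e]/= [_ ->]].
Qed.

Variable h : X -> R.
Hypothesis ih : intg lebD h.

Definition wave_family (i : (int * int * int) * R) : X -> R := wave (freq i.1) i.2.
Notation mult := (multiplier lebD wave_family h).

Let mwave_family i : measurable_fun [set: X] (wave_family i). Proof. exact: measurable_wave. Qed.
Let wave_family1 i x : `|wave_family i x| <= 1. Proof. exact: wave_le1. Qed.

(** The lattice is stable under translation by the frequency e, so that a product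
of waves is a combination of waves of the family. *)
Lemma multiplier_step (e : X) alpha :
  (forall m, exists j k, freq m - e = freq j /\ freq m + e = freq k) ->
  mult (wave e alpha).
Proof.
move=> st; apply: (multiplier_wave mwave_family wave_family1 ih).
  by split; [exact: measurable_wave|exists 1 => x; exact: wave_le1].
move=> [m t]; have [j [k [Ej Ek]]] := st m; exists (j, t - alpha), (k, t + alpha) => x.
rewrite /wave_family/= -Ej -Ek /wave.
have -> : dot3 (freq m - e) x + (t - alpha) = (dot3 (freq m) x + t) - (dot3 e x + alpha).
  by rewrite /dot3/=; ring.
have -> : dot3 (freq m + e) x + (t + alpha) = (dot3 (freq m) x + t) + (dot3 e x + alpha).
  by rewrite /dot3/=; ring.
by move: (dot3 _ x + t) (dot3 e x + alpha) => a b; rewrite cosB cosD; field.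
Qed.

(** The function (1 + sin((c - a)/L))/2 is a multiplier with values in [0, 1]. On D
and for |a| < L its argument stays in ]-2, 2[, within ]-pi, pi[, so that it is
below 1/2 exactly where c < a, and the step polynomials evaluated at it tend
to the indicator of the half-line. *)
Lemma multiplier_halfline (e : X) (c : X -> measurableTypeR R) : measurable_fun [set: X] c ->
  (forall y, dot3 e y = (c y : R) / L) -> (forall y, D y -> `|c y : R| <= L) ->
  (forall a : R, lebD [set y | c y = a] = 0) ->
  (forall m, exists j k, freq m - e = freq j /\ freq m + e = freq k) ->
  forall a, mult (fun y => \1_(`]-oo, a[%classic : set (measurableTypeR R)) (c y)).
Proof.
move=> mc ec cL nc st a.
have bi : bounded_measurable (fun y => \1_(`]-oo, a[%classic : set (measurableTypeR R)) (c y) : R).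
  by apply: (bounded_measurable_indic R mc); exact: measurable_itv.
have aeD := lebD_ae mD Doo.
have aen : {ae lebD, forall y, c y != a}.
  exists [set y | c y = a]; split; last 2 first.
  - exact: nc.
  - by move=> y/= /negP; rewrite negbK => /eqP.
  rewrite -[X in measurable X]setTI; exact: (mc measurableT [set a]).
have [La|aL] := leP L a.
  apply: (multiplier_lim mwave_family wave_family1 ih (fun n => multiplier_cst mwave_family wave_family1 ih 1)) => //.
    by move=> _ _; rewrite normr1.
  apply: filterS2 aeD aen => y /cL; rewrite ler_norml => /andP[_ yL] ya.
  rewrite indicE mem_set; first exact: cvg_cst.
  by rewrite /= in_itv/= lt_neqAle ya (le_trans yL).
have [La|La] := leP a (- L).
  apply: (multiplier_lim mwave_family wave_family1 ih (fun n => multiplier_cst mwave_family wave_family1 ih 0)) => //.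
    by move=> _ _; rewrite normr0.
  apply: filterS aeD => y /cL; rewrite ler_norml => /andP[yL _].
  rewrite indicE memNset; first exact: cvg_cst.
  by rewrite /= in_itv/= => h'; have := lt_le_trans h' La; rewrite ltNge yL.
(* The phase turns the cosine into sin((c y - a)/L). *)
pose v y := 2^-1 + 2^-1 * wave e (- (a / L) - pi / 2) y.
have vE y : v y = 2^-1 * (1 + sin ((c y - a) / L)).
  rewrite /v /wave ec.
  have -> : c y / L + (- (a / L) - pi / 2) = (c y - a) / L - pi / 2 by rewrite mulrBl; ring.
  by rewrite cosBpihalf; ring.
have v01 y : 0 <= v y <= 1.
  rewrite vE; have := sin_geN1 ((c y - a) / L); have := sin_le1 ((c y - a) / L).
  by move: (sin _) => s s1 s2; apply/andP; split; lra.
have mv : mult v.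
  apply: (multiplierD mwave_family wave_family1 ih); first exact: (multiplier_cst mwave_family wave_family1 ih).
  apply: (multiplierM (multiplier_cst mwave_family wave_family1 ih _)).
  exact: multiplier_step.
have mbd n : mult (fun y => step_poly n (v y)).
  rewrite /step_poly; apply: (multiplierX mwave_family wave_family1 ih).
  rewrite (_ : (fun y => _) = (fun y => 1 + (-1) * v y ^+ n)); last by apply/funext => y; ring.
  apply: (multiplierD mwave_family wave_family1 ih); first exact: (multiplier_cst mwave_family wave_family1 ih).
  apply: (multiplierM (multiplier_cst mwave_family wave_family1 ih _)).
  exact: (multiplierX mwave_family wave_family1 ih).
apply: (multiplier_lim mwave_family wave_family1 ih mbd _ bi).
  by move=> n y; have /andP[p q] := step_poly01 n (v01 y); rewrite ger0_norm.
apply: filterS2 aeD aen => y /cL; rewrite ler_norml => /andP[y1 y2] ya.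
have pi2 := @pi_ge2 R.
have ar (u : R) : - L <= u -> u <= L -> a - u < 2 * L /\ u - a < 2 * L.
  by move: (La) (aL) => {}La {}aL h1 h2; split; [rewrite ltrBlDr|rewrite ltrBlDr]; lra.
have [lt2 gt2] := ar _ y1 y2.
have h2L : 2 * L <= pi * L by rewrite ler_wpM2r// ltW.
have [lt|gt|e'] := ltgtP (c y) a; last by rewrite e' eqxx in ya.
- rewrite indicE mem_set; last by rewrite /= in_itv.
  apply: step_poly_cvg1; first by have /andP[] := v01 y.
  have s0 : 0 < sin ((a - c y) / L).
    apply: sin_gt0_pi; apply/andP; split; first by rewrite divr_gt0// subr_gt0.
    rewrite ltr_pdivrMr; [exact: (lt_le_trans lt2 h2L)|exact: L0].
  rewrite vE (_ : (c y - a) / L = - ((a - c y) / L)) ?sinN; last by rewrite -mulNr opprB.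
  by move: (sin _) s0 => s s0; lra.
- rewrite indicE memNset; last first.
    by rewrite /= in_itv/= => h'; move: gt; rewrite ltNge (ltW h').
  apply: step_poly_cvg0; first by have /andP[] := v01 y.
  have s0 : 0 < sin ((c y - a) / L).
    apply: sin_gt0_pi; apply/andP; split; first by rewrite divr_gt0// subr_gt0.
    rewrite ltr_pdivrMr; [exact: (lt_le_trans gt2 h2L)|exact: L0].
  rewrite vE; move: (sin _) s0 => s s0; lra.
Qed.

Lemma int_step (z : int) : exists j k : int,
  (z%:~R - 1 = j%:~R :> R) /\ (z%:~R + 1 = k%:~R :> R).
Proof. by exists (z - 1), (z + 1); rewrite rmorphB rmorphD. Qed.

Lemma multiplier_coord : [/\
  forall A, measurable A -> mult (fun y => \1_(A : set (measurableTypeR R)) y.1.1),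
  forall A, measurable A -> mult (fun y => \1_(A : set (measurableTypeR R)) y.1.2) &
  forall A, measurable A -> mult (fun y => \1_(A : set (measurableTypeR R)) y.2)].
Proof.
have [m1 m2 m3] := measurable_coord R.
have GI : setI_closed (@RGenInftyO.G R).
  move=> A B [a ->] [b ->]; exists (Num.min a b); apply/seteqP; split => x /=;
    rewrite !in_itv/= lt_min; first by move=> [-> ->].
  by move=> /andP[].
have H (e : X) (c : X -> measurableTypeR R) : measurable_fun [set: X] c ->
  (forall y, dot3 e y = (c y : R) / L) -> (forall y, D y -> `|c y : R| <= L) ->
  (forall a : R, lebD [set y | c y = a] = 0) ->
  (forall m, exists j k, freq m - e = freq j /\ freq m + e = freq k) ->
  forall A, measurable A -> mult (fun y => \1_(A : set (measurableTypeR R)) (c y)).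
  move=> mc ec cL nc st.
  apply: (multiplier_sigma mwave_family wave_family1 ih mc (@RGenInftyO.measurableE R) GI).
  by move=> A [a ->]; exact: (multiplier_halfline mc ec cL nc st).
have cD y : D y -> [/\ `|y.1.1 : R| <= L, `|y.1.2 : R| <= L & `|y.2 : R| <= L].
  by move=> /DL[]; rewrite !subr0.
have LV : L != 0 by rewrite gt_eqF.
split.
- apply: (H (L^-1, 0, 0) (fun y : X => y.1.1)) => //.
  + by move=> y; rewrite /dot3/= !mul0r !addr0 mulrC.
  + by move=> y /cD[].
  + by move=> a; have [] := coord_null a.
  + move=> [[a b] c]; have [j [k [Ej Ek]]] := int_step a; exists (j, b, c), (k, b, c).
    rewrite /freq/= -Ej -Ek; split; by congr (_, _, _); rewrite /=; field.
- apply: (H (0, L^-1, 0) (fun y : X => y.1.2)) => //.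
  + by move=> y; rewrite /dot3/= !mul0r add0r addr0 mulrC.
  + by move=> y /cD[].
  + by move=> a; have [] := coord_null a.
  + move=> [[a b] c]; have [j [k [Ej Ek]]] := int_step b; exists (a, j, c), (a, k, c).
    rewrite /freq/= -Ej -Ek; split; by congr (_, _, _); rewrite /=; field.
- apply: (H (0, 0, L^-1) (fun y : X => y.2)) => //.
  + by move=> y; rewrite /dot3/= !mul0r !add0r mulrC.
  + by move=> y /cD[].
  + by move=> a; have [] := coord_null a.
  + move=> [[a b] c]; have [j [k [Ej Ek]]] := int_step c; exists (a, b, j), (a, b, k).
    rewrite /freq/= -Ej -Ek; split; by congr (_, _, _); rewrite /=; field.
Qed.

Lemma multiplier_measurable (A : set X) : measurable A -> mult (fun y => \1_A y).
Proof.
have [H1 H2 H3] := multiplier_coord.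
have indX d1 d2 (T1 : measurableType d1) (T2 : measurableType d2) (A1 : set T1) (A2 : set T2)
    (z : T1 * T2) : \1_(A1 `*` A2) z = \1_A1 z.1 * \1_A2 z.2 :> R.
  by rewrite !indicE in_setX; case: (_ \in _); case: (_ \in _); rewrite /= ?mulr0 ?mul0r ?mulr1.
have GI d1 d2 (T1 : measurableType d1) (T2 : measurableType d2) :
  setI_closed [set A | exists2 A1, measurable A1 & exists2 A2, measurable A2 &
     A1 `*` A2 = A :> set (T1 * T2)].
  move=> _ _ [A1 mA1 [A2 mA2 <-]] [B1 mB1 [B2 mB2 <-]].
  exists (A1 `&` B1); first exact: measurableI.
  exists (A2 `&` B2); first exact: measurableI.
  by rewrite setXI.
have H12 : forall A, measurable A -> mult (fun y => \1_A y.1).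
  apply: (multiplier_sigma mwave_family wave_family1 ih (@measurable_fst _ _ _ _)
    (@measurable_prod_measurableType _ _ _ _) (GI _ _ _ _)).
  move=> _ [A1 mA1 [A2 mA2 <-]]; under eq_fun do rewrite indX.
  by apply: multiplierM; [exact: H1|exact: H2].
move: A; apply: (multiplier_sigma mwave_family wave_family1 ih (@measurable_id _ _ setT)
    (@measurable_prod_measurableType _ _ _ _) (GI _ _ _ _)).
move=> _ [A1 mA1 [A2 mA2 <-]]; under eq_fun do rewrite indX.
by apply: multiplierM; [exact: H12|exact: H3].
Qed.

(** The integral of h times the wave of frequency (0, 1/2, 0)/L vanishes over every
measurable set, and this wave, cos(y_2/(2L)), is positive on D. *)
Lemma shifted_fourier_unique :
  (forall m, \int[lebD]_y (h y * wave (freq m) 0 y) = 0) ->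
  (forall m, \int[lebD]_y (h y * wave (freq m) (- (pi / 2)) y) = 0) ->
  {ae lebD, forall y, h y = 0}.
Proof.
move=> Hc Hs.
have bW (p : X) (t : R) : bounded_measurable (wave p t).
  by split; [exact: measurable_wave|exists 1 => x; exact: wave_le1].
have ann : annihilated lebD wave_family h (fun=> 1).
  split; first exact: bounded_measurable_cst.
  move=> [m t]; rewrite /wave_family/=.
  have sp y : h y * (1 * wave (freq m) t y) =
      cos t * (h y * wave (freq m) 0 y) + (- sin t) * (h y * wave (freq m) (- (pi / 2)) y).
    rewrite /wave addr0 cosBpihalf; move: (dot3 _ y) => z; rewrite cosD; ring.
  under eq_Rintegral do rewrite sp.
  have i1 := intg_bounded_measurable ih (bW (freq m) 0).
  have i2 := intg_bounded_measurable ih (bW (freq m) (- (pi / 2))).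
  rewrite (RintegralD measurableT (intgZ _ i1) (intgZ _ i2)).
  by rewrite (RintegralZl _ measurableT i1) (RintegralZl _ measurableT i2) Hc Hs !mulr0 addr0.
pose w := wave (freq (0, 0, 0)) 0.
have iw : intg lebD (fun y => h y * w y) := intg_bounded_measurable ih (bW _ _).
have Z : ae_eq lebD setT (EFin \o (fun y => h y * w y)) (cst 0%E).
  apply: (integral_ae_eq measurableT iw) => //.
  move=> A _ mA; rewrite integral_cst// mul0e.
  have [_ /(_ _ ann)[_ /(_ ((0, 0, 0), 0))]] := multiplier_measurable mA.
  rewrite /wave_family/= -/w => E.
  have iA : intg lebD (fun y => h y * (1 * \1_A y * w y)).
    apply: intg_bounded_measurable => //; apply: bounded_measurableM (bW _ _); apply: bounded_measurableM; first exact: bounded_measurable_cst.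
    exact: (bounded_measurable_indic R (@measurable_id _ _ setT) mA).
  have : (\int[lebD]_y (h y * (1 * \1_A y * w y))%:E = 0)%E.
    rewrite -[LHS]fineK; last exact: (integrable_fin_num measurableT iA).
    by congr EFin.
  move=> <-; rewrite integral_mkcond; apply: eq_integral => y _.
  by rewrite patchE indicE; case: ifP => _ /=; rewrite ?mul1r ?mul0r ?mulr0 ?mul0r ?mulr0.
apply: filterS2 (lebD_ae mD Doo) Z => y /DL[_ y2 _] /(_ I)/= /eqP.
rewrite eqe mulf_eq0 => /orP[/eqP//|].
rewrite /w /wave /freq /dot3/= !mul0r !add0r !addr0 subr0 in y2 *.
rewrite gt_eqF//; apply: cos_gt0_pihalf.
have ph := @pihalf_ge1 R.
have : `|2^-1 / L * y.1.2| <= 2^-1.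
  rewrite normrM (@ger0_norm _ (2^-1 / L)); last by rewrite divr_ge0// ltW.
  by rewrite -mulrA -[leRHS]mulr1 ler_wpM2l// mulrC ler_pdivrMr// mul1r.
by rewrite ler_norml => /andP[a b]; apply/andP; split; move: (pi / 2) ph => p ph; lra.
Qed.

End Uniqueness.

(** * Pairs of points on a sphere with a given difference *)

Section Points.
Variable R : realType.
Notation X := (R3 R).
Variable L : R.
Hypothesis L0 : 0 < L.

(** The point p must lie on the plane p.xi = |xi|^2/2 and on the sphere of radius k,
with prescribed third coordinate. The plane gives the second coordinate in
terms of the first one, b, since xi has a nonzero second coordinate; the sphere is
then a quadratic equation for b, solvable for large k. *)
Lemma plane_sphere (xi : X) (z k : R) : xi.1.2 != 0 ->
  let A := (dot3 xi xi / 2 - xi.2 * z) / xi.1.2 in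
  A ^+ 2 + z ^+ 2 <= k ^+ 2 -> 0 <= k ->
  exists p : X, [/\ p.2 = z, enorm p = k & enorm (p - xi) = k].
Proof.
move=> x0 A Ak k0; (* The plane reads p = (b, A + B b, z). *)
pose B := - xi.1.1 / xi.1.2.
pose S := (A * B) ^+ 2 - (1 + B ^+ 2) * (A ^+ 2 + z ^+ 2 - k ^+ 2).
have S0 : 0 <= S.
  rewrite subr_ge0 (@le_trans _ _ 0) ?sqr_ge0// mulr_ge0_le0 ?subr_le0//.
  by rewrite addr_ge0 ?sqr_ge0.
have B0 : 1 + B ^+ 2 != 0 by rewrite gt_eqF// ltr_pwDl// sqr_ge0.
pose b := (- (A * B) + Num.sqrt S) / (1 + B ^+ 2).
have bE : b ^+ 2 + (A + B * b) ^+ 2 + z ^+ 2 = k ^+ 2.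
  have h : (1 + B ^+ 2) * b = - (A * B) + Num.sqrt S by rewrite mulrC divfK.
  have := sqr_sqrtr S0.
  rewrite (_ : Num.sqrt S = (1 + B ^+ 2) * b + A * B); last by rewrite h; ring.
  move=> e; apply/(mulfI B0)/eqP; rewrite -subr_eq0; apply/eqP.
  transitivity (((1 + B ^+ 2) * b + A * B) ^+ 2 - S); last by rewrite e subrr.
  by rewrite /S; ring.
pose p : X := (b, A + B * b, z).
have p2 : dot3 p p = k ^+ 2 by rewrite -bE /dot3 /p/=; ring.
have pxi : dot3 (p - xi) (p - xi) = k ^+ 2.
  rewrite -p2 /dot3 /p/=.
  have e : xi.1.2 * (A + B * b) = dot3 xi xi / 2 - xi.2 * z - xi.1.1 * b.
    by rewrite /A /B; field.
  apply/eqP; rewrite -subr_eq0; apply/eqP.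
  transitivity (dot3 xi xi - 2 * (xi.1.1 * b + xi.1.2 * (A + B * b) + xi.2 * z)).
    by rewrite /dot3; ring.
  by rewrite e; field.
by exists p; split => //; rewrite /enorm ?p2 ?pxi sqrtr_sqr ger0_norm.
Qed.

(** The third coordinates (a + i)/L start at a = |m_3| + 1, so that subtracting
m_3/L leaves positive multiples of 1/L: both p_i and p_i - xi satisfy the
hypotheses of the Bessel inequality. *)
Lemma exists_points (m : int * int * int) : exists a b : nat,
  [/\ (0 < a)%N, (0 < b)%N & forall n : nat, exists N : nat, forall k : R, N%:R <= k ->
    exists p : nat -> X, forall i, (i < n)%N ->
    [/\ enorm (p i) = k, enorm (p i - freq L m) = k,
      (p i).2 * L = (a + i)%:R & (p i - freq L m).2 * L = (b + i)%:R]].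
Proof.
pose a := `|m.2|%N.+1; pose b := `|a%:Z - m.2|%N.
have bE : b%:Z = a%:Z - m.2.
  rewrite /b abszE ger0_norm// subr_ge0 /a.
  by apply: (le_trans (ler_norm _)); rewrite -abszE lez_nat.
exists a, b; split => //.
  rewrite lt0n; apply/eqP => b0; move: bE; rewrite b0 => /eqP.
  rewrite eq_sym subr_eq0 => /eqP e.
  have : `|m.2|%N = a by rewrite -e.
  by rewrite /a => /eqP; rewrite ltn_eqF.
move=> n; set xi := freq L m.
have LV : L != 0 by rewrite gt_eqF.
have x0 : xi.1.2 != 0.
  rewrite /xi /freq/= mulf_neq0 ?invr_eq0//.
  apply/eqP => /(congr1 (fun x : R => 2 * x)); rewrite mulr0 mulrDr divff// => e.
  have : (2 * m.1.2 + 1)%:~R = 0 :> R by rewrite rmorphD rmorphM/= -[RHS]e.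
  move/eqP; rewrite intr_eq0 => /eqP e'.
  by move: (m.1.2) e' => q; lia.
pose z i : R := (a + i)%:R / L.
pose A i := (dot3 xi xi / 2 - xi.2 * z i) / xi.1.2.
pose M : R := \sum_(i < n) (A i ^+ 2 + z i ^+ 2) + 1.
have M1 : 1 <= M.
  by rewrite lerDr sumr_ge0// => i _; rewrite addr_ge0 ?sqr_ge0.
exists (Num.bound M) => k Nk.
have Mk : M <= k by exact: (le_trans (ltW (archi_boundP (le_trans ler01 M1))) Nk).
have k1 : 1 <= k by rewrite (le_trans M1).
have H i : exists p : X, (i < n)%N -> [/\ p.2 = z i, enorm p = k & enorm (p - xi) = k].
  have [ltin|] := boolP (i < n)%N; last by exists 0.
  have [||p] := @plane_sphere xi (z i) k x0; last by exists p.
    apply: (@le_trans _ _ M).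
      rewrite /M (bigD1 (Ordinal ltin))//= -addrA lerDl addr_ge0// sumr_ge0// => j _.
      by rewrite addr_ge0 ?sqr_ge0.
    by rewrite (le_trans Mk)// expr2 ler_peMl// (le_trans _ k1).
  by rewrite (le_trans _ k1).
exists (fun i => projT1 (cid (H i))) => i ltin.
case: (cid (H i)) => p /= /(_ ltin)[pz pk pxk]; split => //.
  by rewrite pz /z divfK.
rewrite mulrBl pz /z divfK// /xi /freq/= divfK//.
have -> : (b + i)%:R = (a%:R - m.2%:~R) + i%:R :> R by rewrite natrD -[b%:R]/((b%:Z)%:~R) bE rmorphB.
by rewrite natrD addrAC.
Qed.

End Points.

(** * Dyadic averages *)

Section DyadicAverage.
Variable R : realType.
Implicit Types f g : nat -> R.

Definition avg (n : nat) f : R := (2 ^+ n)^-1 * \sum_(i < 2 ^ n) f i.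

Lemma avg_le n f g : (forall i, (i < 2 ^ n)%N -> f i <= g i) -> avg n f <= avg n g.
Proof.
move=> fg; rewrite /avg ler_wpM2l ?invr_ge0 ?exprn_ge0//.
by apply: ler_sum => i _; exact: fg.
Qed.

Lemma avgD n f g : avg n (fun i => f i + g i) = avg n f + avg n g.
Proof. by rewrite /avg big_split mulrDr. Qed.

Lemma avgZ n a f : avg n (fun i => a * f i) = a * avg n f.
Proof. by rewrite /avg -mulr_sumr mulrCA. Qed.

Lemma avg_ge0 n f : (forall i, 0 <= f i) -> 0 <= avg n f.
Proof. by move=> f0; rewrite mulr_ge0 ?invr_ge0 ?exprn_ge0 ?sumr_ge0. Qed.

Lemma avg_norm n f : `|avg n f| <= avg n (fun i => `|f i|).
Proof.
rewrite /avg normrM ger0_norm ?invr_ge0 ?exprn_ge0//.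
by rewrite ler_wpM2l ?invr_ge0 ?exprn_ge0 ?ler_norm_sum.
Qed.

Lemma avg_cst n c : avg n (fun=> c) = c.
Proof.
by rewrite /avg sumr_const card_ord -[c *+ _]mulr_natl natrX mulrA mulVf ?mul1r// expf_neq0.
Qed.

Lemma avg_eq n f g : (forall i, (i < 2 ^ n)%N -> f i = g i) -> avg n f = avg n g.
Proof. by move=> fg; congr (_ * _); apply: eq_bigr => i _; exact: fg. Qed.

Definition square_null (r : nat -> nat -> R) :=
  (fun n => avg n (fun i => r n i ^+ 2)) @ \oo --> (0 : R).

Definition square_bounded (x : nat -> nat -> R) :=
  exists C, \forall n \near \oo, avg n (fun i => x n i ^+ 2) <= C.

Lemma young (e x s : R) : 0 < e -> `|x * s| <= e * x ^+ 2 + e^-1 * s ^+ 2.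
Proof.
move=> e0; have h (a b : R) : `|a * b| <= a ^+ 2 + b ^+ 2.
  by rewrite ler_norml; apply/andP; split; rewrite !expr2; nra.
have se : 0 < Num.sqrt e by rewrite sqrtr_gt0.
set q := Num.sqrt e in se; have qe : q ^+ 2 = e by rewrite sqr_sqrtr// ltW.
have := h (q * x) (q^-1 * s).
rewrite (_ : q * x * (q^-1 * s) = x * s); last by field; rewrite gt_eqF.
by rewrite !exprMn exprVn qe.
Qed.

(** The cross terms are small by the weighted Young inequality, with a weight
adapted to the bound on the unperturbed sequences. *)
Lemma avg_perturb (x y r s : nat -> nat -> R) :
  square_bounded x -> square_bounded y -> square_null r -> square_null s ->
  (fun n => avg n (fun i => (x n i + r n i) * (y n i + s n i)) -
            avg n (fun i => x n i * y n i)) @ \oo --> (0 : R).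
Proof.
move=> [C xC] [K yK] r0 s0.
pose Dn n := avg n (fun i => x n i * s n i + (r n i * y n i + r n i * s n i)).
have E n : avg n (fun i => (x n i + r n i) * (y n i + s n i)) -
    avg n (fun i => x n i * y n i) = Dn n.
  apply/eqP; rewrite subr_eq addrC; apply/eqP.
  by rewrite /Dn -avgD; apply: avg_eq => i _; ring.
rewrite (funext E).
apply/cvgr0Pnorm_lt => eta eta0.
(* The weight e makes the terms with x and y at most eta/4, and b then multiplies
   the small averages of r^2 and s^2. *)
pose e := eta / (4 * (`|C| + `|K| + 1)).
have e0 : 0 < e by rewrite divr_gt0// mulr_gt0// ltr_wpDl ?addr_ge0.
pose b := e^-1 + 1.
have b0 : 0 < b by rewrite addr_gt0 ?invr_gt0.
have eb : 0 < eta / (4 * b) by rewrite divr_gt0// mulr_gt0.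
have := cvgr0_norm_lt _ r0 _ eb; have := cvgr0_norm_lt _ s0 _ eb.
move=> sN rN; near=> n.
have rn : `|avg n (fun i => r n i ^+ 2)| < eta / (4 * b) by near: n; exact: rN.
have sn : `|avg n (fun i => s n i ^+ 2)| < eta / (4 * b) by near: n; exact: sN.
have xn : avg n (fun i => x n i ^+ 2) <= C by near: n.
have yn : avg n (fun i => y n i ^+ 2) <= K by near: n.
have {}rn := le_lt_trans (ler_norm _) rn; have {}sn := le_lt_trans (ler_norm _) sn.
apply: (le_lt_trans (avg_norm _ _)).
apply: (@le_lt_trans _ _ (e * (avg n (fun i => x n i ^+ 2) + avg n (fun i => y n i ^+ 2)) +
   b * (avg n (fun i => r n i ^+ 2) + avg n (fun i => s n i ^+ 2)))).
  rewrite -!avgD -!avgZ -avgD; apply: avg_le => i _.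
  have h1 := @young e (x n i) (s n i) e0.
  have h2 := @young e (y n i) (r n i) e0.
  have h3 := @young 1 (r n i) (s n i) ltr01.
  rewrite invr1 !mul1r in h3; rewrite mulrC in h2.
  apply: (le_trans (ler_normD _ _)); apply: (le_trans (lerD h1 (ler_normD _ _))).
  apply: (le_trans (lerD (lexx _) (lerD h2 h3))); rewrite /b.
  by rewrite le_eqVlt; apply/orP; left; apply/eqP; ring.
have CK : 0 < `|C| + `|K| + 1 by rewrite ltr_wpDl ?addr_ge0.
have h1 : e * (avg n (fun i => x n i ^+ 2) + avg n (fun i => y n i ^+ 2)) <= eta / 4.
  rewrite (_ : eta / 4 = e * (`|C| + `|K| + 1)); last first.
    by rewrite /e; field; rewrite gt_eqF.
  apply: (ler_wpM2l (ltW e0)); apply: (le_trans (lerD xn yn)).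
  by apply: (le_trans (lerD (ler_norm C) (ler_norm K))); rewrite lerDl.
have h2 : b * (avg n (fun i => r n i ^+ 2) + avg n (fun i => s n i ^+ 2)) < eta / 2.
  have : b * (avg n (fun i => r n i ^+ 2) + avg n (fun i => s n i ^+ 2)) <
     b * (eta / (4 * b) + eta / (4 * b)) by rewrite ltr_pM2l// ltrD.
  rewrite (_ : b * (eta / (4 * b) + eta / (4 * b)) = eta / 2)//.
  by field; rewrite gt_eqF.
by move: (e * _) (b * _) h1 h2 => u v h1 h2; lra.
Unshelve. all: by end_near.
Qed.

Lemma square_bounded_cvg (x : nat -> nat -> R) (c : nat -> nat -> R) C :
  (forall n i, (i < 2 ^ n)%N -> c n i <= C) ->
  (fun n => avg n (fun i => x n i ^+ 2 - c n i)) @ \oo --> (0 : R) ->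
  square_bounded x.
Proof.
move=> cC h; have hN := cvgr0_norm_lt _ h _ (@ltr01 R).
exists (1 + C); near=> n.
have : `|avg n (fun i => x n i ^+ 2 - c n i)| < 1.
  by near: n; exact: hN.
move=> /(le_lt_trans (ler_norm _)) /ltW.
have -> : avg n (fun i => x n i ^+ 2 - c n i) = avg n (fun i => x n i ^+ 2) + avg n (fun i => -1 * c n i).
  by rewrite -avgD; apply: avg_eq => i _; ring.
rewrite avgZ mulN1r lerBlDr => hn; apply: (le_trans hn).
by rewrite lerD2l -[leRHS](avg_cst n); exact: avg_le (cC n).
Unshelve. all: by end_near.
Qed.

Lemma square_nullD (r s : nat -> nat -> R) : square_null r -> square_null s ->
  square_null (fun n i => r n i + s n i).
Proof.
move=> r0 s0.
have h : (fun n => 2 * avg n (fun i => r n i ^+ 2) + 2 * avg n (fun i => s n i ^+ 2)) @ \oo --> (0 : R).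
  rewrite -[X in _ --> X]addr0 -[X in X + _ ](mulr0 2) -[X in _ + X](mulr0 2).
  by apply: cvgD; (apply: cvgM; [exact: cvg_cst|]).
apply: (squeeze_cvgr _ (cvg_cst 0) h); near=> n; apply/andP; split.
  by apply: avg_ge0 => i; rewrite sqr_ge0.
rewrite -!avgZ -avgD; apply: avg_le => i _.
by have := sqr_ge0 (r n i - s n i); rewrite !expr2; nra.
Unshelve. all: by end_near.
Qed.

Lemma square_nullZ a (r : nat -> nat -> R) : square_null r ->
  square_null (fun n i => a * r n i).
Proof.
move=> r0; rewrite /square_null.
have E n : avg n (fun i => (a * r n i) ^+ 2) = a ^+ 2 * avg n (fun i => r n i ^+ 2).
  by rewrite -avgZ; apply: avg_eq => i _; rewrite exprMn.
rewrite (funext E) -(mulr0 (a ^+ 2)).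
by apply: cvgM; [exact: cvg_cst|exact: r0].
Qed.

End DyadicAverage.

(** * Averages of products of noise integrals *)

Section BoundedAE.
Variable R : realType.
Notation X := (R3 R).
Variables (D : set X) (mD : measurable D) (Doo : (leb3 R D < +oo)%E).
Notation lebD := (lebD mD Doo).

Lemma Lfun_oo_bounded (f : X -> R) : f \in Lfun (leb3 R) +oo%E ->
  measurable_fun [set: X] f /\
  exists2 C, 0 <= C & {ae leb3 R, forall x, `|f x| <= C}.
Proof.
rewrite inE => /andP[/[!inE]mf fin]; split => //.
move: fin; rewrite /finite_norm unlock /=; case: ifPn => h fin; last first.
  exists 0 => //; exists setT; split => //.
  by apply/eqP; rewrite eq_le measure_ge0 andbT leNgt.
have [C HC] : exists C, \forall x \ae leb3 R, `|f x| <= C.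
  by apply: (@ess_supr_bounded _ _ _ (leb3 R) (fun x => `|f x|)); exact: fin.
exists `|C| => //; apply: filterS HC => x hx; exact: (le_trans hx (ler_norm _)).
Qed.

Lemma intg_ae_bounded (f : X -> R) C : measurable_fun [set: X] f ->
  {ae lebD, forall x, `|f x| <= C} -> intg lebD f.
Proof.
move=> mf fC; apply/integrableP; split; first exact/measurable_EFinP.
have ic := intg_cst lebD `|C|.
have /integrableP[_ fin] := ic.
apply: (le_lt_trans _ fin); apply: ae_ge0_le_integral => //.
  by apply: measurableT_comp => //; exact/measurable_EFinP.
apply: filterS fC => x h _ /=; rewrite lee_fin normr_id.
exact: (le_trans h (ler_norm _)).
Qed.

Lemma sqr_le_norm (a C : R) : `|a| <= C -> `|a ^+ 2| <= C ^+ 2.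
Proof.
move=> h; rewrite normrX ler_sqr ?nnegrE//; exact: (le_trans _ h).
Qed.

Lemma l2_ae_bounded (f : X -> R) C : measurable_fun [set: X] f ->
  {ae lebD, forall x, `|f x| <= C} -> l2 lebD f.
Proof.
move=> mf fC; split => //; apply: (@intg_ae_bounded _ (C ^+ 2)).
  exact: measurable_funX.
by apply: filterS fC => x; exact: sqr_le_norm.
Qed.

Definition vol : R := fine (lebD setT).

Lemma dot_ae_bounded (f : X -> R) C : measurable_fun [set: X] f ->
  {ae lebD, forall x, `|f x| <= C} -> dot lebD f f <= C ^+ 2 * vol.
Proof.
move=> mf fC; have lf := l2_ae_bounded mf fC.
have -> : C ^+ 2 * vol = \int[lebD]_x (C ^+ 2).
  by rewrite (Rintegral_cst _ measurableT).
rewrite -dotE.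
apply: (ae_le_Rintegral (mD:=mD) (Doo:=Doo) lf.2 (intg_cst lebD _)).
- by move=> x; rewrite sqr_ge0.
- by move=> x; rewrite sqr_ge0.
by apply: filterS fC => x /sqr_le_norm; apply: le_trans; exact: ler_norm.
Qed.

End BoundedAE.

Section GaussianProducts.
Context d (Omega : measurableType d) (R : realType)
  (P : probability Omega R) (D : set (R3 R))
  (B : (R3 R -> R) -> {RV P >-> R}).
Hypothesis hB : white_noise D B.
Notation X := (R3 R).
Variables (mD : measurable D) (Doo : (leb3 R D < +oo)%E).
Notation lebD := (lebD mD Doo).
Variable L : R.
Hypothesis L0 : 0 < L.
Hypothesis DL : D `<=` cube 0 L.
Variables (sigma : X -> R) (S : R).
Hypothesis ms : measurable_fun [set: X] sigma.
Hypothesis S0 : 0 <= S.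
Hypothesis sS : {ae leb3 R, forall x, `|sigma x ^+ 2| <= S}.

Definition increasing_third (a : nat) (n : nat) (p : nat -> X) :=
  forall i, (i < n)%N -> (p i).2 * L = (a + i)%:R.

Lemma bessel_increasing (a n : nat) (p : nat -> X) t g : (0 < a)%N ->
  increasing_third a n p -> l2 lebD g ->
  \sum_(i < n) dot lebD g (wave (p i) t) ^+ 2 <= besselC L * dot lebD g g.
Proof.
move=> a0 ap lg; apply: (bessel_strip L0 DL (a := fun i => (a + i)%N)) => //.
  by move=> i ni; split; [rewrite addn_gt0 a0|exact: ap].
by move=> i j _ _; rewrite eqn_add2l.
Qed.

Variables (a b : nat) (p q : nat -> nat -> X) (t s : R).
Hypotheses (a0 : (0 < a)%N) (b0 : (0 < b)%N).
Hypothesis ap : forall n, increasing_third a (2 ^ n) (p n).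
Hypothesis bq : forall n, increasing_third b (2 ^ n) (q n).

Let bw (al be : R) (x y : X) z := al * wave x t z + be * wave y s z.

Let mbw al be x y : measurable_fun [set: X] (bw al be x y).
Proof.
by apply: measurable_funD; apply: measurable_funM => //; exact: measurable_wave.
Qed.

Let bw2 al be x y z : `|al| <= 1 -> `|be| <= 1 -> `|bw al be x y z| <= 2.
Proof.
move=> h1 h2; rewrite (le_trans (ler_normD _ _))// (_ : 2 = 1 * 1 + 1 * 1); last by ring.
by rewrite !normrM lerD// ler_pM//; exact: wave_le1.
Qed.

Lemma sigma_ae : {ae lebD, forall x, `|sigma x| <= 1 + S}.
Proof.
apply: filterS (ae_leb3_lebD mD Doo sS) => x; rewrite ger0_norm ?sqr_ge0//.
rewrite -real_normK ?num_real// => h.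
have [|/ltW h1] := leP `|sigma x| 1; first by move=> h1; rewrite (le_trans h1)// lerDl.
apply: (@le_trans _ _ (`|sigma x| ^+ 2)); last by rewrite (le_trans h)// lerDr.
by rewrite expr2 ler_peMl.
Qed.

Lemma l2_sigma_wave x r : l2 lebD (fun z => sigma z * wave x r z).
Proof.
apply: (@l2_ae_bounded _ _ mD Doo _ (1 + S)).
  by apply: measurable_funM => //; exact: measurable_wave.
apply: filterS sigma_ae => z h; rewrite normrM -[leRHS]mulr1.
by rewrite ler_pM// wave_le1.
Qed.

Lemma dot_sigma_wave x r : dot lebD (fun z => sigma z * wave x r z)
  (fun z => sigma z * wave x r z) <= (1 + S) ^+ 2 * vol mD Doo.
Proof.
apply: dot_ae_bounded.
  by apply: measurable_funM => //; exact: measurable_wave.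
apply: filterS sigma_ae => z h; rewrite normrM -[leRHS]mulr1.
by rewrite ler_pM// wave_le1.
Qed.

Let lln_pair (al be : R) : `|al| <= 1 -> `|be| <= 1 ->
  let f n i z := sigma z * bw al be (p n i) (q n i) z in
  {ae P, forall w, (fun n => avg n (fun i =>
     B (f n i) w ^+ 2 - dot lebD (f n i) (f n i))) @ \oo --> (0 : R)}.
Proof.
move=> al1 be1 f.
have mf n i : measurable_fun [set: X] (f n i) by exact: measurable_funM.
have lf n i : l2 lebD (f n i).
  apply: (@l2_ae_bounded _ _ mD Doo _ ((1 + S) * 2)) => //.
  by apply: filterS sigma_ae => z h; rewrite normrM ler_pM// bw2.
pose C := 4 * besselC L * ((2 * S) ^+ 2 * vol mD Doo).
have C0 : 0 <= C.
  rewrite mulr_ge0//; first by rewrite mulr_ge0// ltW// besselC_gt0.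
  by rewrite mulr_ge0 ?sqr_ge0// fine_ge0.
have := @lln_square R D d Omega P B hB mD Doo C f C0 (fun n i _ => lf n i); apply.
move=> n l ln.
pose g z := sigma z ^+ 2 * bw al be (p n l) (q n l) z.
have mg : measurable_fun [set: X] g by apply: measurable_funM => //; exact: measurable_funX.
have gb : {ae lebD, forall z, `|g z| <= 2 * S}.
  by apply: filterS (ae_leb3_lebD mD Doo sS) => z h; rewrite normrM [leRHS]mulrC ler_pM// bw2.
have lg := l2_ae_bounded mg gb.
have lw x r : l2 lebD (wave x r) := l2_bounded lebD (measurable_wave x r) (wave_le1 x r).
have E i : dot lebD (f n i) (f n l) =
    al * dot lebD g (wave (p n i) t) + be * dot lebD g (wave (q n i) s).
  rewrite -(dotZr al (lw (p n i) t) lg) -(dotZr be (lw (q n i) s) lg).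
  rewrite -(dotDr (l2Z al (lw (p n i) t)) (l2Z be (lw (q n i) s)) lg).
  by apply: eq_Rintegral => z _; rewrite /f /g /bw; ring.
have sq (u v x y : R) : `|u| <= 1 -> `|v| <= 1 -> (u * x + v * y) ^+ 2 <= 2 * x ^+ 2 + 2 * y ^+ 2.
  move=> /sqr_le1 u1 /sqr_le1 v1.
  have h1 : (u * x) ^+ 2 <= x ^+ 2.
    by rewrite exprMn ler_piMl ?sqr_ge0// expr2.
  have h2 : (v * y) ^+ 2 <= y ^+ 2.
    by rewrite exprMn ler_piMl ?sqr_ge0// expr2.
  have := sqr_ge0 (u * x - v * y); move: (u * x) (v * y) h1 h2 => A B' h1 h2.
  by move: h1 h2; rewrite !expr2; nra.
apply: (@le_trans _ _ (2 * \sum_(i < 2 ^ n) dot lebD g (wave (p n i) t) ^+ 2 +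
    2 * \sum_(i < 2 ^ n) dot lebD g (wave (q n i) s) ^+ 2)).
  rewrite !mulr_sumr -big_split/=; apply: ler_sum => i _.
  by rewrite E; exact: sq.
have B1 := bessel_increasing t a0 (@ap n) lg.
have B2 := bessel_increasing s b0 (@bq n) lg.
have B3 := dot_ae_bounded mg gb.
have B4 := ler_wpM2l (ltW (besselC_gt0 L)) B3.
move: B1 B2 B4; rewrite /C -mulrA.
move: (\sum_(i < _) dot lebD g (wave (p n i) t) ^+ 2) (\sum_(i < _) dot lebD g (wave (q n i) s) ^+ 2).
move: (besselC L * dot lebD g g) (besselC L * ((2 * S) ^+ 2 * vol mD Doo)) => u v x y h1 h2 h3.
apply: (le_trans (lerD (ler_wpM2l (ler0n R 2) (le_trans h1 h3)) (ler_wpM2l (ler0n R 2) (le_trans h2 h3)))).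
by rewrite le_eqVlt; apply/orP; left; apply/eqP; ring.
Qed.

(** Polarization: a product is a quarter of the difference of two squares, to
which the law of large numbers applies, because the covariances of the
combined family are again Fourier coefficients of functions of bounded norm. *)
Lemma gaussian_product_average :
  let x n i w := B (fun z => sigma z * wave (p n i) t z) w in
  let y n i w := B (fun z => sigma z * wave (q n i) s z) w in
  {ae P, forall w,
    [/\ square_bounded (fun n i => x n i w), square_bounded (fun n i => y n i w) &
    (fun n => avg n (fun i => x n i w * y n i w - dot lebD
      (fun z => sigma z * wave (p n i) t z) (fun z => sigma z * wave (q n i) s z)))
      @ \oo --> (0 : R)]}.
Proof.
move=> x y.
have n1 : `|1 : R| <= 1 by rewrite normr1.
have n0 : `|0 : R| <= 1 by rewrite normr0.
have nN : `|-1 : R| <= 1 by rewrite normrN1.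
have /= h1 := lln_pair n1 n0; have /= h2 := lln_pair n0 n1.
have /= h3 := lln_pair n1 n1; have /= h4 := lln_pair n1 nN.
apply: filterS2 (filterI h1 h2) (filterI h3 h4) => w [{}h1 {}h2] [{}h3 {}h4].
have e1 n i : (fun z => sigma z * bw 1 0 (p n i) (q n i) z) = fun z => sigma z * wave (p n i) t z.
  by apply/funext => z; rewrite /bw mul1r mul0r addr0.
have e2 n i : (fun z => sigma z * bw 0 1 (p n i) (q n i) z) = fun z => sigma z * wave (q n i) s z.
  by apply/funext => z; rewrite /bw mul1r mul0r add0r.
have e3 n i : (fun z => sigma z * bw 1 1 (p n i) (q n i) z) =
    fun z => sigma z * wave (p n i) t z + sigma z * wave (q n i) s z.
  by apply/funext => z; rewrite /bw !mul1r mulrDr.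
have e4 n i : (fun z => sigma z * bw 1 (-1) (p n i) (q n i) z) =
    fun z => sigma z * wave (p n i) t z - sigma z * wave (q n i) s z.
  by apply/funext => z; rewrite /bw !mul1r mulN1r mulrBr.
split.
- apply: (@square_bounded_cvg _ _ (fun n i => dot lebD (fun z => sigma z * wave (p n i) t z)
    (fun z => sigma z * wave (p n i) t z)) ((1 + S) ^+ 2 * vol mD Doo)).
    by move=> n i _; exact: dot_sigma_wave.
  rewrite (_ : (fun n => _) = (fun n => avg n (fun i =>
      B (fun z => sigma z * bw 1 0 (p n i) (q n i) z) w ^+ 2 -
      dot lebD (fun z => sigma z * bw 1 0 (p n i) (q n i) z)
             (fun z => sigma z * bw 1 0 (p n i) (q n i) z)))); first exact: h1.
  by apply/funext => n; apply: avg_eq => i _; rewrite e1.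
- apply: (@square_bounded_cvg _ _ (fun n i => dot lebD (fun z => sigma z * wave (q n i) s z)
    (fun z => sigma z * wave (q n i) s z)) ((1 + S) ^+ 2 * vol mD Doo)).
    by move=> n i _; exact: dot_sigma_wave.
  rewrite (_ : (fun n => _) = (fun n => avg n (fun i =>
      B (fun z => sigma z * bw 0 1 (p n i) (q n i) z) w ^+ 2 -
      dot lebD (fun z => sigma z * bw 0 1 (p n i) (q n i) z)
             (fun z => sigma z * bw 0 1 (p n i) (q n i) z)))); first exact: h2.
  by apply/funext => n; apply: avg_eq => i _; rewrite e2.
pose F (r : R) n := avg n (fun i => B (fun z => sigma z * bw 1 r (p n i) (q n i) z) w ^+ 2 -
  dot lebD (fun z => sigma z * bw 1 r (p n i) (q n i) z)
         (fun z => sigma z * bw 1 r (p n i) (q n i) z)).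
have h5 : (fun n => 4^-1 * (F 1 n - F (-1) n)) @ \oo --> (4^-1 * (0 - 0) : R).
  by apply: cvgM; [exact: cvg_cst|apply: cvgB; [exact: h3|exact: h4]].
rewrite subr0 mulr0 in h5.
rewrite (_ : (fun n => _) = (fun n => 4^-1 * (F 1 n - F (-1) n))); first exact: h5.
apply/funext => n.
rewrite /F -[- avg n _]mulN1r -avgZ -avgD -avgZ; apply: avg_eq => i _.
rewrite e3 e4; have l1 := l2_sigma_wave (p n i) t; have l2' := l2_sigma_wave (q n i) s.
rewrite (B_add hB w l1 l2') (B_sub hB w l1 l2').
rewrite (dotDl l1 l2' (l2D l1 l2')) (dotDr l1 l2' l1) (dotDr l1 l2' l2').
rewrite (dotBl l1 l2' (l2B l1 l2')) (dotBr l1 l2' l1) (dotBr l1 l2' l2').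
rewrite (dotC _ (fun z => sigma z * wave (q n i) s z) (fun z => sigma z * wave (p n i) t z)).
by rewrite /x /y; field.
Qed.

End GaussianProducts.

(** * The random field R_k(sigma B) *)

Section NoiseField.
Context d (Omega : measurableType d) (R : realType)
  (P : probability Omega R) (D : set (R3 R))
  (B : (R3 R -> R) -> {RV P >-> R}).
Hypothesis hB : white_noise D B.
Notation X := (R3 R).
Variables (mD : measurable D) (Doo : (leb3 R D < +oo)%E).
Notation lebD := (lebD mD Doo).
Variables (sigma : X -> R) (S : R).
Hypothesis ms : measurable_fun [set: X] sigma.
Hypothesis S0 : 0 <= S.
Hypothesis sS : {ae leb3 R, forall x, `|sigma x ^+ 2| <= S}.

Lemma l2_ae_mul (h : X -> R) : l2 lebD h ->
  l2 lebD (fun x => sigma x * h x) /\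
  dot lebD (fun x => sigma x * h x) (fun x => sigma x * h x) <= (1 + S) ^+ 2 * dot lebD h h.
Proof.
move=> lh; have mh := l2_meas lh.
have msh : measurable_fun [set: X] (fun x => sigma x * h x) by exact: measurable_funM.
have lb := l2Z (1 + S) lh.
have b : (\int[lebD]_x ((sigma x * h x) ^+ 2)%:E <= \int[lebD]_x (((1 + S) * h x) ^+ 2)%:E)%E.
  apply: ae_ge0_le_integral => //.
  - by move=> x _; rewrite lee_fin sqr_ge0.
  - by apply/measurable_EFinP; exact: measurable_funX.
  - by move=> x _; rewrite lee_fin sqr_ge0.
  - by apply/measurable_EFinP; apply: measurable_funX; exact: (l2_meas lb).
  apply: filterS (sigma_ae mD Doo S0 sS) => x sx _.
  rewrite lee_fin !exprMn ler_wpM2r ?sqr_ge0//.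
  by rewrite -real_normK ?num_real// ler_sqr ?nnegrE// addr_ge0.
have lsh : l2 lebD (fun x => sigma x * h x).
  by apply: l2P => //; rewrite (le_lt_trans b)// (dot_fineE lb) ltry.
split => //; rewrite -lee_fin -(dot_fineE lsh) (le_trans b)//.
by rewrite (dot_fineE lb) (dotZl _ lh lb) (dotZr _ lh lh) mulrA -expr2.
Qed.

Definition fieldC : R := 2 * ((1 + S) ^+ 2 * (inv4pi R ^+ 2 * invdistC mD Doo)).

Lemma geomC_ge0 : 0 <= invdistC mD Doo.
Proof. by rewrite addr_ge0// fine_ge0. Qed.

Lemma fieldC_ge0 : 0 <= fieldC.
Proof.
apply: mulr_ge0 => //; apply: mulr_ge0; first exact: sqr_ge0.
by apply: mulr_ge0; [exact: sqr_ge0|exact: geomC_ge0].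
Qed.

(** The variance at x is the integral of sigma^2 |Phi_k(x, .)|^2, bounded
independently of k since |Phi_k| = 1/(4 pi |x - y|). *)
Lemma noise_field_pointwise k Z x : is_Rk_noise B sigma k Z ->
  (\int[P]_w (complex.Re (Z x w) ^+ 2 + complex.Im (Z x w) ^+ 2)%:E <= fieldC%:E)%E.
Proof.
move=> [mr mi /(_ x) aeZ].
have [_ /(_ x)[lC bC] _] := oscC_hs mD Doo k.
have [_ /(_ x)[lS bS] _] := oscS_hs mD Doo k.
have key (K : X -> R) : l2 lebD K -> dot lebD K K <= invdistC mD Doo ->
    l2 lebD (fun y => sigma y * (inv4pi R * K y)) /\
    dot lebD (fun y => sigma y * (inv4pi R * K y)) (fun y => sigma y * (inv4pi R * K y))
    <= (1 + S) ^+ 2 * (inv4pi R ^+ 2 * invdistC mD Doo).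
  move=> lK bK; have lc := l2Z (inv4pi R) lK; have [h1 h2] := l2_ae_mul lc.
  split => //; apply: (le_trans h2); apply: (ler_wpM2l (sqr_ge0 _)).
  by rewrite (dotZl _ lK lc) (dotZr _ lK lK) mulrA -expr2; exact: (ler_wpM2l (sqr_ge0 _) bK).
have [l1 b1] := key _ lC bC; have [l2' b2] := key _ lS bS.
have mre : measurable_fun [set: Omega] (fun w => complex.Re (Z x w)).
  exact: (measurableT_comp mr (pair1_measurable x)).
have mim : measurable_fun [set: Omega] (fun w => complex.Im (Z x w)).
  exact: (measurableT_comp mi (pair1_measurable x)).
pose f1 y := sigma y * (inv4pi R * oscC k (x, y)).
pose f2 y := sigma y * (inv4pi R * oscS k (x, y)).
have [m1 _ d1 _] := B_moments hB l1; have [m2 _ d2 _] := B_moments hB l2'.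
have -> : (\int[P]_w (complex.Re (Z x w) ^+ 2 + complex.Im (Z x w) ^+ 2)%:E =
    \int[P]_w (B f1 w ^+ 2 + B f2 w ^+ 2)%:E)%E.
  apply: ae_eq_integral => //.
  - by apply/measurable_EFinP; apply: measurable_funD; exact: measurable_funX.
  - by apply/measurable_EFinP; apply: measurable_funD; apply: measurable_funX.
  have E1 : (fun y => complex.Re ((sigma y)%:C%C * Phi k x y)) = f1.
    by apply/funext => y; rewrite PhiE /f1/=; ring.
  have E2 : (fun y => complex.Im ((sigma y)%:C%C * Phi k x y)) = f2.
    by apply/funext => y; rewrite PhiE /f2/=; ring.
  by apply: filterS aeZ => w -> _; rewrite /noiseC E1 E2.
have i1 := m1.2; have i2 := m2.2.
under eq_integral do rewrite EFinD.
rewrite ge0_integralD//; last 4 first.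
- by move=> w _; rewrite lee_fin sqr_ge0.
- by apply/measurable_EFinP; exact: measurable_funX.
- by move=> w _; rewrite lee_fin sqr_ge0.
- by apply/measurable_EFinP; exact: measurable_funX.
rewrite (dot_fineE m1) (dot_fineE m2) d1 d2 -EFinD lee_fin /fieldC.
by rewrite (_ : 2 * _ = (1 + S) ^+ 2 * (inv4pi R ^+ 2 * invdistC mD Doo) +
  (1 + S) ^+ 2 * (inv4pi R ^+ 2 * invdistC mD Doo)) ?lerD//; ring.
Qed.

(** By Tonelli the expected squared norm of the field over D is bounded
independently of k, so that division by 2^n makes it summable. *)
Lemma noise_field_average (k : nat -> R) (Z : nat -> X -> Omega -> R[i]) :
  (forall n, is_Rk_noise B sigma (k n) (Z n)) ->
  {ae P, forall w,
    (forall n, l2 lebD (fun x => complex.Re (Z n x w)) /\ l2 lebD (fun x => complex.Im (Z n x w))) /\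
    (fun n => (2 ^+ n)^-1 *
       (dot lebD (fun x => complex.Re (Z n x w)) (fun x => complex.Re (Z n x w)) +
        dot lebD (fun x => complex.Im (Z n x w)) (fun x => complex.Im (Z n x w)))) @ \oo --> (0 : R)}.
Proof.
move=> hZ.
pose F n (z : X * Omega) : \bar R :=
  ((2 ^+ n)^-1 * (complex.Re (Z n z.1 z.2) ^+ 2 + complex.Im (Z n z.1 z.2) ^+ 2))%:E.
have F0 n z : (0 <= F n z)%E.
  by rewrite lee_fin mulr_ge0 ?invr_ge0 ?exprn_ge0// addr_ge0 ?sqr_ge0.
have mF n : measurable_fun [set: X * Omega] (F n).
  have [mr mi _] := hZ n.
  apply/measurable_EFinP; apply: measurable_funM => //.
  by apply: measurable_funD; exact: measurable_funX.
pose g n w := (\int[lebD]_x F n (x, w))%E.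
have mg n : measurable_fun [set: Omega] (g n).
  exact: (measurable_fun_fubini_tonelli_G (m1 := lebD) (F n) (mF n) (F0 n)).
have g0 n w : (0 <= g n w)%E by exact: integral_ge0.
have Vo : lebD setT = (vol mD Doo)%:E by rewrite fineK// fin_num_measure.
have vol0 : 0 <= vol mD Doo by exact: fine_ge0.
have gC n : (\int[P]_w g n w <= (fieldC * vol mD Doo / 2 ^+ n)%:E)%E.
  rewrite /g -(fubini_tonelli (m1 := lebD) (m2 := P) (F n) (mF n) (F0 n)).
  have h x : (\int[P]_w F n (x, w) <= ((2 ^+ n)^-1 * fieldC)%:E)%E.
    rewrite /F/=; under eq_integral do rewrite EFinM.
    have [mr mi _] := hZ n.
    rewrite ge0_integralZl_EFin//.
    - rewrite EFinM lee_wpmul2l ?lee_fin ?invr_ge0 ?exprn_ge0//.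
      exact: (noise_field_pointwise x (hZ n)).
    - by move=> w _; rewrite lee_fin addr_ge0 ?sqr_ge0.
    - apply/measurable_EFinP; apply: measurable_funD; apply: measurable_funX.
        exact: (measurableT_comp mr (pair1_measurable x)).
      exact: (measurableT_comp mi (pair1_measurable x)).
  have c0 : 0 <= (2 ^+ n)^-1 * fieldC by rewrite mulr_ge0 ?fieldC_ge0 ?invr_ge0 ?exprn_ge0.
  apply: (@le_trans _ _ (\int[lebD]_x ((2 ^+ n)^-1 * fieldC)%:E)%E).
    apply: ge0_le_integral => //.
    - by move=> x _; exact: integral_ge0.
    - exact: (measurable_fun_fubini_tonelli_F (m2 := P) (F n) (mF n) (F0 n)).
  rewrite integral_cst// -[X in (_ * X)%E]/(lebD setT) Vo -EFinM lee_fin le_eqVlt; apply/orP; left; apply/eqP; ring.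
have := @ae_cvg0 _ _ _ P (fieldC * vol mD Doo) g mg g0 gC (mulr_ge0 fieldC_ge0 vol0).
apply: filterS => w [gfin gcv].
have msec n : measurable_fun [set: X] (fun x => complex.Re (Z n x w)) /\
    measurable_fun [set: X] (fun x => complex.Im (Z n x w)).
  have [mr mi _] := hZ n; split.
    exact: (measurableT_comp mr (pair2_measurable w)).
  exact: (measurableT_comp mi (pair2_measurable w)).
have i2 n : intg lebD (fun x => (2 ^+ n)^-1 * (complex.Re (Z n x w) ^+ 2 + complex.Im (Z n x w) ^+ 2)).
  have [mr mi] := msec n; apply/integrableP; split.
    apply/measurable_EFinP; apply: measurable_funM => //.
    by apply: measurable_funD; exact: measurable_funX.
  rewrite (_ : (\int[lebD]_x _)%E = g n w); first exact: gfin.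
  apply: eq_integral => x _; rewrite /F/= ger0_norm// mulr_ge0 ?invr_ge0 ?exprn_ge0//.
  by rewrite addr_ge0 ?sqr_ge0.
have i3 n : intg lebD (fun x => complex.Re (Z n x w) ^+ 2 + complex.Im (Z n x w) ^+ 2).
  have := intgZ (2 ^+ n) (i2 n).
  by congr intg; apply/funext => x; rewrite mulrA divff ?mul1r// expf_neq0.
have ll n : l2 lebD (fun x => complex.Re (Z n x w)) /\ l2 lebD (fun x => complex.Im (Z n x w)).
  have [mr mi] := msec n; split; split => //.
    apply: (intg_le _ (i3 n)); first exact: measurable_funX.
    by move=> x; rewrite ger0_norm ?sqr_ge0// lerDl sqr_ge0.
  apply: (intg_le _ (i3 n)); first exact: measurable_funX.
  by move=> x; rewrite ger0_norm ?sqr_ge0// lerDr sqr_ge0.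
split => //.
rewrite (_ : (fun n => _) = (fun n => fine (g n w))); first exact: gcv.
apply/funext => n; have [lr li] := ll n.
rewrite -!dotE -(RintegralD measurableT lr.2 li.2).
by rewrite -(RintegralZl _ measurableT (i3 n)).
Qed.

End NoiseField.

(** * Fourier integrals in the far field *)

Definition dilate (R : realType) (k : R) (x : R3 R) : R3 R :=
  (k * x.1.1, k * x.1.2, k * x.2).

Lemma dot3_dilate (R : realType) (k : R) (x y : R3 R) :
  dot3 (dilate k x) y = k * dot3 x y.
Proof. by rewrite /dot3/=; ring. Qed.

Section FarField.
Local Open Scope complex_scope.
Context d (Omega : measurableType d) (R : realType)
  (P : probability Omega R) (D : set (R3 R))
  (B : (R3 R -> R) -> {RV P >-> R}).
Hypothesis hB : white_noise D B.
Notation X := (R3 R).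
Variables (mD : measurable D) (Doo : (leb3 R D < +oo)%E).
Notation lebD := (lebD mD Doo).
Variable L : R.
Hypothesis L0 : 0 < L.
Hypothesis DL : D `<=` cube 0 L.

Lemma l2_wave_lebD x t : l2 lebD (wave x t).
Proof. exact: (l2_bounded lebD (measurable_wave x t) (wave_le1 x t)). Qed.

Lemma expiN (u : R) : expi (- u) = cos u +i* - sin u.
Proof. by rewrite /expi cosN sinN. Qed.

Lemma fourier_re (k : R) (x : X) (w : X -> R[i]) : L2C D w ->
  complex.Re (cintegral D (fun y => expi (- (k * dot3 x y)) * w y)) =
  dot lebD (re_on D w) (wave (dilate k x) 0) + dot lebD (im_on D w) (wave (dilate k x) (- (pi / 2))).
Proof.
move=> /(L2C_l2 mD Doo)[l1 l2'].
have i1 := l2_mul l1 (l2_wave_lebD (dilate k x) 0).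
have i2 := l2_mul l2' (l2_wave_lebD (dilate k x) (- (pi / 2))).
rewrite /cintegral/= (Rintegral_lebD_patch mD Doo) -(RintegralD measurableT i1 i2).
apply: eq_Rintegral => y _; rewrite patchE /re_on /im_on !patchE; case: ifP => _.
  rewrite /wave dot3_dilate addr0 cosBpihalf expiN.
  by case: (w y) => a b /=; ring.
by rewrite !mul0r addr0.
Qed.

Lemma fourier_im (k : R) (x : X) (w : X -> R[i]) : L2C D w ->
  complex.Im (cintegral D (fun y => expi (- (k * dot3 x y)) * w y)) =
  dot lebD (im_on D w) (wave (dilate k x) 0) - dot lebD (re_on D w) (wave (dilate k x) (- (pi / 2))).
Proof.
move=> /(L2C_l2 mD Doo)[l1 l2'].
have i1 := l2_mul l2' (l2_wave_lebD (dilate k x) 0).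
have i2 := l2_mul l1 (l2_wave_lebD (dilate k x) (- (pi / 2))).
rewrite /cintegral/= (Rintegral_lebD_patch mD Doo) -(RintegralB measurableT i1 i2).
apply: eq_Rintegral => y _; rewrite patchE /re_on /im_on !patchE; case: ifP => _.
  rewrite /wave dot3_dilate addr0 cosBpihalf expiN.
  by case: (w y) => a b /=; ring.
by rewrite !mul0r subr0.
Qed.

(** White noise is real, and the imaginary part of e^{-i p.y} is - sin(p.y). *)
Lemma noiseC_wave (sigma : X -> R) k x w :
  l2 lebD (fun y => sigma y * wave (dilate k x) (- (pi / 2)) y) ->
  noiseC B (fun y => (sigma y)%:C * expi (- (k * dot3 x y))) w =
  B (fun y => sigma y * wave (dilate k x) 0 y) w +i*
  - B (fun y => sigma y * wave (dilate k x) (- (pi / 2)) y) w.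
Proof.
move=> ls; rewrite /noiseC; congr (_ +i* _).
  by congr (B _ w); apply/funext => y; rewrite expiN /wave dot3_dilate addr0/=; ring.
have := B_lin hB (-2) w ls ls; rewrite (_ : -2 * _ + _ = - B (fun y => sigma y *
  wave (dilate k x) (- (pi / 2)) y) w); last by ring.
move=> <-; congr (B _ w); apply/funext => y.
by rewrite expiN /wave dot3_dilate cosBpihalf/=; ring.
Qed.

Lemma dot_restrict (h : X -> R) : measurable_fun [set: X] h ->
  dot lebD (h \_ D) (h \_ D) = dot lebD h h.
Proof.
move=> mh; rewrite /dot -(Rintegral_lebD mD Doo (measurable_funM mh mh)) (Rintegral_lebD_patch mD Doo).
by apply: eq_Rintegral => x _; rewrite !patchE; case: ifP => _; rewrite ?mulr0.
Qed.

(** This is the Bessel inequality, and the place where it matters that the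
function h n does not depend on the direction i. *)
Lemma fourier_residual_null (a : nat) (p : nat -> nat -> X) t (h : nat -> X -> R) :
  (0 < a)%N -> (forall n, increasing_third L a (2 ^ n) (p n)) ->
  (\forall n \near \oo, l2 lebD (h n)) ->
  (fun n => (2 ^+ n)^-1 * dot lebD (h n) (h n)) @ \oo --> (0 : R) ->
  square_null (fun n i => dot lebD (h n) (wave (p n i) t)).
Proof.
move=> a0 ap lh h0.
have h1 : (fun n => besselC L * ((2 ^+ n)^-1 * dot lebD (h n) (h n))) @ \oo --> (0 : R).
  by rewrite -(mulr0 (besselC L)); apply: cvgM; [exact: cvg_cst|exact: h0].
apply: (squeeze_cvgr _ (cvg_cst 0) h1); near=> n; apply/andP; split.
  by apply: avg_ge0 => i; rewrite sqr_ge0.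
rewrite /avg mulrCA ler_wpM2l ?invr_ge0 ?exprn_ge0//.
apply: (bessel_increasing L0 DL t a0 (ap n)); near: n; exact: lh.
Unshelve. all: by end_near.
Qed.

Lemma normC2_null (w : nat -> X -> R[i]) (g : nat -> X -> R[i]) :
  (\forall n \near \oo, L2C D (w n) /\ normC2 mD Doo (w n) <= 4 * normC2 mD Doo (g n)) ->
  (fun n => (2 ^+ n)^-1 * normC2 mD Doo (g n)) @ \oo --> (0 : R) ->
  (fun n => (2 ^+ n)^-1 * dot lebD (re_on D (w n)) (re_on D (w n))) @ \oo --> (0 : R) /\
  (fun n => (2 ^+ n)^-1 * dot lebD (im_on D (w n)) (im_on D (w n))) @ \oo --> (0 : R).
Proof.
move=> wg g0.
have h1 : (fun n => 4 * ((2 ^+ n)^-1 * normC2 mD Doo (g n))) @ \oo --> (0 : R).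
  by rewrite -(mulr0 4); apply: cvgM; [exact: cvg_cst|exact: g0].
have i0 n : 0 <= (2 ^+ n)^-1 :> R by rewrite invr_ge0 exprn_ge0.
split; apply: (squeeze_cvgr _ (cvg_cst 0) h1); near=> n; apply/andP; split.
- by rewrite mulr_ge0 ?dot_ge0.
- have [_ le] : L2C D (w n) /\ normC2 mD Doo (w n) <= 4 * normC2 mD Doo (g n) by near: n.
  by rewrite mulrCA ler_wpM2l// (le_trans _ le)// lerDl dot_ge0.
- by rewrite mulr_ge0 ?dot_ge0.
- have [_ le] : L2C D (w n) /\ normC2 mD Doo (w n) <= 4 * normC2 mD Doo (g n) by near: n.
  by rewrite mulrCA ler_wpM2l// (le_trans _ le)// lerDr dot_ge0.
Unshelve. all: by end_near.
Qed.

Lemma fourier_null (a : nat) (k : nat -> R) (s : nat -> nat -> X) (w g : nat -> X -> R[i]) :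
  (0 < a)%N -> (forall n, increasing_third L a (2 ^ n) (fun i => dilate (k n) (s n i))) ->
  (\forall n \near \oo, L2C D (w n) /\ normC2 mD Doo (w n) <= 4 * normC2 mD Doo (g n)) ->
  (fun n => (2 ^+ n)^-1 * normC2 mD Doo (g n)) @ \oo --> (0 : R) ->
  square_null (fun n i => complex.Re (cintegral D (fun y => expi (- (k n * dot3 (s n i) y)) * w n y))) /\
  square_null (fun n i => complex.Im (cintegral D (fun y => expi (- (k n * dot3 (s n i) y)) * w n y))).
Proof.
move=> a0 ap wg g0; have [re0 im0] := normC2_null wg g0.
have lre : \forall n \near \oo, l2 lebD (re_on D (w n)).
  by apply: filterS wg => n [/(L2C_l2 mD Doo)[]].
have lim : \forall n \near \oo, l2 lebD (im_on D (w n)).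
  by apply: filterS wg => n [/(L2C_l2 mD Doo)[]].
have r1 := fourier_residual_null 0 a0 ap lre re0.
have r2 := fourier_residual_null (- (pi / 2)) a0 ap lim im0.
have r3 := fourier_residual_null 0 a0 ap lim im0.
have r4 := fourier_residual_null (- (pi / 2)) a0 ap lre re0.
split.
- apply: (cvg_trans _ (square_nullD r1 r2)); apply: near_eq_cvg; near=> n.
  apply: avg_eq => i _; rewrite -fourier_re//.
  have [] : L2C D (w n) /\ normC2 mD Doo (w n) <= 4 * normC2 mD Doo (g n) by near: n.
  by [].
- apply: (cvg_trans _ (square_nullD r3 (square_nullZ (-1) r4))); apply: near_eq_cvg; near=> n.
  apply: avg_eq => i _; rewrite mulN1r -fourier_im//.
  have [] : L2C D (w n) /\ normC2 mD Doo (w n) <= 4 * normC2 mD Doo (g n) by near: n.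
  by [].
Unshelve. all: by end_near.
Qed.

End FarField.

(** * The correlation of the far field at two directions *)

Lemma dyadic_scaling_cvg0 (R : realType) (K : R) : (fun n => (2 ^+ n)^-1 * K) @ \oo --> (0 : R).
Proof.
have h : (fun n => (2^-1) ^+ n) @ \oo --> (0 : R).
  by apply: cvg_expr; rewrite ger0_norm ?invr_ge0// invf_lt1// ltr1n.
have h2 : (fun n => (2^-1) ^+ n * K) @ \oo --> (0 * K : R).
  by apply: cvgM; [exact: h|exact: cvg_cst].
rewrite mul0r in h2; rewrite (_ : (fun n => _) = (fun n => (2^-1) ^+ n * K)); first exact: h2.
by apply/funext => n; rewrite exprVn.
Qed.

Lemma pair_limit (R : realType) (x y r s e : nat -> nat -> R) :
  square_bounded x -> square_bounded y -> square_null r -> square_null s ->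
  (fun n => avg n (fun i => x n i * y n i - e n i)) @ \oo --> (0 : R) ->
  (fun n => avg n (fun i => (x n i + r n i) * (y n i + s n i)) - avg n (e n)) @ \oo --> (0 : R).
Proof.
move=> bx by_ r0 s0 xy0.
have h : (fun n => (avg n (fun i => (x n i + r n i) * (y n i + s n i)) -
    avg n (fun i => x n i * y n i)) + avg n (fun i => x n i * y n i - e n i)) @ \oo --> (0 + 0 : R).
  by apply: cvgD; [exact: avg_perturb|exact: xy0].
rewrite addr0 in h.
rewrite (_ : (fun n => _) = (fun n => (avg n (fun i => (x n i + r n i) * (y n i + s n i)) -
    avg n (fun i => x n i * y n i)) + avg n (fun i => x n i * y n i - e n i))); first exact: h.
apply/funext => n.
have -> : avg n (fun i => x n i * y n i - e n i) = avg n (fun i => x n i * y n i) + -1 * avg n (e n).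
  by rewrite -avgZ -avgD; apply: avg_eq => i _; ring.
ring.
Qed.

Section Correlation.
Local Open Scope complex_scope.
Context d (Omega : measurableType d) (R : realType)
  (P : probability Omega R) (D : set (R3 R))
  (B : (R3 R -> R) -> {RV P >-> R}).
Hypothesis hB : white_noise D B.
Notation X := (R3 R).
Variables (mD : measurable D) (Doo : (leb3 R D < +oo)%E).
Notation lebD := (lebD mD Doo).
Variable L : R.
Hypothesis L0 : 0 < L.
Hypothesis DL : D `<=` cube 0 L.
Variables (sigma V f : X -> R) (S v F : R).
Hypothesis ms : measurable_fun [set: X] sigma.
Hypothesis S0 : 0 <= S.
Hypothesis sS : {ae leb3 R, forall x, `|sigma x ^+ 2| <= S}.
Hypothesis mV : measurable_fun [set: X] V.
Hypothesis Vv : {ae leb3 R, forall x, `|V x| <= v}.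
Hypothesis mf : measurable_fun [set: X] f.
Hypothesis fF : {ae leb3 R, forall x, `|f x| <= F}.
Variable N : X -> R -> Omega -> R[i].
Hypothesis hN : is_noise_contribution D B sigma V N.
Variables (a b : nat) (k : nat -> R) (s s' : nat -> nat -> sphere R) (xi : X).
Hypotheses (a0 : (0 < a)%N) (b0 : (0 < b)%N).
Hypothesis k0 : forall n, 0 < k n.
Hypothesis ksmall : forall n, small_at mD Doo (n.+1%:R^-1) (k n).
Let p n i := dilate (k n) (sval (s n i)).
Let q n i := dilate (k n) (sval (s' n i)).
Hypothesis ap : forall n, increasing_third L a (2 ^ n) (p n).
Hypothesis bq : forall n, increasing_third L b (2 ^ n) (q n).
Hypothesis pq : forall n i y, (i < 2 ^ n)%N -> dot3 (p n i) y - dot3 (q n i) y = dot3 xi y.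
Variable dir : X.

Let sin_phase : R := - (pi / 2).

Lemma eventually_small : \forall n \near \oo, 16 * v ^+ 2 * inv4pi R ^+ 2 * n.+1%:R^-1 <= 1.
Proof.
have h : (fun n => 16 * v ^+ 2 * inv4pi R ^+ 2 * n.+1%:R^-1) @ \oo --> (0 : R).
  rewrite -(mulr0 (16 * v ^+ 2 * inv4pi R ^+ 2)).
  by apply: cvgM; [exact: cvg_cst|exact: cvg_harmonic].
have hN1 := cvgr0_norm_lt _ h _ (@ltr01 R); near=> n.
apply: (le_trans (ler_norm _)); apply/ltW; near: n; exact: hN1.
Unshelve. all: by end_near.
Qed.

Lemma source_L2C : L2C D (fun x => (- f x)%:C).
Proof.
split; last exact: (l2_L2 (l2_0 lebD)).
apply: l2_L2; exact: (l2N (l2_ae_bounded mf (ae_leb3_lebD mD Doo fF))).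
Qed.

Lemma source_null : (fun n : nat => (2 ^+ n)^-1 * normC2 mD Doo (fun x => (- f x)%:C)) @ \oo --> (0 : R).
Proof. exact: dyadic_scaling_cvg0. Qed.

(** Multiplication by the bounded potential; 1 + v^2 is a convenient bound for v. *)
Lemma potential_noise (z : X -> R[i]) :
  l2 lebD (fun x => complex.Re (z x)) -> l2 lebD (fun x => complex.Im (z x)) ->
  L2C D (fun x => (V x)%:C * z x) /\
  normC2 mD Doo (fun x => (V x)%:C * z x) <= (1 + v ^+ 2) ^+ 2 *
    (dot lebD (fun x => complex.Re (z x)) (fun x => complex.Re (z x)) +
     dot lebD (fun x => complex.Im (z x)) (fun x => complex.Im (z x))).
Proof.
move=> lr li.
have V2 : {ae leb3 R, forall x, `|V x ^+ 2| <= v ^+ 2}.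
  by apply: filterS Vv => x; exact: sqr_le_norm.
have [r1 r2] := l2_ae_mul mV (sqr_ge0 v) V2 lr.
have [i1 i2] := l2_ae_mul mV (sqr_ge0 v) V2 li.
have Er : (fun x => complex.Re ((V x)%:C * z x)) = (fun x => V x * complex.Re (z x)).
  by apply/funext => x; case: (z x) => u w /=; ring.
have Ei : (fun x => complex.Im ((V x)%:C * z x)) = (fun x => V x * complex.Im (z x)).
  by apply/funext => x; case: (z x) => u w /=; ring.
split; first by split; rewrite ?Er ?Ei; exact: (@l2_L2 _ _ mD Doo).
rewrite /normC2 /re_on /im_on Er Ei (dot_restrict mD Doo (l2_meas r1)) (dot_restrict mD Doo (l2_meas i1)).
by rewrite mulrDr lerD.
Qed.

Lemma dot_pair t u n i : dot lebD (fun z => sigma z * wave (p n i) t z) (fun z => sigma z * wave (q n i) u z) =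
  \int[lebD]_z (sigma z ^+ 2 * (wave (p n i) t z * wave (q n i) u z)).
Proof. by apply: eq_Rintegral => z _; ring. Qed.

Lemma intg_pair t u n i : intg lebD (fun z => sigma z ^+ 2 * (wave (p n i) t z * wave (q n i) u z)).
Proof.
have := l2_mul (l2_sigma_wave mD Doo ms S0 sS (p n i) t) (l2_sigma_wave mD Doo ms S0 sS (q n i) u).
by congr intg; apply/funext => z; ring.
Qed.

(** cos p cos q + sin p sin q = cos (p - q), which does not depend on i. *)
Lemma covariance_re n i : (i < 2 ^ n)%N ->
  dot lebD (fun z => sigma z * wave (p n i) 0 z) (fun z => sigma z * wave (q n i) 0 z) +
  dot lebD (fun z => sigma z * wave (p n i) sin_phase z) (fun z => sigma z * wave (q n i) sin_phase z) =
  dot lebD (fun z => sigma z ^+ 2) (wave xi 0).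
Proof.
move=> ni; rewrite !dot_pair -(RintegralD measurableT (intg_pair 0 0 n i) (intg_pair sin_phase sin_phase n i)).
apply: eq_Rintegral => z _; rewrite -mulrDr; congr (_ * _).
rewrite /wave -(pq z ni) !addr0 /sin_phase !cosBpihalf.
by rewrite -cosB.
Qed.

(** cos p sin q - sin p cos q = - sin (p - q), which does not depend on i. *)
Lemma covariance_im n i : (i < 2 ^ n)%N ->
  dot lebD (fun z => sigma z * wave (p n i) 0 z) (fun z => sigma z * wave (q n i) sin_phase z) -
  dot lebD (fun z => sigma z * wave (p n i) sin_phase z) (fun z => sigma z * wave (q n i) 0 z) =
  - dot lebD (fun z => sigma z ^+ 2) (wave xi sin_phase).
Proof.
move=> ni; rewrite !dot_pair -(RintegralB measurableT (intg_pair 0 sin_phase n i) (intg_pair sin_phase 0 n i)).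
have ix : intg lebD (fun z => sigma z ^+ 2 * wave xi sin_phase z).
  have := intgB (intg_pair sin_phase 0 n i) (intg_pair 0 sin_phase n i).
  congr intg; apply/funext => z; rewrite -mulrBr; congr (_ * _).
  by rewrite /wave -(pq z ni) !addr0 /sin_phase !cosBpihalf sinB.
rewrite -mulN1r /dot -(RintegralZl _ measurableT ix).
apply: eq_Rintegral => z _; rewrite -mulrBr mulN1r -[RHS]mulrN; congr (_ * _).
by rewrite /wave -(pq z ni) !addr0 /sin_phase !cosBpihalf sinB opprB.
Qed.

Lemma noise_null (Z : nat -> X -> Omega -> R[i]) w :
  (forall n, l2 lebD (fun x => complex.Re (Z n x w)) /\ l2 lebD (fun x => complex.Im (Z n x w))) ->
  (fun n => (2 ^+ n)^-1 *
    (dot lebD (fun x => complex.Re (Z n x w)) (fun x => complex.Re (Z n x w)) +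
     dot lebD (fun x => complex.Im (Z n x w)) (fun x => complex.Im (Z n x w)))) @ \oo --> (0 : R) ->
  (fun n => (2 ^+ n)^-1 * normC2 mD Doo (fun x => (V x)%:C * Z n x w)) @ \oo --> (0 : R).
Proof.
move=> lZ hZ0.
pose G n := dot lebD (fun x => complex.Re (Z n x w)) (fun x => complex.Re (Z n x w)) +
            dot lebD (fun x => complex.Im (Z n x w)) (fun x => complex.Im (Z n x w)).
have h : (fun n => (1 + v ^+ 2) ^+ 2 * ((2 ^+ n)^-1 * G n)) @ \oo --> (0 : R).
  by rewrite -(mulr0 ((1 + v ^+ 2) ^+ 2)); apply: cvgM; [exact: cvg_cst|exact: hZ0].
apply: (squeeze_cvgr _ (cvg_cst 0) h); near=> n; apply/andP; split.
  by rewrite mulr_ge0 ?normC2_ge0 ?invr_ge0 ?exprn_ge0.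
rewrite [leRHS]mulrCA ler_wpM2l ?invr_ge0 ?exprn_ge0//.
exact: (potential_noise (lZ n).1 (lZ n).2).2.
Unshelve. all: by end_near.
Qed.

Lemma resolvent_bounds (g : nat -> X -> R[i]) : (forall n, L2C D (g n)) ->
  \forall n \near \oo, L2C D (inv_I_VRk D V (k n) (g n)) /\
    normC2 mD Doo (inv_I_VRk D V (k n) (g n)) <= 4 * normC2 mD Doo (g n).
Proof.
move=> Lg; apply: filterS eventually_small => n sn.
apply: (inv_I_VRk_bound (ksmall n) _ sn Vv (Lg n)).
by rewrite invr_ge0.
Qed.

(** The complex number c is the contribution of the source, z that of the part
of the noise scattered by the potential. *)
Lemma far_fieldE (x0 : X) (kk : R) w (c z : R[i]) :
  cintegral D (fun y => expi (- (kk * dot3 x0 y)) *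
    inv_I_VRk D V kk (fun x => (- f x)%:C) y) = c ->
  N x0 kk w = noiseC B (fun y => (sigma y)%:C *
    expi (- (kk * dot3 x0 y))) w + z ->
  far_field D V f N false x0 kk dir w =
  (inv4pi R * - (B (fun y => sigma y * wave (dilate kk x0) 0 y) w + (complex.Re z + -1 * complex.Re c))) +i*
  (inv4pi R * (B (fun y => sigma y * wave (dilate kk x0) sin_phase y) w + (complex.Im c + -1 * complex.Im z))).
Proof.
move=> Ec EN; rewrite /far_field.
have -> : (fun x => false%:R * ((V x)%:C * incident kk dir x) - (f x)%:C) = (fun x => (- f x)%:C).
  by apply/funext => x; rewrite mul0r sub0r rmorphN.
rewrite Ec EN (noiseC_wave hB); last exact: (l2_sigma_wave mD Doo ms S0 sS (dilate kk x0) sin_phase).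
rewrite -/sin_phase -/(inv4pi R).
move: (B _ w) (B _ w) => x y; case: c {Ec} => c1 c2; case: z {EN} => z1 z2.
by apply/eqP; rewrite eq_complex/=; apply/andP; split; apply/eqP; ring.
Qed.

Let U n i w := far_field D V f N false (sval (s n i)) (k n) dir w.
Let U' n i w := far_field D V f N false (sval (s' n i)) (k n) dir w.

(** The two limits are the real and the imaginary part of (4 pi)^-2 times the
integral of sigma^2 e^{-i xi.y}. The covariances of the four real products of
noise integrals depend on i, but not their combinations in
[covariance_re] and [covariance_im]. *)
Theorem correlation_limit : {ae P, forall w,
  (fun n => avg n (fun i => complex.Re (U n i w) * complex.Re (U' n i w) +
                            complex.Im (U n i w) * complex.Im (U' n i w))) @ \oo -->
    (inv4pi R ^+ 2 * dot lebD (fun z => sigma z ^+ 2) (wave xi 0) : R) /\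
  (fun n => avg n (fun i => complex.Im (U n i w) * complex.Re (U' n i w) -
                            complex.Re (U n i w) * complex.Im (U' n i w))) @ \oo -->
    (- (inv4pi R ^+ 2 * dot lebD (fun z => sigma z ^+ 2) (wave xi sin_phase)) : R)}.
Proof.
have [_ _ hN'] := hN.
have hZ n : {Z | is_Rk_noise B sigma (k n) Z & forall xhat : X, enorm xhat = 1 ->
    {ae P, forall w, N xhat (k n) w =
       noiseC B (fun y => (sigma y)%:C * expi (- (k n * dot3 xhat y))) w
       + cintegral D (fun y => expi (- (k n * dot3 xhat y)) *
           inv_I_VRk D V (k n) (fun x => (V x)%:C * Z x w) y)}}.
  by apply: cid2; exact: hN'.
pose Z n := s2val (hZ n).
have Z1 n : is_Rk_noise B sigma (k n) (Z n) := s2valP (hZ n).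
have Z2 n := s2valP' (hZ n).
pose cf n (x : X) := cintegral D (fun y => expi (- (k n * dot3 x y)) *
  inv_I_VRk D V (k n) (fun x => (- f x)%:C) y).
pose cz n (x : X) w := cintegral D (fun y => expi (- (k n * dot3 x y)) *
  inv_I_VRk D V (k n) (fun x => (V x)%:C * Z n x w) y).
have aeN (t : nat -> nat -> sphere R) : {ae P, forall w, forall n i,
    N (sval (t n i)) (k n) w = noiseC B (fun y => (sigma y)%:C *
      expi (- (k n * dot3 (sval (t n i)) y))) w + cz n (sval (t n i)) w}.
  by apply: ae_foralln => n; apply: ae_foralln => i; exact: Z2 (svalP (t n i)).
have gauss (t u : R) := gaussian_product_average hB mD Doo L0 DL ms S0 sS t u a0 b0 ap bq.
have g1 := gauss 0 0; have g2 := gauss sin_phase sin_phase.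
have g3 := gauss 0 sin_phase; have g4 := gauss sin_phase 0.
have aeZ := noise_field_average hB mD Doo ms S0 sS Z1.
apply: filterS2 (filterI (aeN s) (aeN s')) (filterI aeZ (filterI (filterI g1 g2) (filterI g3 g4))).
move=> w [Ns Ns'] [[lZ nZ] [[{}g1 {}g2] [{}g3 {}g4]]].
have wf := resolvent_bounds (fun _ => source_L2C).
have wz := @resolvent_bounds (fun n x => (V x)%:C * Z n x w)
  (fun n => (potential_noise (lZ n).1 (lZ n).2).1).
have nz := noise_null lZ nZ.
have [f1 f2] := fourier_null L0 DL a0 ap wf source_null.
have [f1' f2'] := fourier_null L0 DL b0 bq wf source_null.
have [z1 z2] := fourier_null L0 DL a0 ap wz nz.
have [z1' z2'] := fourier_null L0 DL b0 bq wz nz.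
pose X1 n i := B (fun y => sigma y * wave (p n i) 0 y) w.
pose X2 n i := B (fun y => sigma y * wave (p n i) sin_phase y) w.
pose Y1 n i := B (fun y => sigma y * wave (q n i) 0 y) w.
pose Y2 n i := B (fun y => sigma y * wave (q n i) sin_phase y) w.
pose r1 n i := complex.Re (cz n (sval (s n i)) w) + -1 * complex.Re (cf n (sval (s n i))).
pose r2 n i := complex.Im (cf n (sval (s n i))) + -1 * complex.Im (cz n (sval (s n i)) w).
pose t1 n i := complex.Re (cz n (sval (s' n i)) w) + -1 * complex.Re (cf n (sval (s' n i))).
pose t2 n i := complex.Im (cf n (sval (s' n i))) + -1 * complex.Im (cz n (sval (s' n i)) w).
have r10 : square_null r1 := square_nullD z1 (square_nullZ (-1) f1).
have r20 : square_null r2 := square_nullD f2 (square_nullZ (-1) z2).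
have t10 : square_null t1 := square_nullD z1' (square_nullZ (-1) f1').
have t20 : square_null t2 := square_nullD f2' (square_nullZ (-1) z2').
have UE n i : U n i w = (inv4pi R * - (X1 n i + r1 n i)) +i* (inv4pi R * (X2 n i + r2 n i)).
  exact: (far_fieldE erefl (Ns n i)).
have U'E n i : U' n i w = (inv4pi R * - (Y1 n i + t1 n i)) +i* (inv4pi R * (Y2 n i + t2 n i)).
  exact: (far_fieldE erefl (Ns' n i)).
have [bX1 bY1 c11] := g1; have [bX2 bY2 c22] := g2.
have [_ _ c12] := g3; have [_ _ c21] := g4.
have l11 := pair_limit bX1 bY1 r10 t10 c11.
have l22 := pair_limit bX2 bY2 r20 t20 c22.
have l12 := pair_limit bX1 bY2 r10 t20 c12.
have l21 := pair_limit bX2 bY1 r20 t10 c21.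
pose e (t u : R) n i := dot lebD (fun z => sigma z * wave (p n i) t z)
  (fun z => sigma z * wave (q n i) u z).
split.
- pose K := dot lebD (fun z => sigma z ^+ 2) (wave xi 0).
  have h : (fun n => inv4pi R ^+ 2 * (((avg n (fun i => (X1 n i + r1 n i) * (Y1 n i + t1 n i)) - avg n (e 0 0 n)) +
      (avg n (fun i => (X2 n i + r2 n i) * (Y2 n i + t2 n i)) - avg n (e sin_phase sin_phase n))) + K)) @ \oo -->
      (inv4pi R ^+ 2 * ((0 + 0) + K) : R).
    apply: cvgM; first exact: cvg_cst.
    by apply: cvgD; [apply: cvgD; [exact: l11|exact: l22]|exact: cvg_cst].
  rewrite !add0r in h.
  apply: (cvg_trans _ h); apply: near_eq_cvg; near=> n.
  have -> : K = avg n (e 0 0 n) + avg n (e sin_phase sin_phase n).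
    by rewrite -avgD -[LHS](avg_cst n); apply: avg_eq => i ni; rewrite /K -(covariance_re ni).
  have ring1 (x x' y y' : R) : x - x' + (y - y') + (x' + y') = x + y by ring.
  rewrite ring1 -avgD -avgZ; apply: avg_eq => i _; rewrite UE U'E.
  move: (X1 n i + _) (X2 n i + _) (Y1 n i + _) (Y2 n i + _) => u1 u2 u3 u4 /=; ring.
- pose K := dot lebD (fun z => sigma z ^+ 2) (wave xi sin_phase).
  have h : (fun n => inv4pi R ^+ 2 * (((avg n (fun i => (X1 n i + r1 n i) * (Y2 n i + t2 n i)) - avg n (e 0 sin_phase n)) -
      (avg n (fun i => (X2 n i + r2 n i) * (Y1 n i + t1 n i)) - avg n (e sin_phase 0 n))) - K)) @ \oo -->
      (inv4pi R ^+ 2 * ((0 - 0) - K) : R).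
    apply: cvgM; first exact: cvg_cst.
    by apply: cvgB; [apply: cvgB; [exact: l12|exact: l21]|exact: cvg_cst].
  rewrite subr0 sub0r mulrN in h.
  apply: (cvg_trans _ h); apply: near_eq_cvg; near=> n.
  have -> : K = -1 * (avg n (e 0 sin_phase n) + -1 * avg n (e sin_phase 0 n)).
    rewrite -avgZ -avgD -avgZ -[LHS](avg_cst n); apply: avg_eq => i ni.
    by rewrite !mulN1r /K -[LHS]opprK -(covariance_im ni).
  have ring1 (x x' y y' : R) : x - x' - (y - y') - -1 * (x' + -1 * y') = x + -1 * y by ring.
  rewrite ring1 -avgZ -avgD -avgZ; apply: avg_eq => i _; rewrite UE U'E.
  move: (X1 n i + _) (X2 n i + _) (Y1 n i + _) (Y2 n i + _) => u1 u2 u3 u4 /=; ring.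
Unshelve. all: by end_near.
Qed.

End Correlation.

(** * Recovery *)

Section Recovery.
Variable R : realType.
Notation X := (R3 R).
Variables (D : set X) (mD : measurable D) (Doo : (leb3 R D < +oo)%E).
Notation lebD := (lebD mD Doo).
Variable L : R.
Hypothesis L0 : 0 < L.
Hypothesis DL : D `<=` cube 0 L.

Lemma dilate_enorm (k : R) (x : X) : 0 <= k -> enorm (dilate k x) = k * enorm x.
Proof.
move=> k0; rewrite /enorm.
have -> : dot3 (dilate k x) (dilate k x) = k ^+ 2 * dot3 x x by rewrite /dot3/=; ring.
by rewrite sqrtrM ?sqr_ge0// sqrtr_sqr ger0_norm.
Qed.

Lemma exists_unit : exists e : X, enorm e = 1.
Proof. by exists (1, 0, 0); rewrite /enorm /dot3/= !mulr0 !addr0 mulr1 sqrtr1. Qed.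

Lemma exists_direction (p : X) (k : R) : 0 < k ->
  exists s : sphere R, enorm p = k -> dilate k (sval s) = p.
Proof.
move=> k0; have [pk|pk] := eqVneq (enorm p) k; last first.
  have [e e1] := exists_unit; exists (exist (fun x : X => enorm x = 1) e e1) => h.
  by rewrite h eqxx in pk.
have u : enorm (dilate k^-1 p) = 1.
  by rewrite dilate_enorm ?invr_ge0 ?ltW// pk mulVf// gt_eqF.
exists (exist (fun x : X => enorm x = 1) _ u) => _ /=; rewrite /dilate/= !mulrA divff ?gt_eqF// !mul1r.
by case: (p) => -[].
Qed.

Record probes := Probes {
  wavenumber : nat -> posreal R ;
  left_dir : nat -> nat -> sphere R ;
  right_dir : nat -> nat -> sphere R }.

(** The data that the recovery map looks at for the lattice point m. They depend
on D only: neither on the unknowns nor on the realization. *)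
Definition admissible_probes (m : int * int * int) (c : probes) : Prop :=
  exists a b : nat, [/\ (0 < a)%N, (0 < b)%N,
    forall n, small_at mD Doo (n.+1%:R^-1) (sval (wavenumber c n)),
    forall n i, (i < 2 ^ n)%N ->
      (dilate (sval (wavenumber c n)) (sval (left_dir c n i))).2 * L = (a + i)%:R /\
      (dilate (sval (wavenumber c n)) (sval (right_dir c n i))).2 * L = (b + i)%:R &
    forall n i y, (i < 2 ^ n)%N ->
      dot3 (dilate (sval (wavenumber c n)) (sval (left_dir c n i))) y -
      dot3 (dilate (sval (wavenumber c n)) (sval (right_dir c n i))) y =
      dot3 (freq L m) y].

Lemma exists_probes m : exists c, admissible_probes m c.
Proof.
have [a [b [a0 b0 H]]] := exists_points L0 m.
have H1 n : exists c : posreal R * (nat -> sphere R) * (nat -> sphere R),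
    small_at mD Doo (n.+1%:R^-1) (sval c.1.1) /\ forall i, (i < 2 ^ n)%N ->
    [/\ (dilate (sval c.1.1) (sval (c.1.2 i))).2 * L = (a + i)%:R,
      (dilate (sval c.1.1) (sval (c.2 i))).2 * L = (b + i)%:R &
      forall y, dot3 (dilate (sval c.1.1) (sval (c.1.2 i))) y -
        dot3 (dilate (sval c.1.1) (sval (c.2 i))) y = dot3 (freq L m) y].
  have [N HN] := H (2 ^ n)%N.
  have e0 : 0 < n.+1%:R^-1 :> R by rewrite invr_gt0.
  have [k Nk sk] := exists_small mD Doo (maxn N 1) e0.
  have k0 : 0 < k%:R :> R by rewrite ltr0n (leq_trans _ Nk)// leq_max orbT.
  have [p Hp] : exists p : nat -> X, forall i, (i < 2 ^ n)%N ->
    [/\ enorm (p i) = k%:R, enorm (p i - freq L m) = k%:R,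
      (p i).2 * L = (a + i)%:R & (p i - freq L m).2 * L = (b + i)%:R].
    by apply: HN; rewrite ler_nat (leq_trans _ Nk)// leq_maxl.
  pose sl i := projT1 (cid (exists_direction (p i) k0)).
  pose sr i := projT1 (cid (exists_direction (p i - freq L m) k0)).
  exists (exist (fun k : R => 0 < k) _ k0, sl, sr); split => // i ni.
  have [h1 h2 h3 h4] := Hp i ni.
  have el : dilate k%:R (sval (sl i)) = p i by rewrite /sl; case: cid => /= ? ->.
  have er : dilate k%:R (sval (sr i)) = p i - freq L m by rewrite /sr; case: cid => /= ? ->.
  split.
  - by change ((dilate k%:R (sval (sl i))).2 * L = (a + i)%:R); rewrite el.
  - by change ((dilate k%:R (sval (sr i))).2 * L = (b + i)%:R); rewrite er.
  move=> y; change (dot3 (dilate k%:R (sval (sl i))) y -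
    dot3 (dilate k%:R (sval (sr i))) y = dot3 (freq L m) y).
  by rewrite el er /dot3/=; ring.
pose c n := projT1 (cid (H1 n)).
have cP n := projT2 (cid (H1 n)).
exists (Probes (fun n => (c n).1.1) (fun n => (c n).1.2) (fun n => (c n).2)).
exists a, b; split => //=.
- by move=> n; exact: (cP n).1.
- by move=> n i ni; have [h1 h2 _] := (cP n).2 i ni.
- by move=> n i y ni; have [_ _ ->] := (cP n).2 i ni.
Qed.

(** Real part of the average of u(left) conj(u(right)). *)
Definition correlation_re (u : sphere R -> posreal R -> R[i]) (c : probes) (n : nat) : R :=
  let ul i := u (left_dir c n i) (wavenumber c n) in
  let ur i := u (right_dir c n i) (wavenumber c n) in
  avg n (fun i => complex.Re (ul i) * complex.Re (ur i) + complex.Im (ul i) * complex.Im (ur i)).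

(** Imaginary part of the average of u(left) conj(u(right)). *)
Definition correlation_im (u : sphere R -> posreal R -> R[i]) (c : probes) (n : nat) : R :=
  let ul i := u (left_dir c n i) (wavenumber c n) in
  let ur i := u (right_dir c n i) (wavenumber c n) in
  avg n (fun i => complex.Im (ul i) * complex.Re (ur i) - complex.Re (ul i) * complex.Im (ur i)).

Definition recovered (c : int * int * int -> probes) (u : sphere R -> posreal R -> R[i])
    (g : X -> R) : Prop :=
  [/\ measurable_fun [set: X] g, exists C, {ae leb3 R, forall x, `|g x| <= C},
    supported_in D g &
    forall m, correlation_re u (c m) @ \oo --> (inv4pi R ^+ 2 * dot lebD g (wave (freq L m) 0) : R) /\
      correlation_im u (c m) @ \oo --> (- (inv4pi R ^+ 2 * dot lebD g (wave (freq L m) (- (pi / 2)))) : R)].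

Lemma ae_lebD_leb3 (Q : X -> Prop) : {ae lebD, forall x, Q x} -> {ae leb3 R, forall x, D x -> Q x}.
Proof.
move=> [A [mA A0 QA]]; exists (A `&` D); split => //.
  exact: measurableI.
move=> x /= h; split; last by apply: contrapT => nD; apply: h.
by apply: QA => /= q; apply: h.
Qed.

(** The limits determine the integrals of g against all waves of the shifted
lattice, hence g on D. *)
Lemma recovered_unique c u g1 g2 : recovered c u g1 -> recovered c u g2 ->
  {ae leb3 R, forall x, g1 x = g2 x}.
Proof.
move=> [m1 [C1 b1] s1 l1] [m2 [C2 b2] s2 l2'].
have lg1 := l2_ae_bounded m1 (ae_leb3_lebD mD Doo b1).
have lg2 := l2_ae_bounded m2 (ae_leb3_lebD mD Doo b2).
have ig : intg lebD (fun x => g1 x - g2 x).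
  by apply: intgB; [exact: (intg_ae_bounded m1 (ae_leb3_lebD mD Doo b1))|
    exact: (intg_ae_bounded m2 (ae_leb3_lebD mD Doo b2))].
have c40 : inv4pi R ^+ 2 != 0 by rewrite expf_neq0// invr_neq0// mulf_neq0// gt_eqF// pi_gt0.
have U : {ae lebD, forall x, g1 x - g2 x = 0}.
  apply: (shifted_fourier_unique L0 DL ig) => m; have [r1 i1] := l1 m; have [r2 i2] := l2' m.
  - rewrite [LHS](dotBl lg1 lg2 (l2_wave_lebD mD Doo (freq L m) 0)).
    by apply/eqP; rewrite subr_eq0; apply/eqP; exact: (mulfI c40 (cvg_unique _ r1 r2)).
  - rewrite [LHS](dotBl lg1 lg2 (l2_wave_lebD mD Doo (freq L m) (- (pi / 2)))).
    by apply/eqP; rewrite subr_eq0; apply/eqP; exact: (mulfI c40 (oppr_inj (cvg_unique _ i1 i2))).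
apply: filterS3 (ae_lebD_leb3 U) s1 s2 => x h e1 e2.
have [Dx|nD] := pselect (D x); last by rewrite e1// e2.
by apply/eqP; rewrite -subr_eq0; apply/eqP; exact: h.
Qed.

End Recovery.

Lemma ae_countable d (T : measurableType d) (R : realType) (mu : {measure set T -> \bar R})
  (I : countType) (Q : I -> T -> Prop) :
  (forall i, {ae mu, forall x, Q i x}) -> {ae mu, forall x, forall i, Q i x}.
Proof.
move=> H.
have : {ae mu, forall x, forall n, if unpickle n is Some i then Q i x else True}.
  by apply: ae_foralln => n; case: unpickle => [i|]; [exact: H|exact: aeW].
by apply: filterS => x h i; have := h (pickle i); rewrite pickleK.
Qed.

Theorem theorem1p1 (R : realType) (D : set (R3 R))
    (hD : bounded_domain D) (hD0 : D 0)
    (d : measure_display) (Omega : measurableType d)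
    (P : probability Omega R) (hP : measure_is_complete P)
    (B : (R3 R -> R) -> {RV P >-> R}) (hB : white_noise D B) :
  exists T : (sphere R -> posreal R -> R[i]) -> (R3 R -> R),
    forall sigma V f : R3 R -> R, admissible D sigma V f ->
    forall N : R3 R -> R -> Omega -> R[i],
      is_noise_contribution D B sigma V N ->
    forall dir : sphere R,
      {ae P, forall w : Omega,
        {ae @leb3 R, forall x : R3 R,
          T (fun xhat k =>
               far_field D V f N false (sval xhat) (sval k) (sval dir) w) x
          = sigma x ^+ 2}}.
Proof.
have [oD _ _ bD] := hD.
have mD := open_measurable3 oD.
have [L L0 DL] := bounded_cube bD.
have Doo : (leb3 R D < +oo)%E.
  apply: (@le_lt_trans _ _ (leb3 R (cube 0 L))).
    by apply: le_measure; rewrite ?inE//; exact: measurable_cube.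
  by rewrite leb3_cube ?ltry// ltW.
pose c m := projT1 (cid (exists_probes mD Doo L0 m)).
have cP m : admissible_probes mD Doo L m (c m) := projT2 (cid (exists_probes mD Doo L0 m)).
(* The map uses the probes c, fixed before the unknowns are introduced. *)
exists (fun u => xget (fun=> 0) (recovered mD Doo L c u)).
move=> sigma V f [ms s2 Voo foo [ss _ _]] N hN dir.
have [ms2 [S S0 sS]] := Lfun_oo_bounded s2.
have [mV [v v0 Vv]] := Lfun_oo_bounded Voo.
have [mf [F F0 fF]] := Lfun_oo_bounded foo.
have lim m : {ae P, forall w,
  let u := (fun xhat k => far_field D V f N false (sval xhat) (sval k) (sval dir) w) in
  correlation_re u (c m) @ \oo -->
    (inv4pi R ^+ 2 * dot (lebD mD Doo) (fun x => sigma x ^+ 2) (wave (freq L m) 0) : R) /\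
  correlation_im u (c m) @ \oo -->
    (- (inv4pi R ^+ 2 * dot (lebD mD Doo) (fun x => sigma x ^+ 2) (wave (freq L m) (- (pi / 2)))) : R)}.
  have [a [b [a0 b0 sm ab pq]]] := cP m.
  exact: (correlation_limit hB L0 DL ms S0 sS mV Vv mf fF hN a0 b0
    (fun n => svalP (wavenumber (c m) n)) sm (fun n i ni => (ab n i ni).1)
    (fun n i ni => (ab n i ni).2) pq (sval dir)).
apply: filterS (ae_countable lim) => w {}lim.
set u := (fun xhat k => _) in lim *.
have rec : recovered mD Doo L c u (fun x => sigma x ^+ 2).
  split => //; first by exists S.
  by apply: filterS ss => x sx /sx ->; rewrite expr0n.
exact: (recovered_unique L0 DL (xgetI (fun=> 0) rec) rec).
Qed.
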